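(* Let $X_n$, $n\in\mathbb{N}$, be a sequence of Polish spaces, let $d_n$ be a Borel pseudo-metric on $X_n$ for each $n$, and let $p\ge 1$. Denote $E=E((X_n,d_n)_{n\in\mathbb{N}};p)$. Then (a) $\sum_{n\in\mathbb{N}}\delta(X_n)^p<+\infty$ and $(\ell 1)$ fails $\iff$ $E\sim_B E_0$ or $E$ is trivial; (b) $\sum_{n\in\mathbb{N}}\delta(X_n)^p<+\infty$ and $(\ell 1)$ holds $\iff$ $\mathbb{R}^{\mathbb{N}}/\ell_1\le_B E\le_B E(c_0;p)$; (c) $\sum_{n\in\mathbb{N}}\delta(X_n)^p=+\infty\iff E_1\le_B E$. Here $(\ell 1)$ is the condition: for every $c>0$ there exist $x,y\in\prod_{n\in\mathbb{N}}X_n$ such that $d_n(x(n),y(n))^p<c$ for all $n$ and $\sum_{n\in\mathbb{N}}d_n(x(n),y(n))^p=+\infty$.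
   Context: A Polish space is a separable, completely metrizable topological space. A Borel pseudo-metric on $X_n$ is a pseudo-metric $d_n$ on $X_n$ that is a Borel function on $X_n\times X_n$. For pseudo-metric spaces $(X_n,d_n)$ and $p\ge1$, $E((X_n,d_n)_{n\in\mathbb{N}};p)$ is the equivalence relation on $\prod_{n\in\mathbb{N}}X_n$ given by: $(x,y)\in E((X_n,d_n)_{n\in\mathbb{N}};p)$ iff $\sum_{n\in\mathbb{N}}d_n(x(n),y(n))^p<+\infty$. $E(c_0;p)$ is this relation when every $(X_n,d_n)$ is $c_0$, the Banach space of real sequences converging to $0$ with the sup norm, with its norm metric; so it is the relation on $c_0^{\mathbb{N}}$ given by $\sum_n\|x(n)-y(n)\|_{c_0}^p<+\infty$. $E$ is trivial if all elements of $\prod_{n\in\mathbb{N}}X_n$ are $E$-equivalent. For a pseudo-metric space $(X,d)$ and $\delta>0$, $(X,d)$ is $\delta$-separable if there is a countable set $S\subseteq X$ such that for every $u\in X$ there is $s\in S$ with $d(u,s)<\delta$. For a pseudo-metric space $(X,d)$, $\delta(X)=\inf\{\delta: X\text{ is }\delta\text{-separable}\}$. $E_0$ is the equivalence relation on $2^{\mathbb{N}}$: $(x,y)\in E_0\iff\exists m\,\forall n\ge m\,(x(n)=y(n))$. $E_1$ is the equivalence relation on $2^{\mathbb{N}\times\mathbb{N}}$: $(x,y)\in E_1\iff\exists m\,\forall n\ge m\,\forall k\,(x(n,k)=y(n,k))$. $\mathbb{R}^{\mathbb{N}}/\ell_1$ is the equivalence relation on $\mathbb{R}^{\mathbb{N}}$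 given by $x\sim y$ iff $\sum_n|x(n)-y(n)|<+\infty$. For equivalence relations $E,F$ on Polish spaces $X,Y$, $E\le_B F$ ($E$ is Borel reducible to $F$) means there is a Borel function $\theta:X\to Y$ such that $(x,y)\in E\iff(\theta(x),\theta(y))\in F$ for all $x,y\in X$; $E\sim_B F$ means $E\le_B F$ and $F\le_B E$.
   Formalization: The X_n are taken nonempty, and when some δ(X_n) is +∞ (inf of the empty set) convergence or divergence of Σδ(X_n)^p is judged by tails; otherwise one infinite δ(X_0) with the other X_n points makes E trivial but the sum infinite, so (a) and (c) fail. *)

(* Defs.v *)
From HB Require Import structures.
From mathcomp Require Import all_boot all_order all_algebra.
From mathcomp Require Import all_classical all_reals all_analysis.

Set Implicit Arguments.
Unset Strict Implicit.
Unset Printing Implicit Defensive.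

Import Order.TTheory GRing.Theory Num.Theory.
Import numFieldNormedType.Exports.

Local Open Scope classical_set_scope.
Local Open Scope ring_scope.

Record is_pseudometric (R : realType) (T : Type) (d : T -> T -> R) : Prop := {
  pseudometric_ge0 : forall x y, 0 <= d x y;
  pseudometric_xx : forall x, d x x = 0;
  pseudometric_sym : forall x y, d x y = d y x;
  pseudometric_triangle : forall x y z, d x z <= d x y + d y z }.

Record complete_metric (R : realType) (T : topologicalType)
    (rho : T -> T -> R) : Prop := {
  complete_metric_pseudometric : is_pseudometric rho;
  complete_metric_eq : forall x y, rho x y = 0 -> x = y;
  complete_metric_nbhs : forall (x : T) (A : set T),
    nbhs x A <-> exists2 e, 0 < e & [set y | rho x y < e] `<=` A;
  complete_metric_cvg : forall u : nat -> T,
    (forall e, 0 < e ->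
       exists N, forall m n, (N <= m)%N -> (N <= n)%N -> rho (u m) (u n) < e) ->
    exists l : T, u n @[n --> \oo] --> l }.

Definition polish (R : realType) (T : topologicalType) : Prop :=
  (exists2 S : set T, countable S & dense S) /\
  (exists rho : T -> T -> R, complete_metric rho).

Definition borel_set (T : topologicalType) : set (set T) := <<s @open T >>.

Definition borel_fun (T U : topologicalType) (f : T -> U) : Prop :=
  forall B : set U, borel_set B -> borel_set (f @^-1` B).

Record borel_pseudometric (R : realType) (T : topologicalType)
    (d : T -> T -> R) : Prop := {
  borel_pseudometric_pseudometric : is_pseudometric d;
  borel_pseudometric_borel : @borel_fun (T * T)%type R (fun z => d z.1 z.2) }.

Definition borel_reducible (T U : topologicalType)
    (E : T -> T -> Prop) (F : U -> U -> Prop) : Prop :=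
  exists2 theta : T -> U, borel_fun theta &
    forall x y, E x y <-> F (theta x) (theta y).

Definition borel_bireducible (T U : topologicalType)
    (E : T -> T -> Prop) (F : U -> U -> Prop) : Prop :=
  borel_reducible E F /\ borel_reducible F E.

Definition trivial_rel (T : Type) (E : T -> T -> Prop) : Prop :=
  forall x y, E x y.

Definition c0_pred (R : realType) : {pred nat -> R} :=
  fun u => `[< u n @[n --> \oo] --> (0 : R) >].

Record c0 (R : realType) :=
  MkC0 { c0_seq :> nat -> R; _ : c0_seq \in @c0_pred R }.

Section c0_space.
Variable R : realType.
Implicit Types u v : c0 R.

HB.instance Definition _ := [isSub for @c0_seq R].
HB.instance Definition _ := [Choice of c0 R by <:].

Lemma c0_submod_closed : submod_closed (@c0_pred R).
Proof.
split=> [|a u v /asboolP u0 /asboolP v0]; apply/asboolP.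
  exact: cvg_cst.
rewrite [X in _ --> X](_ : 0 = a * 0 + 0); last by rewrite mulr0 addr0.
by apply: cvgD => //; apply: cvgMr.
Qed.

HB.instance Definition _ :=
  GRing.isSubmodClosed.Build R (nat -> R) (@c0_pred R) c0_submod_closed.
HB.instance Definition _ := [SubChoice_isSubLmodule of c0 R by <:].

Definition c0_norm u : R := sup (range (fun n => `|c0_seq u n|)).

Let c0_has_sup u : has_sup (range (fun n => `|c0_seq u n|)).
Proof.
split; first by exists `|c0_seq u 0%N|, 0%N.
have /asboolP u0 : c0_seq u \in @c0_pred R by case: u.
have /cvg_seq_bounded/pinfty_ex_gt0[M _ uM] : cvgn (c0_seq u).
  by apply/cvg_ex; exists 0.
by exists M => _ [n _ <-]; exact: uM.
Qed.

Let c0_norm_ub u n : `|c0_seq u n| <= c0_norm u.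
Proof. by apply: sup_upper_bound; [exact: c0_has_sup|exists n]. Qed.

Let c0_norm_le u (M : R) : (forall n, `|c0_seq u n| <= M) -> c0_norm u <= M.
Proof.
move=> uM; apply: ge_sup; first by case: (c0_has_sup u).
by move=> _ [n _ <-].
Qed.

Let c0_normD u v : c0_norm (u + v) <= c0_norm u + c0_norm v.
Proof.
apply: c0_norm_le => n; rewrite (le_trans (ler_normD _ _))//.
by apply: lerD; exact: c0_norm_ub.
Qed.

Let c0_normZ_le a u : c0_norm (a *: u) <= `|a| * c0_norm u.
Proof.
by apply: c0_norm_le => n; rewrite normrM ler_wpM2l ?normr_ge0 ?c0_norm_ub.
Qed.

Let c0_normZ a u : c0_norm (a *: u) = `|a| * c0_norm u.
Proof.
apply/eqP; rewrite eq_le c0_normZ_le/=.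
have [->|a0] := eqVneq a 0.
  by rewrite normr0 mul0r (le_trans _ (c0_norm_ub _ 0%N)).
rewrite -ler_pdivlMl ?normr_gt0// -normfV.
by rewrite -{1}(scalerK a0 u); exact: c0_normZ_le.
Qed.

Let c0_norm_eq0 u : c0_norm u = 0 -> u = 0.
Proof.
move=> u0; apply/val_inj/funext => n; apply/normr0_eq0/le_anti.
by rewrite normr_ge0 andbT -u0; exact: c0_norm_ub.
Qed.

HB.instance Definition _ :=
  Lmodule_isNormed.Build R (c0 R) c0_normD c0_normZ c0_norm_eq0.

Lemma c0_normE u : `|u| = sup (range (fun n => `|c0_seq u n|)).
Proof. by []. Qed.

End c0_space.

Definition E_sum (R : realType) (X : nat -> Type)
    (d : forall n, X n -> X n -> R) (p : R) (x y : forall n, X n) : Prop :=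
  (\sum_(0 <= n <oo) (d n (x n) (y n) `^ p)%:E < +oo)%E.

Definition E_c0 (R : realType) (p : R) :
    prod_topology (fun _ : nat => c0 R) ->
    prod_topology (fun _ : nat => c0 R) -> Prop :=
  E_sum (fun _ (u v : c0 R) => `|u - v|) p.

Definition E0 (x y : cantor_space) : Prop :=
  exists m, forall n, (m <= n)%N -> x n = y n.

Definition E1 (x y : prod_topology (fun _ : nat * nat => bool)) : Prop :=
  exists m, forall n, (m <= n)%N -> forall k, x (n, k) = y (n, k).

Definition RN_mod_l1 (R : realType) (x y : prod_topology (fun _ : nat => R)) :
    Prop :=
  (\sum_(0 <= n <oo) `|x n - y n|%:E < +oo)%E.

Definition delta_separable (R : realType) (T : Type) (d : T -> T -> R)
    (e : R) : Prop :=
  exists2 S : set T, countable S &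
    forall u, exists2 s, S s & d u s < e.

(* [+oo] when [d] is [e]-separable for no [e] *)
Definition delta (R : realType) (T : Type) (d : T -> T -> R) : \bar R :=
  ereal_inf [set e%:E | e in [set e : R | 0 < e /\ delta_separable d e]].

Definition cond_l1 (R : realType) (X : nat -> Type)
    (d : forall n, X n -> X n -> R) (p : R) : Prop :=
  forall c : R, 0 < c -> exists x y : forall n, X n,
    (forall n, d n (x n) (y n) `^ p < c) /\
    (\sum_(0 <= n <oo) (d n (x n) (y n) `^ p)%:E = +oo)%E.

(* Convergence and divergence of a series of nonnegative terms, insensitive to
   finitely many terms even when some of these are [+oo]. When all the terms
   are finite this is [\sum_(0 <= n <oo) a n < +oo], resp. [= +oo]: see
   [series_convergesE] and [series_divergesE]. The tails matter for
   [a n = delta (d n) `^ p]: a single infinite [delta (d n)] makes the whole sum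
   infinite, although changing one coordinate does not affect [E_sum]. *)
Definition series_converges (R : realType) (a : nat -> \bar R) : Prop :=
  exists m, (\sum_(m <= n <oo) a n < +oo)%E.

Definition series_diverges (R : realType) (a : nat -> \bar R) : Prop :=
  forall m, (\sum_(m <= n <oo) a n = +oo)%E.

Lemma series_convergesE (R : realType) (a : nat -> \bar R) :
  (forall n, 0 <= a n < +oo)%E ->
  series_converges a <-> (\sum_(0 <= n <oo) a n < +oo)%E.
Proof.
move=> a_fin; split=> [[m am]|a0]; last by exists 0%N.
have a_ge0 n : (0 <= a n)%E by case/andP: (a_fin n).
rewrite (nneseries_split 0%N m)// add0n lte_add_pinfty//.
by apply: lte_sum_pinfty => n _; case/andP: (a_fin n).
Qed.

Lemma series_divergesE (R : realType) (a : nat -> \bar R) :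
  (forall n, 0 <= a n < +oo)%E ->
  series_diverges a <-> (\sum_(0 <= n <oo) a n = +oo)%E.
Proof.
move=> a_fin; split=> [/(_ 0%N)//|a0 m].
apply/eqP; rewrite -leye_eq leNgt; apply/negP => am.
have := (series_convergesE a_fin).1 (ex_intro _ m am).
by rewrite a0 ltxx.
Qed.

(* Main.v *)
(* If [\sum_n delta (X_n) ^ p] converges, each [X_n] has a countable [r_n]-net with
   [\sum_n r_n ^ p < oo], and Aharoni's embedding, truncated below scale [r_n], maps
   [X_n] into [c0] coarsely enough to reduce [E] to [E_c0]. If the sum diverges,
   pick radii [r_n] with [\sum_n r_n ^ p = oo] for which [X_n] is not
   [r_n]-separable. A fusion along the sigma-ideal of [r_n]-small sets gives a
   continuous copy of the hypercube graph of [2 ^ nat], whose edges have length at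
   least [r_n]; since [d_n] is continuous on a comeager set of pairs, Mycielski's
   theorem turns it into a Cantor set of [r_n / 2]-separated points, and [E1]
   reduces to [E] by sending [x] to the codes of its tails.

   [E1] does not reduce to [E_c0]: a Borel [theta] is continuous on a comeager set,
   where, the classes of [E_c0] being cosets of a separable group, any single row
   can be changed while moving [theta] arbitrarily little. Changing all the rows
   one after the other gives a pair that is [E_c0]- but not [E1]-equivalent.

   Under (l1), blocks of pairs [(x n, y n)] with small distances and sums at least
   [1] encode the reals of [[0, 1]] by thresholds, which reduces the [l1]-relation.
   It does not reduce to [E0], as already its restriction to the sequences
   [x n / (n + 1)], [x n] in [{0, 1}], does not, again by category. If (l1) fails,
   [d_n ^ p < c] is, for large [n], an equivalence relation with countably many
   classes, and [E] is equality of almost all the classes. *)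
Require Import Defs.
From HB Require Import structures.
From mathcomp Require Import all_boot all_order all_algebra.
From mathcomp Require Import all_classical all_reals all_analysis.
From mathcomp Require Import ring lra.

Set Implicit Arguments.
Unset Strict Implicit.
Unset Printing Implicit Defensive.

Import Order.TTheory GRing.Theory Num.Theory.
Import numFieldNormedType.Exports.

Local Open Scope classical_set_scope.
Local Open Scope ring_scope.

(** * The Cantor space: products, category and the Baire property *)

(** The obstacle in the divergent case is that [d n] is merely Borel: a lower bound [r <= d u v]
    does not survive limits. The set of such pairs is therefore presented as the projection of a
    closed set, and the fusion freezes, besides approximations of the vertices, finite parts of the
    witnesses of all edges; the bound then holds in the limit by closedness. The loss from [r] to
    [r / 2] comes from the triangle inequality: two vertices joined by an edge cannot both be within
    [r / 2] of a third point.

    Category arguments are run on finite lists of coordinates. Their limits must stay in the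
    comeager set at hand, so these fusions also enter, one by one, the dense open sets whose
    intersection is that set.

    Sums of [p]-th powers are handled without Minkowski's inequality: telescoping sums get the
    weights [2 ^+ k.+1], compensated by making the [k]-th increment small enough. The weights
    [1 / (n + 1)] tend to [0] but have an infinite sum: single flips become negligible, while
    flipping almost all bits leaves the class. *)

Lemma choice_prod (I : Type) (T : I -> Type) (P : forall i, T i -> Prop) :
  (forall i, exists x, P i x) -> exists f : forall i, T i, forall i, P i (f i).
Proof.
by move=> H; exists (fun i => sval (cid (H i))) => i; case: (cid (H i)).
Qed.

(** The engine of the fusions below: [P n] is the invariant of stage [n], and [Q n] links it to the
    next stage. *)
Lemma dependent_choice_from (T : Type) (P : nat -> T -> Prop)
    (Q : nat -> T -> T -> Prop) (t0 : T) :
  P 0%N t0 ->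
  (forall n t, P n t -> exists t', P n.+1 t' /\ Q n t t') ->
  exists f : nat -> T,
    f 0%N = t0 /\ forall n, P n (f n) /\ Q n (f n) (f n.+1).
Proof.
move=> P0 step.
have [F HF] : {F : nat -> {t | True} -> {t : T | True} |
    forall n t, P n (sval t) -> P n.+1 (sval (F n t)) /\
      Q n (sval t) (sval (F n t))}.
  apply: cid.
  have : forall nt : nat * {t : T | True}, exists t' : {t : T | True},
      P nt.1 (sval nt.2) -> P nt.1.+1 (sval t') /\ Q nt.1 (sval nt.2) (sval t').
    move=> [n [t ?]] /=; have [/step[t' ?]|nP] := pselect (P n t).
      by exists (exist _ t' I).
    by exists (exist _ t I).
  by move=> /choice[F HF]; exists (fun n t => F (n, t)) => n t /(HF (n, t)).
pose f := fix f n := if n is n'.+1 then F n' (f n') else exist _ t0 I.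
have Pf n : P n (sval (f n)) by elim: n => [//|n /HF[]].
exists (fun n => sval (f n)); split => // n; split; first exact: Pf.
exact: (HF n (f n) (Pf n)).2.
Qed.

Lemma countable_enum (T : Type) (S : set T) :
  countable S -> S !=set0 -> exists s : nat -> T, S = range s.
Proof.
move=> /countable_injP[f finj] [x0 Sx0].
have /choice[s Hs] : forall n, exists x, S x /\ ((exists2 y, S y & f y = n) -> f x = n).
  move=> n; have [[y Sy fy]|nex] := pselect (exists2 y, S y & f y = n).
    by exists y; split.
  by exists x0; split.
exists s; apply/seteqP; split=> [x Sx|_ [n _ <-]]; last exact: (Hs n).1.
exists (f x) => //; apply: finj; rewrite ?inE//; first exact: (Hs _).1.
by apply: (Hs _).2; exists x.
Qed.

Section prod_nbhs.
Context {I : eqType} {K : I -> topologicalType}.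

Lemma prod_nbhsP (x : prod_topology K) (A : set (prod_topology K)) :
  nbhs x A -> exists (s : seq I) (V : forall i, set (K i)),
    (forall i, open (V i) /\ V i (x i)) /\
    forall y, (forall i, i \in s -> V i (y i)) -> A y.
Proof.
pose F : set_system (prod_topology K) :=
  [set B | exists (s : seq I) (V : forall i, set (K i)),
    (forall i, open (V i) /\ V i (x i)) /\
    forall y, (forall i, i \in s -> V i (y i)) -> B y].
have FF : Filter F.
  split.
  - by exists [::], (fun i => setT); split => // i; split => //; exact: openT.
  - move=> B C [s [V [Vo VB]]] [s' [V' [Vo' VC]]].
    exists (s ++ s'), (fun i => V i `&` V' i); split.
      move=> i; have [oV Vx] := Vo i; have [oV' Vx'] := Vo' i.
      by split; [exact: openI|split].
    move=> y Vy; split; [apply: VB|apply: VC] => i si.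
      by have [] := Vy i; rewrite ?mem_cat ?si.
    by have [] := Vy i; rewrite ?mem_cat ?si ?orbT.
  - move=> B C BC [s [V [Vo VB]]]; exists s, V; split => // y /VB; exact: BC.
suff : F --> x by move=> Fx /Fx.
apply/cvg_sup => i B.
rewrite (@nbhsE (initial_topology (fun g : (forall i, K i) => g i))) => -[W [[U oU <-] Ux] UB].
(* [V] must be a family over all indices: it is [U] at [i], transported along [j = i], and
   everything elsewhere. *)
exists [:: i], (fun j => [set z | forall e : j = i, U (ecast j (K j) e z)]).
split; last first.
  move=> y Vy; apply: UB => /=.
  exact: (Vy i (mem_head _ _) erefl).
move=> j; have [e|ne] := eqVneq j i.
  case: _ / e U oU Ux UB => U oU Ux UB.
  rewrite (_ : [set _ | _] = U).
    by split.
  apply/seteqP; split=> z /=; first by move=> /(_ erefl).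
  by move=> Uz e; rewrite (eq_axiomK e).
rewrite (_ : [set _ | _] = setT); first by split=> //; exact: openT.
by apply/seteqP; split=> z //= _ e; rewrite e eqxx in ne.
Qed.

Lemma prod_continuous (T : topologicalType) (f : T -> prod_topology K) :
  (forall i, continuous (fun t => f t i)) -> continuous f.
Proof.
move=> fc t; apply/cvg_sup => i B.
rewrite (@nbhsE (initial_topology (fun g : (forall i, K i) => g i))) => -[W [[U oU <-] Ux] UB].
have : nbhs t ((fun t => f t i) @^-1` U) by apply: fc; exact: open_nbhs_nbhs.
by apply: filterS => z; exact: UB.
Qed.

End prod_nbhs.

Section cylinders.
Context {I : countType}.
Implicit Types (x y z : I -> bool) (s : seq I) (O A : set (I -> bool)).

Definition agree s x y := {in s, x =1 y}.

Lemma agree_refl s x : agree s x x. Proof. by []. Qed.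

Lemma agree_sym s x y : agree s x y -> agree s y x.
Proof. by move=> xy i si; rewrite xy. Qed.

Lemma agree_trans s x y z : agree s x y -> agree s y z -> agree s x z.
Proof. by move=> xy yz i si; rewrite xy// yz. Qed.

Lemma agree_sub s s' x y : {subset s <= s'} -> agree s' x y -> agree s x y.
Proof. by move=> ss' xy i /ss'; exact: xy. Qed.

Lemma agree_cat s s' x y :
  agree (s ++ s') x y <-> agree s x y /\ agree s' x y.
Proof.
split=> [xy|[xy xy'] i]; last by rewrite mem_cat => /orP[/xy|/xy'].
by split; apply: agree_sub xy => i si; rewrite mem_cat si ?orbT.
Qed.

Definition cyl_open O := forall x, O x -> exists s, forall y, agree s x y -> O y.

Definition cyl_dense O := forall x s, exists2 y, agree s x y & O y.

Definition comeager A := exists2 O : nat -> set (I -> bool),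
  forall j, cyl_open (O j) /\ cyl_dense (O j) & \bigcap_j O j `<=` A.

(** Baire's theorem, by a fusion of cylinders that enters [O n] at stage [n]. *)
Lemma comeager_dense A : comeager A -> cyl_dense A.
Proof.
move=> [ O Oo OA] x s.
(* Stage [n] also freezes the coordinate coded by [n], so that every coordinate is eventually
   fixed. *)
pose nxt := fun (n : nat) => (seq_of_opt (unpickle n) : seq I).
have [//| |f [f0 Hf]] := @dependent_choice_from ((I -> bool) * seq I)%type
    (fun _ _ => True)
    (fun n xs yt => [/\ agree xs.2 xs.1 yt.1, {subset xs.2 <= yt.2},
      {subset nxt n <= yt.2} & forall z, agree yt.2 yt.1 z -> O n z]) (x, s).
  move=> n [{}x {}s] _ /=; have [y xy Oy] := (Oo n).2 x s.
  have [t Ot] := (Oo n).1 y Oy.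
  exists (y, s ++ t ++ nxt n); split => //; split => //=.
  + by move=> i si; rewrite mem_cat si.
  + by move=> i si; rewrite !mem_cat si !orbT.
  + by move=> z /agree_cat[_ /agree_cat[/Ot]].
have mono m n : (m <= n)%N -> {subset (f m).2 <= (f n).2} /\
    agree (f m).2 (f m).1 (f n).1.
  elim: n => [|n IH]; first by rewrite leqn0 => /eqP->; split.
  rewrite leq_eqVlt => /orP[/eqP->|/IH[sub ag]]; first by split.
  have [_ [ag' sub' _ _]] := Hf n; split; first by move=> i /sub /sub'.
  exact: agree_trans ag (agree_sub sub ag').
pose y i := (f (pickle i).+1).1 i.
have fy n : agree (f n).2 (f n).1 y.
  move=> i si; rewrite /y.
  have [/mono[_ ->//]|/ltnW/mono[sub ag]] := leqP n (pickle i).+1.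
  rewrite ag//; have [_ [_ _ + _]] := Hf (pickle i).
  by apply; rewrite /nxt pickleK mem_head.
exists y; first by have := fy 0%N; rewrite f0.
apply: OA => n _; have [_ [_ _ _]] := Hf n; apply; exact: fy.
Qed.

Lemma comeager_sub A B : A `<=` B -> comeager A -> comeager B.
Proof. by move=> AB [ O Oo OA]; exists O => // x /OA /AB. Qed.

Lemma comeager_bigcap (J : countType) (A : J -> set (I -> bool)) :
  (forall j, comeager (A j)) -> comeager [set x | forall j, A j x].
Proof.
move=> cA.
have /choice[ O HO] : forall j, exists O : nat -> set (I -> bool),
  (forall k, cyl_open (O k) /\ cyl_dense (O k)) /\ \bigcap_k O k `<=` A j.
  by move=> j; have [ O ? ?] := cA j; exists O.
exists (fun n => if unpickle n is Some (j, k) then O j k else setT).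
  move=> n; case: (unpickle n) => [[j k]|]; first exact: (HO j).1.
  by split=> [x _|x s]; [exists [::]|exists x].
move=> x Ox j; apply: (HO j).2 => k _.
by have := Ox (pickle (j, k)) Logic.I; rewrite pickleK.
Qed.

Lemma comeagerI A B : comeager A -> comeager B -> comeager (A `&` B).
Proof.
move=> cA cB; have := @comeager_bigcap bool (fun b => if b then A else B).
move=> H; apply: comeager_sub (H _) => [x AB|[]//].
by split; [exact: (AB true)|exact: (AB false)].
Qed.

Lemma comeagerT : comeager setT.
Proof. by exists (fun=> setT) => // j; split=> x // s; [exists [::]|exists x]. Qed.

Lemma comeager_open O : cyl_open O -> cyl_dense O -> comeager O.
Proof. by move=> oO dO; exists (fun=> O) => // x /(_ 0%N Logic.I). Qed.

Definition baire_property (B : set (I -> bool)) := exists2 O, cyl_open O &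
  comeager [set x | B x <-> O x].

Definition exterior O := [set x | exists s, forall y, agree s x y -> ~ O y].

Lemma exterior_open O : cyl_open (exterior O).
Proof.
move=> x [s sO]; exists s => y xy; exists s => z yz; apply: sO.
exact: agree_trans xy yz.
Qed.

Lemma comeager_exterior O : cyl_open O -> comeager (O `|` exterior O).
Proof.
move=> oO; apply: comeager_open.
  move=> x [Ox|/exterior_open[s sO]]; last by exists s => y /sO ?; right.
  by have [s sO] := oO x Ox; exists s => y /sO ?; left.
move=> x s; have [[y xy Oy]|nO] := pselect (exists2 y, agree s x y & O y).
  by exists y => //; left.
exists x => //; right; exists s => y xy Oy; apply: nO; by exists y.
Qed.

(** For complements: off the boundary of [O], which is nowhere dense, the complement of [O]
    coincides with the open set [exterior O]. *)
Lemma baire_property_sigma : sigma_algebra setT baire_property.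
Proof.
split.
- by exists set0 => //; apply: comeager_sub comeagerT.
- move=> B [ O oO cB]; exists (exterior O); first exact: exterior_open.
  apply: comeager_sub (comeagerI cB (comeager_exterior oO)) => x [BO OE] /=.
  split=> [[_ nB]|[s sO]]; first by case: OE => // /BO.
  by split=> // /BO; exact: sO.
- move=> B cB.
  have /choice[U HU] : forall k, exists U, cyl_open U /\
      comeager [set x | B k x <-> U x].
    by move=> k; have [U ? ?] := cB k; exists U.
  exists (\bigcup_k U k).
    move=> x [k _ Ukx]; have [s Us] := (HU k).1 x Ukx.
    by exists s => y /Us ?; exists k.
  have := @comeager_bigcap nat _ (fun k => (HU k).2); apply: comeager_sub => x /= BU.
  by split=> -[k _ /BU ?]; exists k.
Qed.

Lemma baire_property_borel (B : set (prod_topology (fun _ : I => bool))) :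
  borel_set B -> baire_property B.
Proof.
have : sigma_algebra setT (baire_property : set (set (prod_topology (fun _ : I => bool)))).
  exact: baire_property_sigma.
move=> bps; apply: smallest_sub => // O oO; exists O; last first.
  by apply: comeager_sub comeagerT.
move=> x Ox; have /prod_nbhsP[s [V [Vo VO]]] : nbhs (x : prod_topology _) O.
  exact: open_nbhs_nbhs.
by exists s => y xy; apply: VO => i si; rewrite -xy//; exact: (Vo i).2.
Qed.

End cylinders.

Definition countable_base (T : topologicalType) (B : nat -> set T) :=
  (forall i, open (B i)) /\
  forall x A, nbhs x A -> exists2 i, B i x & B i `<=` A.

Section generic_continuity.
Context {I : countType} (T : topologicalType).

Definition continuous_on (C : set (I -> bool)) (f : (I -> bool) -> T) :=
  forall x, C x -> forall A, nbhs (f x) A ->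
    exists s, forall y, C y -> agree s x y -> A (f y).

(** The preimage of each basic open set is open up to a meager set; off these countably many meager
    sets, [f] is continuous. *)
Lemma borel_generically_continuous (B : nat -> set T)
    (f : prod_topology (fun _ : I => bool) -> T) :
  countable_base B -> borel_fun f ->
  exists2 C, comeager C & continuous_on C f.
Proof.
move=> [Bo Bb] fb.
have /choice[U HU] : forall k, exists U, cyl_open U /\
    comeager [set x | B k (f x) <-> U x].
  move=> k; have [|U ? ?] := @baire_property_borel I (f @^-1` B k).
    by apply: fb; exact: sub_sigma_algebra.
  by exists U.
exists [set x | forall k, B k (f x) <-> U k x].
  exact: (@comeager_bigcap I nat _ (fun k => (HU k).2)).
move=> x Cx A /Bb[k Bkx BA].
have [s sU] := (HU k).1 x ((Cx k).1 Bkx).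
by exists s => y Cy /sU /(Cy k).2 /BA.
Qed.

Lemma continuous_on_sub (C D : set (I -> bool)) f :
  C `<=` D -> continuous_on D f -> continuous_on C f.
Proof.
move=> CD fD x /CD Dx A /(fD x Dx)[s sA]; exists s => y /CD; exact: sA.
Qed.

End generic_continuity.

(** Translation in the group [2 ^ I]. It is a homeomorphism, so comeagerness is preserved when a
    fixed set of bits, finite or not, is flipped. *)
Definition bitxor (I : Type) (h x : I -> bool) : I -> bool := fun i => x i (+) h i.

Lemma bitxorK (I : Type) (h : I -> bool) : involutive (bitxor h).
Proof. by move=> x; apply/funext => i; rewrite /bitxor addbK. Qed.

Lemma agree_bitxor (I : countType) (s : seq I) (h x y : I -> bool) :
  agree s x y -> agree s (bitxor h x) (bitxor h y).
Proof. by move=> xy i si; rewrite /bitxor xy. Qed.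

Lemma cyl_open_bitxor (I : countType) (h : I -> bool) (O : set (I -> bool)) :
  cyl_open O -> cyl_open (bitxor h @^-1` O).
Proof.
move=> oO x /oO[s sO]; exists s => y xy; apply: sO; exact: agree_bitxor.
Qed.

Lemma cyl_dense_bitxor (I : countType) (h : I -> bool) (O : set (I -> bool)) :
  cyl_dense O -> cyl_dense (bitxor h @^-1` O).
Proof.
move=> dO x s; have [y xy Oy] := dO (bitxor h x) s.
exists (bitxor h y); last by rewrite /preimage /= bitxorK.
by rewrite -[x](bitxorK h); exact: agree_bitxor.
Qed.

Lemma comeager_bitxor (I : countType) (h : I -> bool) (A : set (I -> bool)) :
  comeager A -> comeager (bitxor h @^-1` A).
Proof.
move=> [ O Oo OA]; exists (fun j => bitxor h @^-1` O j).
  move=> j; split; first exact: cyl_open_bitxor (Oo j).1.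
  exact: cyl_dense_bitxor (Oo j).2.
by move=> x Ox; apply: OA => j _; exact: Ox.
Qed.

(** * Borel functions *)

Definition metrizes (R : realType) (T : topologicalType) (rho : T -> T -> R) :=
  is_pseudometric rho /\ forall (x : T) (A : set T),
    nbhs x A <-> exists2 e, 0 < e & [set y | rho x y < e] `<=` A.

Section countable_bases.
Context {R : realType}.

Lemma metric_ball_open (T : topologicalType) (rho : T -> T -> R) x e :
  metrizes rho -> open [set y | rho x y < e].
Proof.
move=> [pm nb]; rewrite openE => y /= xy; apply/nb.
exists (e - rho x y); first by rewrite subr_gt0.
move=> z /= yz; rewrite (le_lt_trans (pseudometric_triangle pm _ y _))//.
by rewrite addrC -ltrBrDr.
Qed.

Definition metric_balls (T : Type) (rho : T -> T -> R) (s : nat -> T) n : set T :=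
  if unpickle n is Some (i, q) then [set y | rho (s i) y < (q.+1%:R)^-1] else set0.

Lemma metric_balls_base (T : topologicalType) (rho : T -> T -> R)
    (s : nat -> T) : metrizes rho -> dense (range s) ->
  countable_base (metric_balls rho s).
Proof.
move=> mr dS; split.
  move=> n; rewrite /metric_balls; case: (unpickle n) => [[i q]|]; last exact: open0.
  exact: metric_ball_open.
move=> x A xA; have [e e0 eA] := (mr.2 x A).1 xA.
have [q qe] : exists q : nat, (q.+1%:R)^-1 < e / 2.
  have e20 : 0 < e / 2 by rewrite divr_gt0.
  by have := near_infty_natSinv_lt (PosNum e20) => -[q _ /(_ q (leqnn q))]; exists q.
have q0 : 0 < (q.+1%:R : R)^-1 by rewrite invr_gt0.
have [||y [/= yx]] := dS [set y | rho x y < (q.+1%:R)^-1].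
- by exists x => /=; rewrite (pseudometric_xx mr.1).
- exact: metric_ball_open.
move=> [i _ siy].
exists (pickle (i, q)); rewrite /metric_balls pickleK /=.
  by rewrite (pseudometric_sym mr.1) siy.
move=> z /= siz; apply: eA => /=.
rewrite (le_lt_trans (pseudometric_triangle mr.1 _ y _))// [e]splitr ltrD//.
  exact: lt_trans qe.
by rewrite -siy (lt_trans siz).
Qed.

Lemma metric_countable_base (T : topologicalType) (rho : T -> T -> R)
    (S : set T) (x0 : T) : metrizes rho -> countable S -> dense S ->
  exists B : nat -> set T, countable_base B.
Proof.
move=> mr cS dS.
have [|s Ss] := countable_enum cS.
  by have [||x [_ Sx]] := dS setT; [exists x0|exact: openT|exists x].
by exists (metric_balls rho s); apply: metric_balls_base => //; rewrite -Ss.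
Qed.

Lemma norm_metrizes (V : normedModType R) : metrizes (fun u v : V => `|u - v|).
Proof.
split.
  split=> [x y|x|x y|x y z]; first exact: normr_ge0.
  - by rewrite subrr normr0.
  - by rewrite distrC.
  - by rewrite (le_trans _ (ler_normD _ _))// addrA subrK.
move=> x A; rewrite -nbhs_ballE; split.
  by move=> [e e0 xA]; exists e => // y xy; apply: xA; rewrite -ball_normE.
by move=> [e e0 xA]; exists e => // y; rewrite -ball_normE => /xA.
Qed.

Lemma polish_countable_base (T : topologicalType) :
  polish R T -> [set: T] !=set0 -> exists B : nat -> set T, countable_base B.
Proof.
move=> [[S cS dS] [rho [pm _ nb _]]] [x0 _].
by apply: (@metric_countable_base T rho S x0) => //; split.
Qed.

Lemma real_countable_base : exists B : nat -> set R, countable_base B.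
Proof.
apply: (@metric_countable_base R (fun u v => `|u - v|) (range (@ratr R)) 0).
- exact: (@norm_metrizes R^o).
- exact: (sub_countable (card_image_le _ _) (countableP _)).
- exact: dense_rat.
Qed.

Lemma bool_countable_base : exists B : nat -> set bool, countable_base B.
Proof.
exists (fun n => [set b | b = (n == 0)%N]); split; first by move=> n; exact: (@discrete_open bool).
move=> x A /nbhs_singleton Ax; exists (if x then 0 else 1)%N; first by case: x {Ax}.
by move=> y /= ->; case: x Ax.
Qed.

End countable_bases.

Section borel_functions.

Lemma borel_setC (T : topologicalType) (A : set T) :
  borel_set A -> borel_set (~` A).
Proof. by rewrite -setTD; exact: sigma_algebraCD. Qed.

Lemma borel_setU_countable (T : topologicalType) (A : nat -> set T) :
  (forall n, borel_set (A n)) -> borel_set (\bigcup_n A n).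
Proof. exact: sigma_algebra_bigcup. Qed.

Lemma borel_open (T : topologicalType) (A : set T) : open A -> borel_set A.
Proof. exact: sub_sigma_algebra. Qed.

Lemma borel_setI_countable (T : topologicalType) (A : nat -> set T) :
  (forall n, borel_set (A n)) -> borel_set (\bigcap_n A n).
Proof.
move=> bA; rewrite -[X in borel_set X]setCK setC_bigcap; apply: borel_setC.
by apply: borel_setU_countable => n; exact: borel_setC.
Qed.

Lemma borel_setT (T : topologicalType) : borel_set [set: T].
Proof. by apply: borel_open; exact: openT. Qed.

Lemma borel_setI (T : topologicalType) (A B : set T) :
  borel_set A -> borel_set B -> borel_set (A `&` B).
Proof.
move=> bA bB; rewrite (_ : A `&` B = \bigcap_n (if n is 0%N then A else B)).
  by apply: borel_setI_countable => -[|n].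
apply/seteqP; split=> [x [Ax Bx] [|n]//|x ABx].
by split; [exact: (ABx 0%N)|exact: (ABx 1%N)].
Qed.

Lemma borel_setU (T : topologicalType) (A B : set T) :
  borel_set A -> borel_set B -> borel_set (A `|` B).
Proof.
move=> bA bB; rewrite -[X in borel_set X]setCK setCU; apply: borel_setC.
by apply: borel_setI; exact: borel_setC.
Qed.

Lemma borel_fun_gen (T U : topologicalType) (f : T -> U) :
  (forall A, open A -> borel_set (f @^-1` A)) -> borel_fun f.
Proof.
move=> fo; rewrite /borel_fun.
suff : @borel_set U `<=` [set B | borel_set (f @^-1` B)] by [].
apply: smallest_sub => //; split => /=.
- by rewrite preimage_set0; apply: borel_open; exact: open0.
- by move=> A bA; rewrite setTD preimage_setC; exact: borel_setC.
- by move=> A bA; rewrite preimage_bigcup; exact: borel_setU_countable.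
Qed.

Lemma borel_fun_base (T U : topologicalType) (B : nat -> set U) (f : T -> U) :
  countable_base B -> (forall i, borel_set (f @^-1` B i)) -> borel_fun f.
Proof.
move=> [Bo Bb] fB; apply: borel_fun_gen => A oA.
rewrite (_ : f @^-1` A =
    \bigcup_i (if pselect (B i `<=` A) then f @^-1` B i else set0)).
  apply: borel_setU_countable => i; case: pselect => /= _; first exact: fB.
  by apply: borel_open; exact: open0.
apply/seteqP; split=> [x Ax|x [i _]]; last by case: pselect => // BA /BA.
have [i Bx BA] := Bb (f x) A (open_nbhs_nbhs (conj oA Ax)).
by exists i => //; case: pselect.
Qed.

Lemma borel_fun_continuous (T U : topologicalType) (f : T -> U) :
  continuous f -> borel_fun f.
Proof.
move=> fc; apply: borel_fun_gen => A oA; apply: borel_open.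
by apply: open_comp => // x _; exact: fc.
Qed.

Lemma borel_fun_comp (T U V : topologicalType) (f : T -> U) (g : U -> V) :
  borel_fun f -> borel_fun g -> borel_fun (g \o f).
Proof. by move=> fb gb A /gb /fb. Qed.

(** An open set of the product is a countable union of boxes with finitely many basic sides; a list
    [L] of pairs (coordinate, basic set) codes such a box. *)
Lemma borel_fun_prod (T : topologicalType) (K : nat -> topologicalType)
    (f : T -> prod_topology K) :
  (forall n, exists B : nat -> set (K n), countable_base B) ->
  (forall n, borel_fun (fun t => f t n)) -> borel_fun f.
Proof.
move=> Kb fb; apply: borel_fun_gen => A oA.
have /choice_prod[B HB] := Kb.
pose C (L : seq (nat * nat)) : set T :=
  [set t | forall ni, ni \in L -> B ni.1 ni.2 (f t ni.1)].
have bC L : borel_set (C L).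
  elim: L => [|[n i] L IH].
    by rewrite (_ : C _ = setT) ?predeqE//; exact: borel_setT.
  rewrite (_ : C _ = ((fun t => f t n) @^-1` B n i) `&` C L).
    by apply: borel_setI => //; apply: fb; apply: borel_open; exact: (HB n).1.
  rewrite predeqE => y; split=> [By|[Bni By] ni].
    split; first exact: (By (n, i) (mem_head _ _)).
    by move=> ni niL; apply: By; rewrite in_cons niL orbT.
  by rewrite in_cons => /orP[/eqP->|/By].
pose D (o : option (seq (nat * nat))) : set T := if o is Some L then
  if pselect (C L `<=` f @^-1` A) then C L else set0 else set0.
have bD o : borel_set (D o).
  case: o => [L|] /=; last by apply: borel_open; exact: open0.
  by case: pselect => /= _; [exact: bC|apply: borel_open; exact: open0].
rewrite (_ : f @^-1` A = \bigcup_k D (unpickle k)).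
  by apply: borel_setU_countable => k; exact: bD.
apply/seteqP; split=> [t At|t [k _]]; last first.
  by case: unpickle => [L|//] /=; case: pselect => //= CA /CA.
have /prod_nbhsP[s [V [Vo VA]]] : nbhs (f t) A by exact: open_nbhs_nbhs.
have /choice[j Hj] : forall n, exists j, B n j (f t n) /\ B n j `<=` V n.
  move=> n; have [j ? ?] := (HB n).2 _ (V n) (open_nbhs_nbhs (Vo n)).
  by exists j.
exists (pickle [seq (n, j n) | n <- s]); [by []|]; rewrite pickleK /=.
case: pselect => [CA|[]].
  by move=> ni /mapP[n ns ->] /=; exact: (Hj n).1.
move=> u By; apply: VA => n ns; apply: (Hj n).2.
by apply: (By (n, j n)); apply/mapP; exists n.
Qed.

Context {R : realType}.

Lemma borel_fun_realP (T : topologicalType) (f : T -> R) :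
  (forall q, borel_set [set x | f x < q] /\ borel_set [set x | q < f x]) <->
  borel_fun f.
Proof.
split=> [fq|fb q].
  have [B HB] := @real_countable_base R; apply: borel_fun_gen => A oA.
  have mr := @norm_metrizes R R^o.
  pose J (qe : rat * nat) : set R := [set y | `|ratr qe.1 - y| < (qe.2.+1%:R)^-1].
  pose D (o : option (rat * nat)) : set T := if o is Some qe then
    if pselect (J qe `<=` A) then f @^-1` J qe else set0 else set0.
  have bD o : borel_set (D o).
    case: o => [[r e]|] /=; last by apply: borel_open; exact: open0.
    case: pselect => /= _; last by apply: borel_open; exact: open0.
    rewrite (_ : _ @^-1` _ = [set x | f x < ratr r + (e.+1%:R)^-1] `&`
        [set x | ratr r - (e.+1%:R)^-1 < f x]).
      by apply: borel_setI; [exact: (fq _).1|exact: (fq _).2].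
    apply/seteqP; split=> x; rewrite /J /preimage /= distrC ltr_distl.
      by move=> /andP[].
    by move=> [-> ->].
  rewrite (_ : f @^-1` A = \bigcup_k D (unpickle k)).
    by apply: borel_setU_countable => k; exact: bD.
  apply/seteqP; split=> [t At|t [k _]]; last first.
    by case: unpickle => [L|//] /=; case: pselect => //= CA /CA.
  have [e e0 eA] := (mr.2 (f t) A).1 (open_nbhs_nbhs (conj oA At)).
  have e20 : 0 < e / 2 by rewrite divr_gt0.
  have [n _ /(_ n (leqnn n)) /= ne] := near_infty_natSinv_lt (PosNum e20).
  have n0 : 0 < (n.+1%:R : R)^-1 by rewrite invr_gt0.
  have [||y [/= yx [q _ qy]]] := @dense_rat R [set y | `|f t - y| < (n.+1%:R)^-1].
  - by exists (f t) => /=; rewrite subrr normr0.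
  - exact: (@metric_ball_open R _ _ (f t) _ mr).
  exists (pickle (q, n)); [by []|rewrite pickleK /=]; case: pselect => [CA|[]].
    by rewrite /J /= qy distrC.
  move=> z /=; rewrite /J /= qy => yz; apply: eA => /=.
  rewrite (le_lt_trans (pseudometric_triangle mr.1 _ y _))// [e]splitr ltrD//.
    exact: lt_trans ne.
  exact: lt_trans ne.
split; [apply: (fb [set y | y < q])|apply: (fb [set y | q < y])]; apply: borel_open.
  exact: open_lt.
exact: open_gt.
Qed.

Lemma borel_fun_min (T : topologicalType) (f g : T -> R) :
  borel_fun f -> borel_fun g -> borel_fun (fun x => Num.min (f x) (g x)).
Proof.
move=> /borel_fun_realP fb /borel_fun_realP gb; apply/borel_fun_realP => q.
split.
  rewrite (_ : [set _ | _] = [set x | f x < q] `|` [set x | g x < q]).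
    by apply: borel_setU; [exact: (fb q).1|exact: (gb q).1].
  by apply/seteqP; split=> x /=; rewrite gt_min => /orP.
rewrite (_ : [set _ | _] = [set x | q < f x] `&` [set x | q < g x]).
  by apply: borel_setI; [exact: (fb q).2|exact: (gb q).2].
by apply/seteqP; split=> x /=; rewrite lt_min => /andP.
Qed.

Lemma borel_fun_opp (T : topologicalType) (f : T -> R) :
  borel_fun f -> borel_fun (fun x => - f x).
Proof.
move=> /borel_fun_realP fb; apply/borel_fun_realP => q; split.
  rewrite (_ : [set _ | _] = [set x | - q < f x]); first exact: (fb _).2.
  by apply/seteqP; split=> x /=; rewrite ltrNl.
rewrite (_ : [set _ | _] = [set x | f x < - q]); first exact: (fb _).1.
by apply/seteqP; split=> x /=; rewrite ltrNr.
Qed.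

Lemma borel_fun_addr (T : topologicalType) (f : T -> R) c :
  borel_fun f -> borel_fun (fun x => f x + c).
Proof.
move=> /borel_fun_realP fb; apply/borel_fun_realP => q; split.
  rewrite (_ : [set _ | _] = [set x | f x < q - c]); first exact: (fb _).1.
  by apply/seteqP; split=> x /=; rewrite ltrBrDr.
rewrite (_ : [set _ | _] = [set x | q - c < f x]); first exact: (fb _).2.
by apply/seteqP; split=> x /=; rewrite ltrBlDr.
Qed.

Lemma borel_fun_max (T : topologicalType) (f g : T -> R) :
  borel_fun f -> borel_fun g -> borel_fun (fun x => Num.max (f x) (g x)).
Proof.
move=> fb gb; rewrite (_ : (fun _ => _) = fun x => - Num.min (- f x) (- g x)).
  by apply: borel_fun_opp; apply: borel_fun_min; exact: borel_fun_opp.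
by apply/funext => x; rewrite oppr_min !opprK.
Qed.

Lemma borel_fun_if (T U : topologicalType) (b : T -> bool) (u v : U) :
  borel_set [set x | b x] -> borel_fun (fun x => if b x then u else v).
Proof.
move=> bb A _; rewrite (_ : _ @^-1` A =
    ([set x | b x] `&` [set _ | A u]) `|` (~` [set x | b x] `&` [set _ | A v])).
  have cst (P : Prop) : borel_set [set _ : T | P].
    have [Pt|Pf] := pselect P.
      by rewrite (_ : [set _ | _] = setT) ?predeqE//; exact: borel_setT.
    by rewrite (_ : [set _ | _] = set0) ?predeqE//; apply: borel_open; exact: open0.
  by apply: borel_setU; apply: borel_setI => //; exact: borel_setC.
apply/seteqP; split=> x; rewrite /preimage /=.
  by case: ifP => bx Ax; [left|right].
by case=> -[]; case: ifP.
Qed.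

End borel_functions.

(** * Bounded sums and the radii [delta] *)

Section bounded_sums.
Context {R : realType}.
Implicit Types a b : nat -> R.

(** For nonnegative terms this is convergence, by [nneseries_bounded]; it keeps the estimates inside
    [R]. *)
Definition bounded_sums a := exists M, forall N, \sum_(n < N) a n <= M.

Lemma nneseries_bounded a : (forall n, 0 <= a n) ->
  (\sum_(0 <= n <oo) (a n)%:E < +oo)%E <-> bounded_sums a.
Proof.
move=> a0; split=> [afin|[M aM]]; last first.
  apply: (@le_lt_trans _ _ M%:E); last exact: ltry.
  apply: lime_le; first by apply: is_cvg_nneseries => n _ _; rewrite lee_fin.
  by apply: nearW => N; rewrite sumEFin lee_fin big_mkord.
have sfin : (\sum_(0 <= n <oo) (a n)%:E)%E \is a fin_num.
  by rewrite ge0_fin_numE//; apply: nneseries_ge0 => n _ _; rewrite lee_fin.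
exists (fine (\sum_(0 <= n <oo) (a n)%:E)%E) => N.
rewrite -lee_fin fineK// -sumEFin -(big_mkord xpredT (fun n => (a n)%:E)).
by apply: nneseries_lim_ge => n _; rewrite lee_fin.
Qed.

Lemma bounded_sums_dom m a b : (forall n, 0 <= b n) ->
  (forall n, (m <= n)%N -> a n <= b n) -> bounded_sums b -> bounded_sums a.
Proof.
move=> b0 ab [M bM]; exists (\sum_(n < m) `|a n| + M) => N.
(* [b] says nothing about the first [m] terms, which are bounded separately by their absolute
   values. *)
suff H : \sum_(n < N) a n <= \sum_(n < minn N m) `|a n| + \sum_(n < N) b n.
  rewrite (le_trans H)// lerD//.
  rewrite -!(big_mkord xpredT (fun n => `|a n|)).
  rewrite [leRHS](big_cat_nat _ (geq_minr N m))//= lerDl.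
  by apply: sumr_ge0 => n _; exact: normr_ge0.
elim: N => [|N IH]; first by rewrite min0n !big_ord0 addr0.
rewrite !big_ord_recr /=; have [Nm|mN] := ltnP N m.
  move: IH; rewrite (minn_idPl (ltnW Nm)) (minn_idPl Nm) big_ord_recr /= => IH.
  rewrite addrACA; apply: lerD => //.
  by rewrite (le_trans (ler_norm _))// lerDl.
move: IH; rewrite (minn_idPr mN) (minn_idPr (leqW mN)) addrA => IH.
by apply: lerD => //; exact: ab.
Qed.

Lemma bounded_sumsD a b :
  bounded_sums a -> bounded_sums b -> bounded_sums (fun n => a n + b n).
Proof.
by move=> [M aM] [M' bM]; exists (M + M') => N; rewrite big_split lerD.
Qed.

Lemma bounded_sumsZ c a : 0 <= c ->
  bounded_sums a -> bounded_sums (fun n => c * a n).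
Proof.
by move=> c0 [M aM]; exists (c * M) => N; rewrite -mulr_sumr ler_wpM2l.
Qed.

Lemma bounded_sums_small c a : (forall n, 0 <= a n) -> bounded_sums a -> 0 < c ->
  exists m, forall n, (m <= n)%N -> a n < c.
Proof.
move=> a0 [M aM] c0.
have : cvgn (series a).
  apply: nondecreasing_is_cvgn.
    by apply/nondecreasing_seqP => n; rewrite /series/= big_nat_recr//= lerDl.
  by exists M => _ [N _ <-]; rewrite /series /= big_mkord.
move=> /cvg_series_cvg_0/cvgrPdist_lt/(_ c c0)[m _ Hm].
by exists m => n /Hm /=; rewrite sub0r normrN ger0_norm.
Qed.

Lemma sum_geometric N : \sum_(n < N) (2 ^- n : R) = 2 - 2 * 2 ^- N.
Proof.
elim: N => [|N IH]; first by rewrite big_ord0 expr0 invr1 mulr1 subrr.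
rewrite big_ord_recr /= IH exprS invfM mulrA mulfV// mul1r; lra.
Qed.

Lemma bounded_sums_geometric : bounded_sums (fun n => 2 ^- n).
Proof.
by exists 2 => N; rewrite sum_geometric gerBl mulr_ge0// invr_ge0 exprn_ge0.
Qed.

End bounded_sums.

Section powers.
Context {R : realType} (p : R) (p_ge1 : 1 <= p).
Implicit Types x y : R.

Let p_gt0 : 0 < p. Proof. exact: lt_le_trans p_ge1. Qed.

Lemma powR_le x y : 0 <= x -> x <= y -> x `^ p <= y `^ p.
Proof.
move=> x0 xy; apply: ge0_ler_powR => //; rewrite ?nnegrE//; first exact: ltW.
exact: le_trans xy.
Qed.

Lemma powR_lt x y : 0 <= x -> 0 <= y -> (x `^ p < y `^ p) = (x < y).
Proof.
move=> x0 y0; apply/idP/idP => [|xy]; last first.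
  by apply: gt0_ltr_powR => //; rewrite nnegrE.
by apply: contraTT; rewrite -!leNgt; exact: powR_le.
Qed.

(** Through the maximum of [x] and [y]. Only convergence matters later, so this crude constant
    serves instead of Minkowski's inequality. *)
Lemma powR_addle x y : 0 <= x -> 0 <= y ->
  (x + y) `^ p <= 2 `^ p * (x `^ p + y `^ p).
Proof.
move=> x0 y0; have m0 : 0 <= Num.max x y by rewrite le_max x0.
apply: (@le_trans _ _ ((2 * Num.max x y) `^ p)).
  apply: powR_le; first exact: addr_ge0.
  by rewrite mulr_natl mulr2n lerD// le_max lexx ?orbT.
rewrite powRM// ler_wpM2l ?powR_ge0//.
by rewrite /Num.max; case: ifP => _; rewrite ?lerDl ?lerDr powR_ge0.
Qed.

(* [\sum_k x k = \sum_k 2 ^- k.+1 * (2 ^+ k.+1 * x k)] is at most the maximum of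
   the [2 ^+ k.+1 * x k], which is at most the [lp]-norm of this family. *)
Lemma powR_sum_le (x : nat -> R) m : (forall k, 0 <= x k) ->
  (\sum_(k < m) x k) `^ p <= \sum_(k < m) (2 ^+ k.+1 * x k) `^ p.
Proof.
move=> x0; set b := \sum_(k < m) _ `^ p.
have b0 : 0 <= b by apply: sumr_ge0 => k _; exact: powR_ge0.
have bp : (b `^ p^-1) `^ p = b.
  by rewrite -powRrM mulVf ?gt_eqF// powRr1.
rewrite -[leRHS]bp; apply: powR_le; first by apply: sumr_ge0 => k _.
have xb (k : 'I_m) : 2 ^+ k.+1 * x k <= b `^ p^-1.
  rewrite leNgt -powR_lt ?powR_ge0//; last by rewrite mulr_ge0// exprn_ge0.
  rewrite bp -leNgt /b (bigD1 k)//= lerDl; apply: sumr_ge0 => i _.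
  exact: powR_ge0.
apply: (@le_trans _ _ (\sum_(k < m) (2 ^- k.+1 * b `^ p^-1))).
  apply: ler_sum => k _; rewrite -(@ler_pM2l _ (2 ^+ k.+1)) ?exprn_gt0//.
  by rewrite mulrA mulfV ?mul1r// expf_neq0.
rewrite -mulr_suml ler_piMl ?powR_ge0//.
under eq_bigr => k _ do rewrite exprS invfM.
rewrite -mulr_sumr sum_geometric.
have : 0 <= (2 : R) ^- m by rewrite invr_ge0 exprn_ge0.
lra.
Qed.

Lemma E_sum_bounded (X : nat -> Type) (d : forall n, X n -> X n -> R)
    (x y : forall n, X n) :
  E_sum d p x y <-> bounded_sums (fun n => d n (x n) (y n) `^ p).
Proof. by apply: nneseries_bounded => n; exact: powR_ge0. Qed.

Lemma powR_geometric_le n : (2 ^- n : R) `^ p <= 2 ^- n.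
Proof.
apply: ge1r_powR => //; rewrite invr_gt0 exprn_gt0//=.
by rewrite invf_le1 ?exprn_gt0// exprn_ege1// ler1n.
Qed.

End powers.

(** * Radii extracted from [delta] *)

Section radii.
Context {R : realType} (X : nat -> Type) (d : forall n, X n -> X n -> R) (p : R).
Hypothesis p_ge1 : 1 <= p.
Arguments d : clear implicits.
Let delta_p n := (delta (d n) `^ p)%E.

Let p_gt0 : 0 < p. Proof. exact: lt_le_trans p_ge1. Qed.

Lemma delta_ge0 n : (0 <= delta (d n))%E.
Proof. by apply: le_ereal_inf_tmp => _ [e [e0 _] <-]; rewrite lee_fin ltW. Qed.

Lemma series_divergesN : series_diverges delta_p <-> ~ series_converges delta_p.
Proof.
split=> [dv [m]|nc m]; first by rewrite dv ltxx.
by apply/eqP; rewrite -leye_eq leNgt; apply/negP => fin; apply: nc; exists m.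
Qed.

Lemma delta_separable_lt n r :
  (delta (d n) < r%:E)%E -> 0 < r /\ delta_separable (d n) r.
Proof.
move=> /ereal_inf_lt[_ [e [e0 [S cS Se]] <-]]; rewrite lte_fin => er.
split; first exact: lt_trans er.
by exists S => // u; have [s Ss us] := Se u; exists s => //; exact: lt_trans er.
Qed.

Lemma nneseries_tail (u : nat -> \bar R) m : (forall n, 0 <= u n)%E ->
  (\sum_(m <= n <oo) u n = \sum_(0 <= n <oo) (if (n < m)%N then 0 else u n))%E.
Proof.
move=> u0; rewrite [RHS](nneseries_split 0%N m); last first.
  by move=> k _; case: ifP.
rewrite add0n big_nat big1 ?add0e; last by move=> k /andP[_ ->].
apply/congr_lim/funext => N; apply: eq_big_nat => k /andP[+ _]; by rewrite ltnNge => ->.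
Qed.

Lemma summable_radii : series_converges delta_p -> exists m (r : nat -> R),
  [/\ forall n, (m <= n)%N -> delta_separable (d n) (r n),
      forall n, 0 < r n & bounded_sums (fun n => r n `^ p)].
Proof.
move=> [m]; rewrite nneseries_tail; last by move=> n; exact: poweR_ge0.
pose b n := if (n < m)%N then 0%E else delta_p n.
rewrite -[X in (X < _)%E]/(\sum_(0 <= n <oo) b n)%E => bfin.
have b0 n : (0 <= b n)%E by rewrite /b; case: ifP => // _; exact: poweR_ge0.
have dfin n : (m <= n)%N -> delta (d n) \is a fin_num.
  move=> mn; rewrite ge0_fin_numE ?delta_ge0// ltNge leye_eq; apply/negP => /eqP dy.
  move: bfin; rewrite (@nneseries_pinfty _ _ xpredT n)// /b.
  by rewrite ltnNge mn /= /delta_p dy poweRyr ?gt_eqF.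
pose e n := fine (delta (d n)).
have e0 n : 0 <= e n by apply: fine_ge0; exact: delta_ge0.
pose a n := if (n < m)%N then 0 else e n `^ p.
have ba n : (a n)%:E = b n.
  rewrite /a /b; case: ltnP => // mn.
  by rewrite /delta_p -[delta _]fineK ?dfin// poweR_EFin.
have a0 n : 0 <= a n by rewrite /a; case: ifP => // _; exact: powR_ge0.
have sa : bounded_sums a by apply/nneseries_bounded => //; rewrite (eq_eseriesr (fun n _ => ba n)).
(* [delta] is an infimum and may vanish; adding [2 ^- n] gives a positive radius above it and costs
   only a [p]-summable amount. *)
exists m, (fun n => e n + 2 ^- n).
have g0 n : 0 < (2 : R) ^- n by rewrite invr_gt0 exprn_gt0.
split.
- move=> n mn; apply: (delta_separable_lt _).2.
  by rewrite -[ltLHS]fineK ?dfin// lte_fin ltrDl.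
- by move=> n; rewrite ltr_wpDl.
- apply: (@bounded_sums_dom _ m _ (fun n => 2 `^ p * (a n + 2 ^- n))).
  + by move=> n; rewrite mulr_ge0 ?powR_ge0// addr_ge0// ltW.
  + move=> n mn; rewrite (le_trans (powR_addle p_ge1 _ _))// ?(ltW (g0 _))//.
    rewrite ler_wpM2l ?powR_ge0// /a ltnNge mn /= lerD2l.
    exact: powR_geometric_le.
  + apply: bounded_sumsZ; first exact: powR_ge0.
    by apply: bounded_sumsD => //; exact: bounded_sums_geometric.
Qed.

Lemma divergent_radii : series_diverges delta_p -> exists r : nat -> R,
  [/\ forall n, 0 <= r n, forall n, 0 < r n -> ~ delta_separable (d n) (r n)
    & ~ bounded_sums (fun n => r n `^ p)].
Proof.
move=> dv.
(* Half of a positive finite [delta] is strictly below the infimum, so separability fails at this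
   radius. An infinite [delta] gets radius [1], and infinitely many of these already make the sum
   diverge. *)
pose r n := if delta (d n) == +oo%E then 1 else fine (delta (d n)) / 2.
have dfin n : delta (d n) != +oo%E -> delta (d n) \is a fin_num.
  by move=> dn; rewrite ge0_fin_numE ?delta_ge0// lt_neqAle dn leey.
exists r; split.
- move=> n; rewrite /r; case: ifP => // _; rewrite divr_ge0// fine_ge0//.
  exact: delta_ge0.
- move=> n rn0 sep.
  have : (delta (d n) <= (r n)%:E)%E by apply: ereal_inf_lbound; exists (r n).
  move: rn0; rewrite /r; case: eqVneq => [->|/dfin dn]; first by rewrite leNgt ltry.
  rewrite -[X in (X <= _)%E]fineK// lee_fin; set e := fine _ => e20; lra.
- move=> br.
  have [] := @bounded_sums_small R 1 _ _ br ltr01; first by move=> n; exact: powR_ge0.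
  move=> m Hm.
  have fin n : (m <= n)%N -> delta (d n) \is a fin_num.
    move=> /Hm; rewrite /r; case: eqVneq => [_|/dfin//].
    by rewrite powR1 ltxx.
  have := dv m; rewrite nneseries_tail; last by move=> n; exact: poweR_ge0.
  rewrite (@eq_eseriesr _ _ (fun n => (if (n < m)%N then 0 else
      2 `^ p * r n `^ p)%:E)); last first.
    move=> n _; case: ltnP => // mn.
    rewrite /delta_p -[delta _]fineK ?fin// poweR_EFin -powRM//; last first.
      rewrite /r; case: ifP => // _; rewrite divr_ge0// fine_ge0//.
      exact: delta_ge0.
    congr (_ `^ p)%:E; rewrite /r; case: eqVneq => [dy|_].
      by have := fin _ mn; rewrite dy.
    by rewrite mulrC divfK.
  move=> sy; have : (+oo < +oo :> \bar R)%E; last by rewrite ltxx.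
  rewrite -[X in (X < _)%E]sy; apply/nneseries_bounded.
    by move=> n; case: ifP => // _; rewrite mulr_ge0// powR_ge0.
  apply: (@bounded_sums_dom _ 0 _ (fun n => 2 `^ p * r n `^ p)).
  + by move=> n; rewrite mulr_ge0// powR_ge0.
  + by move=> n _; case: ifP => // _; rewrite mulr_ge0// powR_ge0.
  + by apply: bounded_sumsZ => //; exact: powR_ge0.
Qed.

End radii.

(** * Borel sets are Suslin *)

Lemma nbhs_agree (I : countType) (s : seq I) (x : prod_topology (fun _ : I => bool)) :
  nbhs x [set y : prod_topology (fun _ : I => bool) | agree s x y].
Proof.
elim: s => [|i s IH]; first by apply: filterS filterT => y _ j.
have : nbhs x (proj i @^-1` [set x i]).
  by apply: proj_continuous; exact: discrete_set1.
move=> H; apply: filterS (filterI H IH) => y [/= yi xy] j.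
by rewrite in_cons => /orP[/eqP->|/xy].
Qed.

Lemma cyl_continuous (I : countType) (T : topologicalType)
    (f : prod_topology (fun _ : I => bool) -> T) :
  continuous_on setT f -> continuous f.
Proof.
move=> fc x A /(fc x Logic.I)[s sA]; apply: filterS (nbhs_agree s x) => y.
exact: sA.
Qed.

Section suslin.
Context {T : topologicalType}.
Implicit Types (F : T -> (nat -> nat) -> Prop) (B : set T).

(** Closedness in the product of [T] and the Baire space [nat -> nat], by sequences: there,
    convergence of [w] means that each entry is eventually constant. *)
Definition seq_closed F := forall (z : nat -> T) (w : nat -> nat -> nat) z0 w0,
  (exists N, forall n, (N <= n)%N -> F (z n) (w n)) -> z n @[n --> \oo] --> z0 ->
  (forall j, exists N, forall n, (N <= n)%N -> w n j = w0 j) -> F z0 w0.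

(** Analytic sets as projections of closed sets. The witness [w] is what a fusion can freeze entry
    by entry. *)
Definition suslin B := exists2 F, seq_closed F & forall z, B z <-> exists w, F z w.

Lemma suslin_closed B : closed B -> suslin B.
Proof.
move=> cB; exists (fun z _ => B z).
  move=> z w z0 w0 [N BN] zz0 _; apply: (@closed_cvg _ _ \oo _ z B cB _ z0 zz0).
  by exists N.
by move=> z; split=> [?|[]//]; exists (fun=> 0%N).
Qed.

(** The first entry of the witness names a member of the union; the remaining entries are a witness
    for it. *)
Lemma suslin_bigcup (B : nat -> set T) :
  (forall n, suslin (B n)) -> suslin (\bigcup_n B n).
Proof.
move=> /(_ _)/cid2-/all_sig2[F Fc FB].
exists (fun z w => F (w 0%N) z (fun j => w j.+1)).
  move=> z w z0 w0 [N FN] zz0 ww0.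
  have [M wM] := ww0 0%N.
  apply: (Fc _ z (fun n j => w n j.+1)) zz0 _; last by move=> j; exact: ww0.
  exists (maxn N M) => n; rewrite geq_max => /andP[/FN FNn /wM wn].
  by rewrite -wn.
move=> z; split=> [[n _ /FB[w Fw]]|[w Fw]].
  by exists (fun j => if j is j'.+1 then w j' else n).
by exists (w 0%N) => //; apply/FB; exists (fun j => w j.+1).
Qed.

(** One witness interleaves, through [pickle], witnesses for all the members. *)
Lemma suslin_bigcap (B : nat -> set T) :
  (forall n, suslin (B n)) -> suslin (\bigcap_n B n).
Proof.
move=> /(_ _)/cid2-/all_sig2[F Fc FB].
exists (fun z w => forall i, F i z (fun j => w (pickle (i, j)))).
  move=> z w z0 w0 [N FN] zz0 ww0 i.
  apply: (Fc i z (fun n j => w n (pickle (i, j)))) zz0 _.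
    by exists N => n /FN.
  by move=> j; exact: ww0.
move=> z; split=> [Bz|[w Fw] n _]; last by apply/FB; exists (fun j => w (pickle (n, j))).
have /choice[w Fw] : forall n, exists w, F n z w by move=> n; apply/FB/Bz.
exists (fun k => if unpickle k is Some (i, j) then w i j else 0%N) => i.
rewrite (_ : (fun j => _) = w i)//.
by apply/funext => j; rewrite pickleK.
Qed.

Context {R : realType} (rho : T -> T -> R) (rho_metrizes : metrizes rho).

Lemma suslin_open B : open B -> suslin B.
Proof.
move=> oB.
pose C k := [set z | forall y, rho z y < (k.+1%:R)^-1 -> B y].
rewrite (_ : B = \bigcup_k C k).
  apply: suslin_bigcup => k; apply: suslin_closed.
  rewrite -openC openE => z /= nCz; apply/rho_metrizes.2.
  have [y [zy nBy]] : exists y, rho z y < (k.+1%:R)^-1 /\ ~ B y.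
    by apply: contrapT => H; apply: nCz => y zy; apply: contrapT => ?; apply: H; exists y.
  exists ((k.+1%:R)^-1 - rho z y); first by rewrite subr_gt0.
  move=> z' /= zz' Cz'; apply: nBy; apply: Cz'.
  have [tri sym] := (pseudometric_triangle rho_metrizes.1, pseudometric_sym rho_metrizes.1).
  by rewrite (le_lt_trans (tri _ z _))// -ltrBrDr sym.
apply/seteqP; split=> [z Bz|z [k _]]; last first.
  by apply; rewrite (pseudometric_xx rho_metrizes.1) invr_gt0.
have [e e0 eB] := (rho_metrizes.2 z B).1 (open_nbhs_nbhs (conj oB Bz)).
have [n _ /(_ n (leqnn n)) /= ne] := near_infty_natSinv_lt (PosNum e0).
by exists n => // y zy; apply: eB; exact: lt_trans ne.
Qed.

(** Suslin sets are not closed under complements, so the induction carries [B] together with its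
    complement. *)
Lemma suslin_borel B : borel_set B -> suslin B.
Proof.
suff : @borel_set T `<=` [set B | suslin B /\ suslin (~` B)] by move=> H /H[].
apply: smallest_sub; last first.
  move=> A oA; split; first exact: suslin_open.
  by apply: suslin_closed; rewrite -openC setCK.
split=> /=.
- split; first by apply: suslin_open; exact: open0.
  by rewrite setC0; apply: suslin_open; exact: openT.
- by move=> A [sA sA']; rewrite setTD setCK.
- move=> A sA; split; first by apply: suslin_bigcup => n; exact: (sA n).1.
  by rewrite setC_bigcup; apply: suslin_bigcap => n; exact: (sA n).2.
Qed.

End suslin.

Lemma prod_metrizes (R : realType) (T : topologicalType) (rho : T -> T -> R) :
  metrizes rho ->
  metrizes (fun z y : T * T => Num.max (rho z.1 y.1) (rho z.2 y.2)).
Proof.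
move=> [pm nb]; split.
  split=> [x y|x|x y|x y z].
  - by rewrite le_max (pseudometric_ge0 pm).
  - by rewrite !(pseudometric_xx pm) maxxx.
  - by congr Num.max; exact: (pseudometric_sym pm).
  - rewrite ge_max; apply/andP; split.
      by rewrite (le_trans (pseudometric_triangle pm _ y.1 _))// lerD// le_max lexx.
    rewrite (le_trans (pseudometric_triangle pm _ y.2 _))// lerD// le_max lexx;
    by rewrite orbT.
move=> [x1 x2] A; split.
  move=> [[U V] /= [/nb[e e0 eU] /nb[f f0 fV]] UVA].
  exists (Num.min e f); first by rewrite lt_min e0.
  move=> [y1 y2] /=; rewrite gt_max !lt_min => /andP[/andP[? ?] /andP[? ?]].
  by apply: UVA; split; [exact: eU|exact: fV].
move=> [e e0 eA]; exists ([set y | rho x1 y < e], [set y | rho x2 y < e]) => /=.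
  by split; apply/nb; exists e.
by move=> [y1 y2] /= [? ?]; apply: eA => /=; rewrite gt_max; apply/andP.
Qed.

(** * A hypercube in a non-separable pseudometric *)

Definition flip (I : eqType) (k : I) (a : I -> bool) : I -> bool :=
  fun i => a i (+) (i == k).

Section hypercube.
Context {R : realType} (X : topologicalType) (rho d : X -> X -> R) (r : R).
Hypothesis rho_complete : complete_metric rho.
Variable s : nat -> X.
Hypothesis s_dense : dense (range s).
Hypothesis d_pm : is_pseudometric d.
Variable F : X * X -> (nat -> nat) -> Prop.
Hypothesis F_closed : seq_closed F.
Hypothesis FE : forall u v, r <= d u v <-> exists w, F (u, v) w.
Hypothesis d_nonsep : ~ delta_separable d r.

Implicit Types (x : (nat -> bool) -> X) (a b : nat -> bool) (H : set ((nat -> bool) -> X)).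

Let rpm := complete_metric_pseudometric rho_complete.

(* The sets of configurations that are not positive form a sigma-ideal, generated
   by the sets that send a fixed vertex [a] into a [d]-ball of radius [r]. No
   definability is needed, as this ideal only guides the fusion below. *)
Definition positive H := forall (v : nat -> X) (a : nat -> nat -> bool),
  exists2 x, H x & forall i, r <= d (v i) (x (a i)).

Let wit u v : nat -> nat :=
  if pselect (exists w, F (u, v) w) is left e then sval (cid e) else fun=> 0%N.

Let witP u v : r <= d u v -> F (u, v) (wit u v).
Proof. by move=> /FE e; rewrite /wit; case: pselect => // e'; case: cid. Qed.

Let idx n u : nat := xget 0%N [set i | rho u (s i) < 2 ^- n].

Let idxP n u : rho u (s (idx n u)) < 2 ^- n.
Proof.
have mr : metrizes rho.
  by split=> // x A; exact: (complete_metric_nbhs rho_complete).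
have e0 : 0 < (2 : R) ^- n by rewrite invr_gt0 exprn_gt0.
apply: (@xgetPex _ 0%N [set i | rho u (s i) < 2 ^- n]).
have [||y [/= uy [i _ sy]]] := @s_dense [set v | rho u v < 2 ^- n].
- by exists u; rewrite /= (pseudometric_xx rpm).
- exact: metric_ball_open mr.
by exists i; rewrite /= sy.
Qed.

(** A cube with [2 ^ n] vertices is stored as a function on the whole Cantor space that reads only
    [n] bits, so that all stages of the fusion have the same type. *)
Definition local n x := forall a b, (forall i, (i < n)%N -> a i = b i) -> x a = x b.

Definition hypercube n x := forall k a, (k < n)%N -> r <= d (x a) (x (flip k a)).

Let wits n x a := [seq [seq wit (x a) (x (flip k a)) i | i <- iota 0 n] | k <- iota 0 n].

(** Takes countably many values, so [positive_partition] can fix it without losing positivity. By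
    locality, the finitely many tuples of [n] bits describe the whole configuration. *)
Let code n x := [seq (idx n (x (nth false (tval t))), wits n x (nth false (tval t)))
  | t <- enum {: n.-tuple bool}].

Definition uniform n H := forall x y, H x -> H y -> forall a,
  rho (x a) (y a) < 2 * 2 ^- n /\
  forall k i, (k < n)%N -> (i < n)%N ->
    wit (x a) (x (flip k a)) i = wit (y a) (y (flip k a)) i.

Lemma code_uniform n c H : (forall x, H x -> local n x) ->
  uniform n (H `&` [set x | code n x = c]).
Proof.
move=> lH x y [Hx xc] [Hy yc] a.
have {c xc yc} : code n x = code n y by rewrite xc yc.
move=> /eq_in_map xy.
pose t := [tuple a i | i < n].
have ta i : (i < n)%N -> a i = nth false t i.
  by move=> ni; rewrite -(tnth_nth _ _ (Ordinal ni)) tnth_mktuple.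
have [xyi xyw] : (idx n (x (nth false t)) = idx n (y (nth false t))) /\
    wits n x (nth false t) = wits n y (nth false t).
  by have := xy t; rewrite mem_enum inE => /(_ isT)[].
have fl k i : (i < n)%N -> flip k a i = flip k (nth false t) i.
  by move=> ni; rewrite /flip ta.
rewrite !(lH _ Hx a (nth false t) ta) !(lH _ Hy a (nth false t) ta).
split.
  have := idxP n (x (nth false t)); rewrite xyi => xs.
  have := idxP n (y (nth false t)); rewrite (pseudometric_sym rpm) => sy.
  by rewrite mulr_natl mulr2n (le_lt_trans (pseudometric_triangle rpm _ _ _) (ltrD xs sy)).
move=> k i kn ni.
rewrite (lH _ Hx (flip k a) _ (fl k)) (lH _ Hy (flip k a) _ (fl k)).
move: xyw => /eq_in_map/(_ k); rewrite mem_iota add0n => /(_ kn)/eq_in_map/(_ i).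
by rewrite mem_iota add0n => /(_ ni).
Qed.

(** Were every piece small, the countably many countable families of balls that catch the pieces
    could be merged through [pickle] into one family that catches all of [H]. *)
Lemma positive_partition (C : countType) (c : ((nat -> bool) -> X) -> C) H :
  positive H -> exists k, positive (H `&` [set x | c x = k]).
Proof.
move=> pH; apply: contrapT => npos.
have [x0 Hx0 _] := pH (fun=> s 0%N) (fun _ _ => false).
have /choice[va Hva] : forall k, exists va : nat -> X * (nat -> bool), forall x,
    H x -> c x = k -> exists i, d (va i).1 (x (va i).2) < r.
  move=> k; apply: contrapT => nva; apply: npos; exists k => v a.
  apply: contrapT => nx; apply: nva; exists (fun i => (v i, a i)) => x Hx xk.
  apply: contrapT => ni; apply: nx; exists x => // i; rewrite leNgt; apply/negP => di.
  by apply: ni; exists i.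
pose u n := if unpickle n is Some (k, i) then va k i else (s 0%N, fun=> false).
have [x Hx xu] := pH (fun n => (u n).1) (fun n => (u n).2).
have [i] := Hva _ _ Hx erefl.
by rewrite ltNge => /negP; apply; have := xu (pickle (c x, i)); rewrite /u pickleK.
Qed.

Definition join_at n (x0 x1 : (nat -> bool) -> X) : (nat -> bool) -> X :=
  fun a => if a n then x1 a else x0 a.

Definition successor n H : set ((nat -> bool) -> X) := [set x | exists x0 x1,
  [/\ H x0, H x1, forall a, r <= d (x0 a) (x1 a) & x = join_at n x0 x1]].

(* [x0] avoids the given balls; [x1] avoids them and also the balls around the
   vertices of [x0], so that both are joined by edges at all vertices. *)
Lemma positive_successor n H : (forall x, H x -> local n x) -> positive H ->
  positive (successor n H).
Proof.
move=> lH pH v a.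
have [x0 Hx0 x0v] := pH v a.
pose pt k : nat -> bool := if unpickle k is Some t then nth false t else fun=> false.
have [x1 Hx1 x1v] := pH
  (fun k => if odd k then v k./2 else x0 (pt k./2))
  (fun k => if odd k then a k./2 else pt k./2).
exists (join_at n x0 x1).
  exists x0, x1; split => // b.
  have bt i : (i < n)%N -> b i = pt (pickle (mkseq b n)) i.
    by move=> ni; rewrite /pt pickleK nth_mkseq.
  rewrite (lH _ Hx0 _ _ bt) (lH _ Hx1 _ _ bt).
  by have := x1v (pickle (mkseq b n)).*2; rewrite odd_double doubleK.
move=> i; rewrite /join_at; case: ifP => _ //.
by have := x1v i.*2.+1; rewrite /= odd_double /= uphalf_double.
Qed.

(** Nonseparability enters here: a countable family of balls catching all constant configurations
    would have its centres form an [r]-net. *)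
Lemma positive0 : positive [set x | exists u, x = fun=> u].
Proof.
move=> v a; apply: contrapT => nx; apply: d_nonsep.
exists (range v); first exact: (sub_countable (card_image_le _ _) (countableP _)).
move=> u; apply: contrapT => nu; apply: nx; exists (fun=> u); first by exists u.
move=> i; rewrite leNgt; apply/negP => di; apply: nu; exists (v i); first by exists i.
by rewrite (pseudometric_sym d_pm).
Qed.

Let good n H := [/\ positive H, forall x, H x -> local n x,
  forall x, H x -> hypercube n x & uniform n H].

Let good_refine n H : positive H -> (forall x, H x -> local n x) ->
  (forall x, H x -> hypercube n x) -> exists2 H', good n H' & H' `<=` H.
Proof.
move=> pH lH hH; have [c pc] := positive_partition (code n) pH.
exists (H `&` [set x | code n x = c]); last by move=> x [].
by split=> // [x []|x []|]; [move=> /lH|move=> /hH|exact: code_uniform].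
Qed.

Lemma hypercube_embedding : exists2 g : prod_topology (fun _ : nat => bool) -> X,
  continuous g & forall k a, r <= d (g a) (g (flip k a)).
Proof.
have [H0 gH0 _] : exists2 H0, good 0 H0 & H0 `<=` [set x | exists u, x = fun=> u].
  by apply: good_refine => [|x [u ->]|//]; first exact: positive0.
have [|H [_ gH]] := @dependent_choice_from _ good
    (fun n H H' => H' `<=` successor n H) H0 gH0.
  move=> n H [pH lH hH uH].
  have [||H' gH' sH'] := good_refine (n := n.+1) (positive_successor lH pH).
  - move=> x [x0 [x1 [/lH lx0 /lH lx1 _ ->]]] a b ab; rewrite /join_at ab//.
    by case: ifP => _; [apply: lx1|apply: lx0] => i ni; apply: ab; exact: ltnW.
  - move=> x [x0 [x1 [Hx0 Hx1 x01 ->]]] k a; rewrite ltnS leq_eqVlt.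
    move=> /orP[/eqP->|kn]; rewrite /join_at /flip.
      have fl i : (i < n)%N -> a i = flip n a i.
        by move=> ni; rewrite /flip ltn_eqF// addbF.
      rewrite eqxx addbT; case: ifP => _ /=.
        by rewrite -(lH _ Hx0 a _ fl) (pseudometric_sym d_pm).
      by rewrite -(lH _ Hx1 a _ fl).
    by rewrite [n == k]gtn_eqF// addbF; case: ifP => _; apply: hH.
  by exists H'.
have /choice[x Hx] : forall n, exists x, H n x.
  by move=> n; have [[/(_ (fun=> s 0%N) (fun _ _ => false))[x]]] := gH n; exists x.
(* Following at each stage the half selected by the bit of [a], one comes back from stage [m] to a
   member of [H n] with the same vertex at [a] and the same neighbours along the edges [k < n].
   Uniformity of [H n] then compares it with [x n]. *)
have back n m y a : (n <= m)%N -> H m y -> exists y', [/\ H n y', y a = y' a &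
    forall k, (k < n)%N -> y (flip k a) = y' (flip k a)].
  move=> nm; elim: m nm y => [|m IH].
    by rewrite leqn0 => /eqP-> y Hy; exists y.
  rewrite leq_eqVlt => /orP[/eqP-> y Hy|]; first by exists y.
  rewrite ltnS => nm y /(gH m).2[y0 [y1 [Hy0 Hy1 _ ->]]].
  have [y' [Hy' ya yf]] : exists y', [/\ H n y', (if a m then y1 else y0) a = y' a &
      forall k, (k < n)%N -> (if a m then y1 else y0) (flip k a) = y' (flip k a)].
    by apply: IH => //; case: ifP.
  exists y'; split => //; rewrite /join_at; first by rewrite -ya; case: ifP.
  move=> k kn; rewrite -yf// {1}/flip [m == k]gtn_eqF ?(leq_trans kn)// addbF.
  by case: ifP.
have near n m a : (n <= m)%N -> rho (x m a) (x n a) < 2 * 2 ^- n.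
  move=> nm; have [y' [Hy' -> _]] := back n m (x m) a nm (Hx m).
  have [_ _ _ /(_ _ _ Hy' (Hx n) a)[]] := (gH n).1; exact.
have wnear n m a k i : (n <= m)%N -> (k < n)%N -> (i < n)%N ->
    wit (x m a) (x m (flip k a)) i = wit (x n a) (x n (flip k a)) i.
  move=> nm kn ni; have [y' [Hy' -> ->//]] := back n m (x m) a nm (Hx m).
  by have [_ _ _ /(_ _ _ Hy' (Hx n) a)[_]] := (gH n).1; apply.
have small e : 0 < e -> exists n, forall m, (n <= m)%N -> 4 * 2 ^- m < e :> R.
  move=> e0.
  have [|||n Hn] := @bounded_sums_small R e (fun n => 4 * 2 ^- n).
  - by move=> n; rewrite mulr_ge0// invr_ge0 exprn_ge0.
  - by apply: bounded_sumsZ => //; exact: bounded_sums_geometric.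
  - by [].
  by exists n.
have [g xg] : exists g : (nat -> bool) -> X, forall a, x n a @[n --> \oo] --> g a.
  apply: (@choice_prod _ (fun=> X) (fun a l => x n a @[n --> \oo] --> l)) => a.
  apply: (complete_metric_cvg rho_complete) => e e0.
  have [N HN] := small e e0; exists N => m n Nm Nn.
  rewrite (le_lt_trans (pseudometric_triangle rpm _ (x N a) _))//.
  apply: lt_trans (HN N (leqnn N)).
  have := near _ _ a Nm; have := near _ _ a Nn.
  rewrite [rho (x n a) _](pseudometric_sym rpm); lra.
have xdist n a : rho (g a) (x n a) < 4 * 2 ^- n.
  have e0 : 0 < (2 : R) ^- n by rewrite invr_gt0 exprn_gt0.
  have : nbhs (g a) [set y | rho (g a) y < 2 ^- n].
    by apply/(complete_metric_nbhs rho_complete); exists (2 ^- n).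
  move=> /xg[N _ /(_ (maxn N n))]; rewrite /= leq_maxl => /(_ isT) gx.
  rewrite (le_lt_trans (pseudometric_triangle rpm _ (x (maxn N n) a) _))//.
  have := near n (maxn N n) a (leq_maxr _ _); lra.
exists g.
  apply: cyl_continuous => a _ A /(complete_metric_nbhs rho_complete)[e e0 eA].
  have e20 : 0 < e / 2 by rewrite divr_gt0.
  have [n Hn] := small _ e20.
  exists (iota 0 n) => b _ ab; apply: eA => /=.
  have xab : x n a = x n b.
    have [_ lH _ _] := (gH n).1; apply: (lH _ (Hx n)) => i ni; apply: ab.
    by rewrite mem_iota.
  rewrite (le_lt_trans (pseudometric_triangle rpm _ (x n a) _))//.
  have := xdist n b; rewrite -xab (pseudometric_sym rpm) => ?.
  have := Hn n (leqnn n); have := xdist n a; lra.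
move=> k a; apply/FE.
(* [d] need not be continuous, so the inequality is not passed to the limit directly. Entry [i] of
   the witness of this edge no longer changes from stage [(maxn i k).+1] on, and [F] is closed. *)
pose w i := let N := (maxn i k).+1 in wit (x N a) (x N (flip k a)) i.
exists w.
apply: (F_closed (z := fun n => (x n a, x n (flip k a)))
  (w := fun n => wit (x n a) (x n (flip k a)))).
- exists k.+1 => n kn; apply: witP.
  by have [_ _ /(_ _ (Hx n)) h _] := (gH n).1; exact: h.
- exact: (cvg_pair (xg a) (xg (flip k a))).
- move=> i; exists (maxn i k).+1 => n Nn; apply: wnear => //.
    by rewrite ltnS leq_maxr.
  by rewrite ltnS leq_maxl.
Qed.

End hypercube.

(** * A perfect separated set *)

Definition join2 (u v : nat -> bool) : bool * nat -> bool :=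
  fun i => if i.1 then u i.2 else v i.2.

Section mycielski.
Variables (C : set (bool * nat -> bool)) (O : nat -> set (bool * nat -> bool)).
Hypothesis O_open : forall j, cyl_open (O j) /\ cyl_dense (O j).
Hypothesis OC : \bigcap_j O j `<=` C.

Let init L := iota 0 L.

Let agree_init L u v : agree (init L) u v <-> forall i, (i < L)%N -> u i = v i.
Proof.
by split=> uv i; [move=> iL; apply: uv|]; rewrite mem_iota add0n //; exact: uv.
Qed.

Let agree_init_le L L' u v : (L <= L')%N -> agree (init L') u v -> agree (init L) u v.
Proof.
by move=> LL' /agree_init uv; apply/agree_init => i iL; apply: uv; exact: leq_trans LL'.
Qed.

(** The finitely many requirements are met one at a time; each is open, hence survives the later
    extensions of the approximations. *)
Lemma separate_pairs (S : eqType) (P : seq (S * S * nat)) (y : S -> nat -> bool) L :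
  (forall q, q \in P -> q.1.1 != q.1.2) ->
  exists (y' : S -> nat -> bool) L', [/\ (L <= L')%N,
    forall t, agree (init L) (y t) (y' t) &
    forall q, q \in P -> forall u v, agree (init L') (y' q.1.1) u ->
      agree (init L') (y' q.1.2) v -> O q.2 (join2 u v)].
Proof.
elim: P => [_|[[t t'] j] P IH Pne]; first by exists y, L; split.
have [|y1 [L1 [LL1 yy1 y1P]]] := IH.
  by move=> q qP; apply: Pne; rewrite in_cons qP orbT.
have tt' : t != t' by exact: (Pne (t, t', j) (mem_head _ _)).
pose q1 := [seq (true, i) | i <- init L1] ++ [seq (false, i) | i <- init L1].
have q1P b i : i \in init L1 -> (b, i) \in q1.
  by move=> iL; rewrite mem_cat; case: b; rewrite map_f ?orbT.
have [z yz Oz] := (O_open j).2 (join2 (y1 t) (y1 t')) q1.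
have [s sO] := (O_open j).1 z Oz.
pose L' := maxn L1 (\max_(i <- s) i.2).+1.
(* As [t] and [t'] are distinct, the two halves of [z] can be stored independently. *)
pose y' q := if q == t then fun i => z (true, i)
  else if q == t' then fun i => z (false, i) else y1 q.
have y1y' q : agree (init L1) (y1 q) (y' q).
  move=> i iL; rewrite /y'; case: eqP => [->|_].
    by rewrite -(yz _ (q1P true i iL)).
  by case: eqP => [->|//]; rewrite -(yz _ (q1P false i iL)).
exists y', L'; split; first exact: leq_trans LL1 (leq_maxl _ _).
  move=> q; apply: agree_trans (yy1 q) _; exact: agree_init_le LL1 (y1y' q).
move=> q; rewrite in_cons => /orP[/eqP-> /=|qP] u v yu yv; last first.
  have L1L' : (L1 <= L')%N by exact: leq_maxl.
  apply: (y1P q qP).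
    exact: agree_trans (y1y' _) (agree_init_le L1L' yu).
  exact: agree_trans (y1y' _) (agree_init_le L1L' yv).
apply: sO => -[b i] si.
have iL : i \in init L'.
  rewrite mem_iota add0n leq_max; apply/orP; right; rewrite ltnS.
  exact: (@leq_bigmax_seq _ s xpredT snd (b, i)).
rewrite /join2 /=; case: b {si}; first by rewrite -yu// /y' eqxx.
by rewrite -yv// /y' eqxx eq_sym (negbTE tt').
Qed.

Lemma mycielski : exists2 h : prod_topology (fun _ : nat => bool) ->
    prod_topology (fun _ : nat => bool),
  continuous h & forall a b, a <> b -> C (join2 (h a) (h b)).
Proof.
pose good n (xL : ((nat -> bool) -> nat -> bool) * nat) :=
  (n <= xL.2)%N /\ forall a b, (forall i, (i < n)%N -> a i = b i) -> xL.1 a = xL.1 b.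
pose next n (xL xL' : ((nat -> bool) -> nat -> bool) * nat) := [/\ (xL.2 <= xL'.2)%N,
  forall a, agree (init xL.2) (xL.1 a) (xL'.1 a) &
  forall a b, (exists2 i, (i <= n)%N & a i != b i) -> forall j, (j <= n)%N ->
    forall u v, agree (init xL'.2) (xL'.1 a) u -> agree (init xL'.2) (xL'.1 b) v ->
      O j (join2 u v)].
have [||f [_ Hf]] := @dependent_choice_from _ good next (fun a => fun=> false, 0%N).
- by split.
- move=> n [x L] [/= nL xloc].
  (* All pairs of distinct prefixes of [n.+1] bits, each with every [j <= n]. *)
  pose P := [seq q <- [seq (c, j) | c <- [seq (t, t') | t <- enum {: n.+1.-tuple bool},
     t' <- enum {: n.+1.-tuple bool}], j <- iota 0 n.+1] | q.1.1 != q.1.2].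
  (* The length is pushed to at least [n.+1], because [h] reads coordinate [i] at stage [i.+1]. *)
  have [|y' [L' [LL' yy' y'P]]] := @separate_pairs _ P
    (fun t : n.+1.-tuple bool => x (nth false t)) (maxn L n.+1).
    by move=> q; rewrite mem_filter => /andP[].
  pose tr (a : nat -> bool) : n.+1.-tuple bool := [tuple a i | i < n.+1].
  have tra a i : (i < n.+1)%N -> nth false (tr a) i = a i.
    by move=> ni; rewrite -(tnth_nth _ _ (Ordinal ni)) tnth_mktuple.
  exists (fun a => y' (tr a), L'); split; first split => /=.
  + by apply: leq_trans LL'; exact: leq_maxr.
  + by move=> a b ab; congr y'; apply: eq_from_tnth => i; rewrite !tnth_mktuple ab.
  split => /=.
  + by apply: leq_trans LL'; exact: leq_maxl.
  + move=> a; rewrite (xloc _ (nth false (tr a))); last first.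
      by move=> i ni; rewrite tra// ltnS ltnW.
    exact: agree_init_le (leq_maxl _ _) (yy' (tr a)).
  + move=> a b [i ni ab] j jn u v au bv.
    apply: (y'P (tr a, tr b, j)) => //; rewrite mem_filter; apply/andP; split.
      apply: contraNneq ab => /= tab.
      by rewrite -(tra a i ni) -(tra b i ni) tab.
    apply/allpairsPdep; exists (tr a, tr b), j; split => //.
      by apply/allpairsPdep; exists (tr a), (tr b); rewrite !mem_enum.
    by rewrite mem_iota.
have mono m n a : (m <= n)%N -> ((f m).2 <= (f n).2)%N /\
    agree (init (f m).2) ((f m).1 a) ((f n).1 a).
  elim: n => [|n IH]; first by rewrite leqn0 => /eqP->.
  rewrite leq_eqVlt => /orP[/eqP->|]; first by split.
  rewrite ltnS => /IH[Lmn amn]; have [_ [Ln an _]] := Hf n; split.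
    exact: leq_trans Lmn Ln.
  exact: agree_trans amn (agree_init_le Lmn (an a)).
pose h (a : nat -> bool) i := (f i.+1).1 a i.
have fh n a : agree (init (f n).2) ((f n).1 a) (h a).
  move=> i iL; rewrite /h; have [ni|/ltnW ni] := leqP n i.+1.
    by have [_ ->] := mono _ _ a ni.
  have [_ ->//] := mono _ _ a ni.
  by rewrite mem_iota add0n; have [[]] := Hf i.+1.
exists h.
  apply: prod_continuous => i; apply: cyl_continuous => a _ A /nbhs_singleton Aa.
  exists (iota 0 i.+1) => b _ ab; rewrite /h -((Hf i.+1).1.2 a b)//.
  by move=> k ki; apply: ab; rewrite mem_iota.
move=> a b nab; apply: OC => j _.
have [i abi] : exists i, a i != b i.
  apply: contrapT => ni; apply: nab; apply/funext => i; apply/eqP.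
  by apply: contrapT => /negP ?; apply: ni; exists i.
have [_ [_ _ sep]] := Hf (maxn i j).
apply: (sep a b); [by exists i => //; exact: leq_maxl|exact: leq_maxr| |]; exact: fh.
Qed.

End mycielski.

Lemma perfect_separated_set (R : realType) (X : topologicalType) (d : X -> X -> R) (r : R) :
  polish R X -> [set: X] !=set0 -> borel_pseudometric d -> 0 < r ->
  ~ delta_separable d r ->
  exists2 f : prod_topology (fun _ : nat => bool) -> X,
    continuous f & forall a b, a <> b -> r / 2 <= d (f a) (f b).
Proof.
move=> [[S cS dS] [rho rhoc]] X0 [pm db] r0 nsep.
have [s Ss] : exists s : nat -> X, S = range s.
  apply: countable_enum => //; have [|x [_ ?]] := dS setT X0 _; first exact: openT.
  by exists x.
have mr : metrizes rho.
  by case: rhoc => *; split.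
have [|F Fc FE] := @suslin_borel (X * X)%type R _ (prod_metrizes mr) [set z | r <= d z.1 z.2].
  rewrite (_ : [set _ | _] = ~` ((fun z => d z.1 z.2) @^-1` [set y | y < r])).
    by apply: borel_setC; apply: (db [set y | y < r]); apply: borel_open; exact: open_lt.
  by apply/seteqP; split=> z /=; rewrite leNgt => /negP.
have sdense : dense (range s) by rewrite -Ss.
have [|g gc gr] := @hypercube_embedding R X rho d r rhoc s sdense pm F Fc _ nsep.
  by move=> u v; exact: (FE (u, v)).
pose D (y : prod_topology (fun _ : bool * nat => bool)) : R :=
  d (g (fun n => y (true, n))) (g (fun n => y (false, n))).
have Db : borel_fun D.
  have row_continuous b : continuous (fun y : prod_topology (fun _ : bool * nat => bool) =>
      (fun n => y (b, n)) : prod_topology (fun _ : nat => bool)).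
    by apply: prod_continuous => n; exact: (@proj_continuous _ (fun=> bool) (b, n)).
  apply: (@borel_fun_comp _ (X * X)%type _ (fun y : prod_topology (fun _ : bool * nat => bool) =>
    (g (fun n => y (true, n)), g (fun n => y (false, n)))) _ _ db).
  apply: borel_fun_continuous => y; apply: cvg_pair.
    exact: (continuous_comp (row_continuous true y) (gc _)).
  exact: (continuous_comp (row_continuous false y) (gc _)).
have [B Bb] := @real_countable_base R.
have [C cC DC] := borel_generically_continuous Bb Db.
(* If [D y < r / 2] with [y] in [C], this holds on [C] in a cylinder. Flipping a far bit [k] of the
   first half there gives two adjacent vertices, both within [r / 2] of the image of the same second
   half: a contradiction. *)
have CD y : C y -> r / 2 <= D y.
  move=> Cy; rewrite leNgt; apply/negP => Dy.
  have [s' s'D] := DC y Cy [set t | t < r / 2] (open_nbhs_nbhs (conj (@open_lt _ _) Dy)).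
  pose k := (\max_(i <- s') i.2).+1.
  have ks' b : (b, k) \notin s'.
    apply/negP => /(@leq_bigmax_seq _ s' xpredT snd)/(_ isT).
    by rewrite /k ltnn.
  pose h : bool * nat -> bool := fun i => i == (true, k).
  have [z yz [Cz Chz]] := comeager_dense (comeagerI cC (comeager_bitxor h cC)) y s'.
  have Dz : D z < r / 2 by exact: (s'D z Cz yz).
  have Dhz : D (bitxor h z) < r / 2.
    apply: (s'D (bitxor h z) Chz) => i si; have [ie|ne] := eqVneq i (true, k).
      by have := ks' true; rewrite -ie si.
    have hi : h i = false := negbTE ne.
    by rewrite /bitxor hi addbF; exact: yz.
  have := gr k (fun n => z (true, n)).
  rewrite leNgt => /negP; apply.
  rewrite (le_lt_trans (pseudometric_triangle pm _ (g (fun n => z (false, n))) _))//.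
  rewrite [r]splitr ltrD// (pseudometric_sym pm).
  move: Dhz; rewrite /D /bitxor /h.
  rewrite (_ : (fun n => _ (+) ((true, n) == _)) = flip k (fun n => z (true, n))); last first.
    by apply/funext => n; rewrite /flip xpair_eqE.
  rewrite (_ : (fun n => _ (+) ((false, n) == _)) = (fun n => z (false, n)))//.
  by apply/funext => n; rewrite xpair_eqE addbF.
have [ O Oo OC] := cC.
have [h hc hC] := mycielski Oo OC.
exists (g \o h); last by move=> a b /hC/CD.
by move=> a; apply: continuous_comp; [exact: hc|exact: gc].
Qed.

(** * The reduction of [E1] in the divergent case *)

Section E1_reduction.
Context {R : realType} (X : nat -> topologicalType)
  (d : forall n, X n -> X n -> R) (p : R).
Arguments d : clear implicits.
Hypothesis p_ge1 : 1 <= p.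
Hypothesis X_polish : forall n, polish R (X n).
Hypothesis X_nonempty : forall n, [set: X n] !=set0.
Hypothesis d_borel : forall n, borel_pseudometric (d n).

Let rows_from n (x : nat * nat -> bool) : nat -> bool :=
  fun j => if unpickle j is Some mk then (n <= mk.1)%N && x mk else false.

Lemma E1_reducible : series_diverges (fun n => (delta (d n) `^ p)%E) ->
  borel_reducible E1 (E_sum d p : prod_topology X -> prod_topology X -> Prop).
Proof.
move=> /divergent_radii[r [r0 rsep rdiv]].
have p0 : 0 < p by exact: lt_le_trans p_ge1.
have /choice_prod[f Hf] : forall n, exists f : prod_topology (fun _ : nat => bool) -> X n,
    continuous f /\ forall a b, a <> b -> r n / 2 <= d n (f a) (f b).
  move=> n; have [rn0|] := ltP 0 (r n).
    have [f fc fr] := perfect_separated_set (X_polish n) (X_nonempty n)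
      (d_borel n) rn0 (rsep n rn0).
    by exists f.
  move=> rn0; have [u _] := X_nonempty n; exists (fun=> u); split.
    by move=> x; exact: cvg_cst.
  have -> : r n = 0 by apply/le_anti; rewrite rn0 r0.
  move=> a b _; rewrite mul0r.
  exact: (pseudometric_ge0 (borel_pseudometric_pseudometric (d_borel n))).
exists (fun x n => f n (rows_from n x)).
  apply: borel_fun_continuous; apply: prod_continuous => n x.
  apply: (@continuous_comp _ _ _ (rows_from n : prod_topology _ -> prod_topology _)).
    apply: prod_continuous => j y; rewrite /rows_from.
    case: unpickle => [mk|]; last exact: cvg_cst.
    case: (n <= mk.1)%N; last exact: cvg_cst.
    exact: proj_continuous.
  exact: (Hf n).1.
move=> x y; split.
  move=> [m xy]; apply/E_sum_bounded.
  apply: (@bounded_sums_dom _ m _ (fun=> 0)) => //; last first.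
    by exists 0 => N; rewrite big1.
  move=> n mn; rewrite (_ : rows_from n x = rows_from n y).
    by rewrite (pseudometric_xx (borel_pseudometric_pseudometric (d_borel n))) powR0 ?gt_eqF.
  apply/funext => j; rewrite /rows_from; case: unpickle => // -[k l] /=.
  by case: leqP => //= nk; rewrite xy// (leq_trans mn).
move=> /E_sum_bounded Exy; apply: contrapT => nxy.
(* All tails differ, so every coordinate contributes at least [r n / 2], and the sum diverges like
   that of the radii. *)
have rxy n : rows_from n x <> rows_from n y.
  move=> rxy; apply: nxy; exists n => m nm k.
  have := congr1 (fun g => g (pickle (m, k))) rxy.
  by rewrite /rows_from pickleK nm.
apply: rdiv; apply: (@bounded_sums_dom _ 0 _ (fun n => 2 `^ p *
  d n (f n (rows_from n x)) (f n (rows_from n y)) `^ p)).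
- by move=> n; rewrite mulr_ge0 ?powR_ge0.
- move=> n _; have d0 := (pseudometric_ge0 (borel_pseudometric_pseudometric (d_borel n))).
  rewrite -powRM//; apply: powR_le => //.
  by have := (Hf n).2 _ _ (rxy n); rewrite ler_pdivrMr// mulrC.
- by apply: bounded_sumsZ => //; exact: powR_ge0.
Qed.

End E1_reduction.

(** * [E1] does not reduce to an [lp]-sum of a separable normed space *)

Section more_sums.
Context {R : realType}.

Lemma sum_widen (a : nat -> R) m n : (forall k, 0 <= a k) -> (m <= n)%N ->
  \sum_(k < m) a k <= \sum_(k < n) a k.
Proof.
move=> a0 mn; rewrite -!(big_mkord xpredT a) [leRHS](big_cat_nat _ mn)//= lerDl.
exact: sumr_ge0.
Qed.

Lemma bounded_sums_tail (a : nat -> R) e : (forall k, 0 <= a k) ->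
  bounded_sums a -> 0 < e ->
  exists m, forall N, \sum_(n < N | (m <= n)%N) a n <= e.
Proof.
move=> a0 [M aM] e0.
have hs : has_sup (range (fun N => \sum_(n < N) a n)).
  by split; [exists (\sum_(n < 0) a n), 0%N|exists M => _ [N _ <-]].
have [_ [m _ <-] me] := sup_adherent e0 hs.
exists m => N.
have mNsup : \sum_(n < maxn m N) a n <= sup (range (fun N => \sum_(n < N) a n)).
  by apply: sup_upper_bound => //; exists (maxn m N).
have : \sum_(n < m) a n + \sum_(n < N | (m <= n)%N) a n <= \sum_(n < maxn m N) a n.
  rewrite [leRHS](bigID (fun n : 'I__ => (n < m)%N))/= lerD//.
    rewrite -(big_ord_widen_cond _ xpredT a)// leq_max leqnn//.
  rewrite -(big_mkord (fun n => m <= n)%N a).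
  rewrite -(big_mkord (fun n => ~~ (n < m))%N a).
  under [leRHS]eq_bigl => i do rewrite -leqNgt.
  rewrite [leRHS](big_cat_nat _ (leq_maxr m N))//= lerDl.
  exact: sumr_ge0.
lra.
Qed.

End more_sums.

(* A multiplicative form of lower semicontinuity, which avoids discussing the
   continuity of [powR] at [0]. *)
Lemma powR_sum_lsc (R : realType) (p : R) (t : nat -> R) N (e : R) : 1 <= p ->
  (forall n, 0 <= t n) -> 0 <= e -> e < \sum_(n < N) t n `^ p ->
  exists2 q, 0 <= q < 1 & forall t' : nat -> R,
    (forall n, (n < N)%N -> q * t n <= t' n) -> e < \sum_(n < N) t' n `^ p.
Proof.
move=> p1 t0 e0; set S := \sum_(n < N) _ => eS.
have p0 : 0 < p by exact: lt_le_trans p1.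
have S0 : 0 < S by exact: le_lt_trans eS.
(* Chosen so that [c * S] is midway between [e] and [S]. *)
pose c := (e + S) / (2 * S).
have c0 : 0 <= c by rewrite divr_ge0// ?mulr_ge0 ?addr_ge0// ltW.
have c1 : c < 1 by rewrite ltr_pdivrMr ?mulr_gt0//; lra.
have cp : (c `^ p^-1) `^ p = c by rewrite -powRrM mulVf ?gt_eqF// powRr1.
exists (c `^ p^-1).
  by rewrite powR_ge0 -(powR_lt p1) ?powR_ge0// cp powR1.
move=> t' tt'; apply: (@lt_le_trans _ _ (c * S)).
  by rewrite /c invfM mulrA -mulrA mulVf ?gt_eqF// mulr1; lra.
rewrite mulr_sumr; apply: ler_sum => n _.
by rewrite -{1}cp -powRM ?powR_ge0//; apply: (powR_le p1);
  [rewrite mulr_ge0 ?powR_ge0|exact: tt'].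
Qed.

(** Separability of the [lp]-sum of [V]: cut off a small tail, then approximate finitely many
    entries. The approximants are indexed by the countable type [seq nat]. *)
Lemma lp_finite_dense (R : realType) (V : normedModType R) (e : nat -> V) (p : R)
    (v : nat -> V) (eps : R) : 1 <= p ->
  (forall v eps, 0 < eps -> exists i, `|v - e i| < eps) ->
  bounded_sums (fun n => `|v n| `^ p) -> 0 < eps ->
  exists L : seq nat, forall N,
    \sum_(n < N) `|v n - (if (n < size L)%N then e (nth 0%N L n) else 0)| `^ p <= eps.
Proof.
move=> p1 ed vp eps0.
have p0 : 0 < p by exact: lt_le_trans p1.
have eps2 : 0 < eps / 2 by rewrite divr_gt0.
have [|m Hm] := bounded_sums_tail _ vp eps2; first by move=> n; exact: powR_ge0.
(* The geometric sum is at most [2], so these errors add up to at most [eps / 2], the other half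
   being left for the tail. *)
have /choice[i Hi] : forall n, exists i, `|v n - e i| `^ p <= eps / 4 * 2 ^- n.
  move=> n; have c0 : 0 < eps / 4 * 2 ^- n.
    by rewrite mulr_gt0// ?invr_gt0 ?exprn_gt0// divr_gt0.
  have [i Hi] := ed (v n) ((eps / 4 * 2 ^- n) `^ p^-1) (powR_gt0 _ c0).
  have cp : ((eps / 4 * 2 ^- n) `^ p^-1) `^ p = eps / 4 * 2 ^- n.
    by rewrite -powRrM mulVf ?gt_eqF// powRr1// ltW.
  by exists i; rewrite -cp; apply: (powR_le p1) => //; exact: ltW.
exists (mkseq i m) => N; rewrite size_mkseq.
rewrite (bigID (fun n : 'I_N => (n < m)%N))/= [eps]splitr lerD//.
  apply: (@le_trans _ _ (\sum_(n < N) eps / 4 * 2 ^- n)); last first.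
    rewrite -mulr_sumr sum_geometric.
    have : 0 <= eps * 2 ^- N.
      by rewrite mulr_ge0 ?invr_ge0 ?exprn_ge0// ltW.
    set h := 2 ^- N; lra.
  rewrite big_mkcond; apply: ler_sum => n _; case: ifP => nm.
    by rewrite nth_mkseq// nm; exact: Hi.
  by rewrite mulr_ge0 ?invr_ge0 ?exprn_ge0// divr_ge0// ltW.
under eq_bigl => n do rewrite -leqNgt.
apply: le_trans (Hm N); apply: ler_sum => n mn.
by rewrite ltnNge mn /= subr0.
Qed.

(** * Generic changes of a single row *)

Section change_row.
Implicit Types (x z : nat * nat -> bool) (A : set (nat * nat -> bool)).

Definition change_row k z x : nat * nat -> bool :=
  fun i => if i.1 == k then z i else x i.

Lemma change_row_continuous k z : continuous (change_row k z :
  prod_topology (fun _ : nat * nat => bool) -> prod_topology (fun _ : nat * nat => bool)).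
Proof.
apply: prod_continuous => i x; rewrite /change_row.
by case: (i.1 == k); [exact: cvg_cst|exact: proj_continuous].
Qed.

(** The Kuratowski-Ulam theorem for the splitting into row [k] and the other rows: density of a
    section of [O j] amounts to countably many dense open conditions on [x]. *)
Lemma comeager_change_row A : comeager A ->
  comeager [set x | forall k, comeager [set z | A (change_row k z x)]].
Proof.
move=> [ O Oo OA].
(* Here [q] is [((k, j), (t, s))], where the pair [(t, s)] codes the finite pattern on [s] that is
   true exactly on [t]. *)
pose W (q : nat * nat * (seq (nat * nat) * seq (nat * nat))) :=
  [set x | exists2 z, agree q.2.2 (fun i => i \in q.2.1) z &
    O q.1.2 (change_row q.1.1 z x)].
have W_comeager q : comeager (W q).
  case: q => [[k j] [t s]]; apply: comeager_open => [x [z tz Oz]|x s0].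
    have [s' sO] := (Oo j).1 _ Oz; exists s' => y xy; exists z => //; apply: sO.
    by move=> i si; rewrite /change_row; case: ifP => // _; exact: xy.
  have [y xy Oy] := (Oo j).2 (change_row k (fun i => i \in t) x) (s0 ++ s).
  exists (fun i => if i.1 == k then x i else y i).
    move=> i si; case: ifP => // ik.
    by rewrite -xy ?mem_cat ?si// /change_row ik.
  exists (fun i => if i.1 == k then y i else i \in t).
    move=> i si; case: ifP => // ik.
    by rewrite -xy ?mem_cat ?si ?orbT// /change_row ik.
  rewrite (_ : change_row _ _ _ = y)//; apply/funext => i.
  by rewrite /change_row; case: (i.1 == k).
apply: comeager_sub (comeager_bigcap W_comeager) => x Wx k.
exists (fun j => [set z | O j (change_row k z x)]) => [j|z Oz]; last first.
  by apply: OA => j _; exact: Oz.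
split=> [z Oz|z s].
  have [s sO] := (Oo j).1 _ Oz; exists s => z' zz'; apply: sO => i si.
  by rewrite /change_row; case: ifP => // _; exact: zz'.
have [z' zz' Oz'] := Wx (k, j, ([seq i <- s | z i], s)).
exists z' => // i si; rewrite -zz'//.
by rewrite /= mem_filter [i \in s]si andbT.
Qed.

(** Iterating the previous lemma and intersecting gives a set within which rows can be changed again
    and again, as the fusion over all the rows requires. *)
Lemma comeager_change_row_invariant A : comeager A -> exists B,
  [/\ B `<=` A, comeager B &
    forall x, B x -> forall k, comeager [set z | B (change_row k z x)]].
Proof.
move=> cA.
pose G := fix G n := if n is n'.+1 then
  G n' `&` [set x | forall k, comeager [set z | G n' (change_row k z x)]] else A.
have cG n : comeager (G n).
  by elim: n => [//|n IH]; apply: comeagerI => //; exact: comeager_change_row.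
exists [set x | forall n, G n x]; split.
- by move=> x /(_ 0%N).
- exact: comeager_bigcap cG.
- move=> x Gx k; apply: (@comeager_bigcap _ nat) => n.
  by have [_] := Gx n.+1; apply.
Qed.

End change_row.

Section E1_irreducible.
Context {R : realType} (V : normedModType R) (e : nat -> V) (p : R).
Hypothesis p_ge1 : 1 <= p.
Hypothesis e_dense : forall v eps, 0 < eps -> exists i, `|v - e i| < eps.

Let E : prod_topology (fun _ : nat => V) -> prod_topology (fun _ : nat => V) -> Prop :=
  E_sum (fun _ (u v : V) => `|u - v|) p.
Let Y := prod_topology (fun _ : nat * nat => bool).

Let p_gt0 : 0 < p. Proof. exact: lt_le_trans p_ge1. Qed.

Let V_base : exists B : nat -> set V, countable_base B.
Proof.
apply: (@metric_countable_base R V (fun u v => `|u - v|) (range e) 0).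
- exact: norm_metrizes.
- exact: (sub_countable (card_image_le _ _) (countableP _)).
- move=> A [v Av] oA.
  have [eps eps0 vA] := ((norm_metrizes V).2 v A).1 (open_nbhs_nbhs (conj oA Av)).
  by have [i vi] := e_dense v eps0; exists (e i); split; [exact: vA|exists i].
Qed.

Section reduction.
Variable theta : Y -> prod_topology (fun _ : nat => V).
Hypothesis thetaP : forall x y, E1 x y <-> E (theta x) (theta y).

Let zero_row (k : nat) : Y -> Y := change_row k (fun=> false).

Let S L n : V := if (n < size L)%N then e (nth 0%N L n) else 0.

(** Points are sorted by a finite sequence approximating the effect of erasing row [k]. For two
    points of the same part that differ only in row [k], the erased images coincide and cancel, so
    the images are close: this is [A_close]. *)
Let A (k : nat) (eps : R) L : set Y := [set x | forall N,
  \sum_(n < N) `|theta x n - theta (zero_row k x) n - S L n| `^ p <= eps].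

Let A_cover k eps x : 0 < eps -> exists L, A k eps L x.
Proof.
move=> eps0; have : E (theta x) (theta (zero_row k x)).
  apply/thetaP; exists k.+1 => n kn l.
  by rewrite /zero_row /change_row /= gtn_eqF.
by move=> /(E_sum_bounded p)/(lp_finite_dense p_ge1 e_dense)/(_ eps0).
Qed.

Let A_close k eps L x y : A k eps L x -> A k eps L y ->
  zero_row k x = zero_row k y -> forall N,
  \sum_(n < N) `|theta x n - theta y n| `^ p <= 2 `^ p * (eps + eps).
Proof.
move=> Ax Ay xy N.
apply: (@le_trans _ _ (2 `^ p * \sum_(n < N)
   (`|theta x n - theta (zero_row k x) n - S L n| `^ p +
    `|theta y n - theta (zero_row k y) n - S L n| `^ p))).
  rewrite mulr_sumr; apply: ler_sum => n _.
  apply: le_trans (powR_addle p_ge1 _ _) => //; apply: (powR_le p_ge1) => //.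
  apply: le_trans (ler_normB _ _); rewrite xy le_eqVlt; apply/orP; left; apply/eqP.
  by congr `|_|; rewrite opprB addrA subrK opprB addrA subrK.
by rewrite ler_wpM2l ?powR_ge0// big_split lerD.
Qed.

Variable C : set Y.
Hypothesis theta_cont : forall n, continuous_on C (fun x => theta x n).
Hypothesis theta_cont0 : forall k n, continuous_on C (fun x => theta (zero_row k x) n).

(** A violation is witnessed by a finite sum, which is lower semicontinuous on [C]. *)
Let A_closed k eps L x : 0 <= eps -> C x -> ~ A k eps L x ->
  exists s, forall y, C y -> agree s x y -> ~ A k eps L y.
Proof.
move=> eps0 Cx /existsNP[N /negP]; rewrite -ltNge => AxN.
pose t x n := `|theta x n - theta (zero_row k x) n - S L n|.
have t0 y n : 0 <= t y n by exact: normr_ge0.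
have [q /andP[q0 q1] Hq] := powR_sum_lsc p_ge1 (t0 x) eps0 AxN.
have /choice[s Hs] : forall n, exists s, forall y, C y -> agree s x y -> q * t x n <= t y n.
  move=> n; have [tx0|] := ltP 0 (t x n); last first.
    move=> tx0; exists [::] => y _ _; apply: le_trans (t0 y n).
    by rewrite mulr_ge0_le0.
  (* The admissible loss [(1 - q) * t x n] is split between the two continuity estimates. *)
  have u0 : 0 < (1 - q) * t x n / 2 by rewrite divr_gt0// mulr_gt0// subr_gt0.
  have [s1 Hs1] := @theta_cont n x Cx _ (nbhsx_ballx _ _ u0).
  have [s2 Hs2] := @theta_cont0 k n x Cx _ (nbhsx_ballx _ _ u0).
  exists (s1 ++ s2) => y Cy /agree_cat[xy1 xy2].
  have := Hs1 y Cy xy1; have := Hs2 y Cy xy2; rewrite -!ball_normE /=.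
  set u := (1 - q) * t x n / 2 => y2 y1.
  have : t x n <= t y n + (`|theta x n - theta y n| +
      `|theta (zero_row k x) n - theta (zero_row k y) n|).
    rewrite addrC -lerBlDr /t; apply: (le_trans (lerB_dist _ _)).
    set a := theta x n; set b := theta y n.
    set a' := theta _ n; set b' := theta _ n.
    rewrite (_ : _ - _ - _ = (a - b) - (a' - b')); first exact: ler_normB.
    rewrite opprB addrA subrK !opprB [b' - b]addrC [b' - a']addrC.
    by rewrite addrACA.
  rewrite /u in y1 y2 *; nra.
exists (flatten [seq s n | n <- iota 0 N]) => y Cy xy Ay.
have := Ay N; rewrite leNgt => /negP; apply; apply: (Hq (t y)) => n nN.
apply: Hs => //; apply: agree_sub xy => i si; apply/flatten_mapP; exists n => //.
by rewrite mem_iota.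
Qed.

(* Near a point of [D k eps], changing row [k] moves [theta] by at most [eps]. *)
Let D k eps : set Y := [set x | exists s L, forall y, C y -> agree s x y -> A k eps L y].

(** Baire's theorem: the countably many relatively closed sets [A k eps L] cover everything, so
    inside any cylinder one of them contains the trace of [C] on a smaller cylinder. *)
Let D_comeager k eps : comeager C -> 0 < eps -> comeager (D k eps).
Proof.
move=> cC eps0; apply: comeager_open => [x [s [L sL]]|x0 s0].
  exists s => y xy; exists s, L => z Cz yz; apply: sL => //.
  exact: agree_trans xy yz.
apply: contrapT => nD.
have noA s L x : agree s0 x0 x -> exists y, [/\ C y, agree s x y & ~ A k eps L y].
  move=> x0x; apply: contrapT => ny; apply: nD; exists x => //.
  exists s, L => y Cy xy; apply: contrapT => nA; apply: ny; by exists y.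
pose O L : set Y := [set x | agree s0 x0 x ->
  exists s, forall y, C y -> agree s x y -> ~ A k eps L y].
have cO L : comeager (O L).
  apply: comeager_open => [x Ox|x s].
    have [x0x|nx0x] := pselect (agree s0 x0 x); last first.
      exists s0 => y xy x0y; exfalso; apply: nx0x.
      exact: agree_trans x0y (agree_sym xy).
    have [s sO] := Ox x0x; exists s => y xy _; exists s => z Cz yz.
    by apply: sO => //; exact: agree_trans xy yz.
  have [x0x|nx0x] := pselect (agree s0 x0 x); last by exists x.
  have [y [Cy /agree_cat[xy _] nAy]] := noA (s ++ s0) L x x0x.
  by exists y => // _; exact: A_closed (ltW eps0) Cy nAy.
have [x x0x [Cx Ox]] := comeager_dense (comeagerI cC (comeager_bigcap cO)) x0 s0.
have [L AL] := A_cover k x eps0.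
by have [s sn] := Ox L x0x; exact: (sn x Cx).
Qed.

(** Solves for equality: the bound of [A_close], multiplied by the [p]-th power of the weight
    [2 ^+ j.+1], becomes exactly [2 ^- j]. *)
Let eps j : R := 2 ^- j / (2 ^+ j.+1) `^ p / (2 `^ p * 2).

Let eps_gt0 j : 0 < eps j.
Proof.
by rewrite !divr_gt0// ?mulr_gt0// ?powR_gt0// ?invr_gt0 exprn_gt0.
Qed.

Let modify_row k j x (s : seq (nat * nat)) (B : set Y) : B `<=` C `&` D k (eps j) ->
  B x -> comeager [set z | B (change_row k z x)] ->
  exists y, [/\ B y, agree s x y, forall i, i.1 != k -> y i = x i,
    exists l, x (k, l) != y (k, l) & forall N,
    \sum_(n < N) (2 ^+ j.+1 * `|theta x n - theta y n|) `^ p <= 2 ^- j].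
Proof.
move=> BCD Bx cB; have [Cx [s' [L sL]]] := BCD x Bx.
have cne : comeager [set z | exists l, x (k, l) != z (k, l)].
  apply: comeager_open => [z [l zl]|z t].
    exists [:: (k, l)] => y zy; exists l; rewrite -zy//; exact: mem_head.
  pose l := (\max_(i <- t) i.2).+1.
  exists (fun i => if i == (k, l) then ~~ x i else z i).
    move=> i ti; case: eqP => // ie; have := @leq_bigmax_seq _ t xpredT snd i ti isT.
    by rewrite ie /l ltnn.
  by exists l; rewrite eqxx; case: (x _).
have [z xz [Bz [l xzl]]] := comeager_dense (comeagerI cB cne) x (s ++ s').
have /agree_cat[xs xs'] : agree (s ++ s') x (change_row k z x).
  by move=> i si; rewrite /change_row; case: ifP => // _; exact: xz.
exists (change_row k z x); split => //.
- by move=> i ik; rewrite /change_row (negbTE ik).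
- by exists l; rewrite /change_row eqxx.
move=> N; have := A_close (sL x Cx (@agree_refl _ s' x)) (sL _ (BCD _ Bz).1 xs') _ N.
move=> H; have {}H := H _.
apply: (@le_trans _ _ ((2 ^+ j.+1) `^ p * (2 `^ p * (eps j + eps j)))).
  under eq_bigr => n _ do rewrite powRM ?exprn_ge0//.
  rewrite -mulr_sumr ler_wpM2l ?powR_ge0//; apply: H.
  by apply/funext => i; rewrite /zero_row /change_row; case: ifP.
have a0 : (2 ^+ j.+1 : R) `^ p != 0 by rewrite gt_eqF// powR_gt0// exprn_gt0.
have b0 : (2 : R) `^ p != 0 by rewrite gt_eqF// powR_gt0.
rewrite /eps; set a := _ `^ p in a0 *; set b := _ `^ p in b0 *; set c := 2 ^- j.
by rewrite le_eqVlt; apply/orP; left; apply/eqP; field; rewrite a0 b0.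
Qed.

Variable O : nat -> set Y.
Hypothesis O_open : forall j, cyl_open (O j) /\ cyl_dense (O j).
Hypothesis CE : C = \bigcap_j O j.

Lemma no_generic_reduction : False.
Proof.
have cC : comeager C by exists O => //; rewrite CE.
have [B [BCD cB Brow]] := comeager_change_row_invariant (comeagerI cC
  (comeager_bigcap (fun k => D_comeager k cC (eps_gt0 k)))).
have [x0 _ Bx0] := comeager_dense cB (fun=> false) [::].
have [||f [f0 Hf]] := @dependent_choice_from (Y * seq (nat * nat))%type
    (fun _ xs => B xs.1)
    (fun k xs yt => [/\ agree xs.2 xs.1 yt.1, {subset xs.2 <= yt.2},
      (forall z, agree yt.2 yt.1 z -> O k z),
      (forall i, i.1 != k -> yt.1 i = xs.1 i) &
      (exists l, xs.1 (k, l) != yt.1 (k, l)) /\ forall N,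
        \sum_(n < N) (2 ^+ k.+1 * `|theta xs.1 n - theta yt.1 n|) `^ p <= 2 ^- k]) (x0, [::]).
- by [].
- move=> k [x s] /= Bx.
  have [|y [By xy yx xyk xyN]] := @modify_row k k x s B _ Bx (Brow x Bx k).
    by move=> z /BCD[Cz Dz]; split => //; exact: Dz.
  have Oy : O k y by have := (BCD y By).1; rewrite CE; exact.
  have [t tO] := (O_open k).1 y Oy.
  exists (y, s ++ t); split => //; split => //=.
    by move=> i si; rewrite mem_cat si.
  by move=> z /agree_cat[_]; exact: tO.
pose x k := (f k).1.
have row_const k l m : (k < m)%N -> x m (k, l) = x k.+1 (k, l).
  elim: m => // m IH; rewrite ltnS leq_eqVlt => /orP[/eqP->//|km].
  have [_ [_ _ _ fix_ _]] := Hf m; rewrite /x fix_ /= ?ltn_eqF//; exact: IH.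
have row_init k l m : (m <= k)%N -> x m (k, l) = x0 (k, l).
  elim: m => [|m IH mk]; first by rewrite /x f0.
  have [_ [_ _ _ fix_ _]] := Hf m; rewrite /x fix_ /= ?gtn_eqF//; apply: IH; exact: ltnW.
have mono m n : (m <= n)%N -> {subset (f m).2 <= (f n).2} /\ agree (f m).2 (x m) (x n).
  elim: n => [|n IH]; first by rewrite leqn0 => /eqP->; split.
  rewrite leq_eqVlt => /orP[/eqP->|/IH[sub ag]]; first by split.
  have [_ [ag' sub' _ _ _]] := Hf n; split; first by move=> i /sub /sub'.
  exact: agree_trans ag (agree_sub sub ag').
(* Row [k] is changed at stage [k] only, hence is final at stage [k.+1]. *)
pose y : Y := fun i => x i.1.+1 i.
have xy m : agree (f m).2 (x m) y.
  move=> [k l] si; rewrite /y /=; have [mk|km] := leqP m k.+1.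
    by have [_ ->] := mono _ _ mk.
  by apply: row_const; exact: ltnW.
have xyt t : exists m, agree t (x m) y.
  exists (\max_(i <- t) i.1).+1 => -[k l] ti; rewrite /y /=.
  apply: row_const; rewrite ltnS.
  exact: (@leq_bigmax_seq _ t xpredT fst (k, l)).
have Cy : C y.
  rewrite CE => k _; have [_ [_ _ Ok _ _]] := Hf k.
  by apply: Ok; exact: xy.
have : ~ E1 x0 y.
  move=> [m /(_ m (leqnn m)) x0y].
  have [_ [_ _ _ _ [[l + _]]]] := Hf m.
  rewrite -[(f m).1]/(x m) -[(f m.+1).1]/(x m.+1) row_init// x0y.
  by rewrite eqxx.
apply; apply/thetaP/E_sum_bounded.
pose a k n := `|theta (x k) n - theta (x k.+1) n|.
(* Continuity at [y] is only coordinatewise, so the stage [m n] from which the limit is well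
   approximated depends on [n]. *)
have /choice[m Hm] : forall n, exists m, `|theta (x m) n - theta y n| <= 2 ^- n.
  move=> n; have n0 : 0 < (2 : R) ^- n by rewrite invr_gt0 exprn_gt0.
  have [t Ht] := @theta_cont n y Cy _ (nbhsx_ballx _ _ n0).
  have [m ag] := xyt t; exists m.
  have Cx : C (x m) by have [/BCD[]] := Hf m.
  by have := Ht _ Cx (agree_sym ag); rewrite -ball_normE /= distrC => /ltW.
(* [powR_sum_le] bounds the telescoping sum by [b n]; summing over [n] first leaves at most [2 ^- k]
   for each [k]. *)
pose b n := \sum_(k < m n) (2 ^+ k.+1 * a k n) `^ p.
have b_bounded : bounded_sums b.
  exists 2 => N; pose M := \max_(n < N) m n.
  apply: (@le_trans _ _ (\sum_(n < N) \sum_(k < M) (2 ^+ k.+1 * a k n) `^ p)).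
    apply: ler_sum => n _; apply: (sum_widen (a := fun k => (2 ^+ k.+1 * a k n) `^ p)).
      by move=> k; exact: powR_ge0.
    exact: (@leq_bigmax _ (fun n : 'I_N => m n)).
  rewrite exchange_big /=; apply: (@le_trans _ _ (\sum_(k < M) 2 ^- k)).
    by apply: ler_sum => k _; have [_ [_ _ _ _ [_ ]]] := Hf k; exact.
  by rewrite sum_geometric gerBl mulr_ge0// invr_ge0 exprn_ge0.
apply: (@bounded_sums_dom _ 0 _ (fun n => 2 `^ p * (b n + 2 ^- n))); last first.
- apply: bounded_sumsZ; first exact: powR_ge0.
  by apply: bounded_sumsD => //; exact: bounded_sums_geometric.
- move=> n _; have tel : `|theta x0 n - theta y n| <= \sum_(k < m n) a k n + 2 ^- n.
    apply: le_trans (lerD (lexx _) (Hm n)).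
    have H : `|theta x0 n - theta (x (m n)) n| <= \sum_(k < m n) a k n.
      elim: (m n) => [|q IH]; first by rewrite /x f0 subrr normr0 big_ord0.
      rewrite big_ord_recr /=; apply: le_trans (lerD IH (lexx _)).
      by rewrite (le_trans _ (ler_normD _ _))// addrA subrK.
    rewrite (le_trans _ (lerD H (lexx _)))//.
    by rewrite (le_trans _ (ler_normD _ _))// addrA subrK.
  apply: le_trans (powR_le p_ge1 _ tel) _ => //.
  apply: le_trans (powR_addle p_ge1 _ _) _.
  + by apply: sumr_ge0 => k _; exact: normr_ge0.
  + by rewrite invr_ge0 exprn_ge0.
  rewrite ler_wpM2l ?powR_ge0// lerD//; last exact: powR_geometric_le.
  by apply: (powR_sum_le p_ge1 (x := fun k => a k n)) => k; exact: normr_ge0.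
- move=> n; rewrite mulr_ge0 ?powR_ge0// addr_ge0// ?invr_ge0 ?exprn_ge0//.
  by apply: sumr_ge0 => k _; exact: powR_ge0.
Qed.

End reduction.

Theorem E1_not_reducible : ~ borel_reducible E1 E.
Proof.
move=> [theta tb tP]; have [B Bb] := V_base.
have cont (f : Y -> Y) n : borel_fun f ->
    exists2 C, comeager C & continuous_on C (fun x => theta (f x) n).
  move=> fb; apply: (borel_generically_continuous Bb).
  apply: (@borel_fun_comp _ _ _ f (fun x => theta x n) fb).
  apply: (@borel_fun_comp _ _ _ theta (proj n) tb).
  apply: borel_fun_continuous; exact: proj_continuous.
have /choice[C1 HC1] : forall n, exists C, comeager C /\ continuous_on C (fun x => theta x n).
  move=> n; have [|C ? ?] := cont id n; last by exists C.
  exact.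
have /choice[C2 HC2] : forall kn : nat * nat, exists C, comeager C /\
    continuous_on C (fun x => theta (change_row kn.1 (fun=> false) x) kn.2).
  move=> [k n]; have [|C ? ?] := cont (change_row k (fun=> false)) n; last by exists C.
  by apply: borel_fun_continuous; exact: change_row_continuous.
(* Shrinking the set of continuity to a countable intersection of open sets lets the fusion force
   its limit into it. *)
have [ O Oo OC] := comeagerI (comeager_bigcap (fun n => (HC1 n).1))
  (comeager_bigcap (fun n => (HC2 n).1)).
apply: (@no_generic_reduction theta tP (\bigcap_j O j) _ _ O Oo erefl).
- move=> n; apply: continuous_on_sub (HC1 n).2 => x /OC[Cx _]; exact: Cx.
- move=> k n; apply: continuous_on_sub (HC2 (k, n)).2 => x /OC[_ Cx]; exact: Cx.
Qed.

End E1_irreducible.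

(** * [RN_mod_l1] does not reduce to [E0] *)

Section l1_irreducible.
Context {R : realType}.
Let w (n : nat) : R := n.+1%:R^-1.
Let Y := prod_topology (fun _ : nat => bool).
Implicit Types (x y z : Y) (s t u : seq nat).

Let w_ge0 n : 0 <= w n. Proof. by rewrite invr_ge0. Qed.

Let w_unbounded : ~ bounded_sums w.
Proof.
move=> [M wM]; apply: (@dvg_harmonic R); apply: nondecreasing_is_cvgn.
  by apply/nondecreasing_seqP => n; rewrite /series/= big_nat_recr//= lerDl.
by exists M => _ [N _ <-]; rewrite /series /= big_mkord; exact: wM.
Qed.

Let w_small e : 0 < e -> exists L, forall n, (L <= n)%N -> w n <= e.
Proof.
move=> e0; have [L _ HL] := near_infty_natSinv_lt (PosNum e0).
by exists L => n /HL /ltW.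
Qed.

Let xor_in t : Y -> Y := bitxor (fun i => i \in t).

Let symdiff t u := [seq i <- t | i \notin u] ++ [seq i <- u | i \notin t].

Let xor_in_symdiff t u x : xor_in (symdiff t u) x = xor_in t (xor_in u x).
Proof.
apply/funext => i; rewrite /xor_in /bitxor mem_cat !mem_filter -addbA; congr addb.
by case: (i \in t); case: (i \in u).
Qed.

Section reduction.
Variable Theta : Y -> nat -> bool.
Hypothesis ThetaP : forall x y,
  (exists m, forall n, (m <= n)%N -> Theta x n = Theta y n) <->
  bounded_sums (fun n => if x n == y n then 0 else w n).
Variables (C : set Y) (O : nat -> set Y).
Hypothesis Theta_cont : forall n, continuous_on C (fun x => Theta x n).
Hypothesis O_open : forall j, cyl_open (O j) /\ cyl_dense (O j).
Hypothesis CE : C = \bigcap_j O j.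
Hypothesis C_xor : forall t x, C x -> C (xor_in t x).

Let mass_le t (e : R) := forall N, \sum_(i < N | val i \in t) w i <= e.

Let Theta_locally_constant n x : C x ->
  exists s, forall y, C y -> agree s x y -> Theta y n = Theta x n.
Proof.
by move=> Cx; apply: (@Theta_cont n x Cx [set b | b = Theta x n]); exact: discrete_set1.
Qed.

(* Otherwise one builds [xl] and [yl = bitxor hl xl] by fusion, where [hl] has
   finite mass but [Theta xl] and [Theta yl] differ infinitely often. *)
Let stable_cylinder : exists x0 s e m, 0 < e /\ forall x, C x -> agree s x0 x ->
  forall t, {in s, forall i, i \notin t} -> mass_le t e ->
  forall n, (m <= n)%N -> Theta (xor_in t x) n = Theta x n.
Proof.
apply: contrapT => unstable.
have {unstable}flips x0 s e m : 0 < e -> exists x t n,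
    [/\ C x, agree s x0 x, {in s, forall i, i \notin t}, mass_le t e &
       (m <= n)%N /\ Theta (xor_in t x) n != Theta x n].
  move=> e0; apply: contrapT => nflip; apply: unstable; exists x0, s, e, m.
  split=> // x Cx x0x t st te n mn; apply/eqP; apply: contrapT => /negP ne.
  by apply: nflip; exists x, t, n.
have cC : comeager C by exists O => //; rewrite CE.
have [x0 _ Cx0] := comeager_dense cC (fun=> false) [::].
pose good (q : Y * seq nat * seq nat) := C q.1.1.
pose next k (q q' : Y * seq nat * seq nat) :=
  [/\ agree q.1.2 q.1.1 q'.1.1 /\ agree q.1.2 (fun i => i \in q.2) (fun i => i \in q'.2),
      {subset q.1.2 <= q'.1.2} /\ k \in q'.1.2,
      (forall z, agree q'.1.2 q'.1.1 z -> O k z) /\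
      (forall z, agree q'.1.2 (xor_in q'.2 q'.1.1) z -> O k z),
      exists2 n, (k <= n)%N & exists b,
      (forall z, C z -> agree q'.1.2 q'.1.1 z -> Theta z n = b) /\
      (forall z, C z -> agree q'.1.2 (xor_in q'.2 q'.1.1) z -> Theta z n = ~~ b) &
      forall N, \sum_(i < N | val i \in q'.2) w i <=
        \sum_(i < N | val i \in q.2) w i + 2 ^- k].
have [||f [f0 Hf]] := @dependent_choice_from _ (fun=> good) next (x0, [::], [::]).
- exact: Cx0.
- move=> k [[x s] h]; rewrite /good /= => Cx.
  have k0 : 0 < (2 : R) ^- k by rewrite invr_gt0 exprn_gt0.
  have [x2 [t [n [Cx2 xx2 st tk [kn ne]]]]] := flips (xor_in h x) s _ k k0.
  pose x1 := xor_in h x2.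
  have x1x2 : xor_in h x1 = x2 by exact: bitxorK.
  have Cx1 : C x1 by exact: C_xor.
  have xx1 : agree s x x1.
    by move=> i si; rewrite /x1 /xor_in /bitxor -xx2// /xor_in /bitxor addbK.
  have [h' [hh' h'h Th']] : exists h', [/\ agree s (fun i => i \in h) (fun i => i \in h'),
      forall N, \sum_(i < N | val i \in h') w i <=
        \sum_(i < N | val i \in h) w i + 2 ^- k &
      Theta (xor_in h' x1) n = ~~ Theta x1 n].
    (* At [n], [Theta] differs between [x2] and [xor_in t x2], so at one of them it differs from its
       value at [x1]. Seen from [x1], these two points are the flips along [h] and [symdiff t h]. *)
    have [e|ne1] := eqVneq (Theta x2 n) (~~ Theta x1 n).
      by exists h; rewrite x1x2; split => // N; rewrite lerDl ltW.
    exists (symdiff t h); split.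
    - move=> i si; rewrite mem_cat !mem_filter (negbTE (st i si)) /=.
      by rewrite andbF.
    - move=> N; apply: le_trans (lerD (lexx _) (tk N)).
      rewrite !(big_mkcond (fun i : 'I_N => _ \in _)) /= -big_split.
      apply: ler_sum => i _; rewrite mem_cat !mem_filter.
      by case: (val i \in t); case: (val i \in h) => /=; rewrite ?addr0 ?add0r ?addr_ge0.
    - rewrite xor_in_symdiff x1x2.
      by move: ne ne1; case: (Theta (xor_in t x2) n); case: (Theta x2 n); case: (Theta x1 n).
  have Chx : C (xor_in h' x1) by exact: C_xor.
  have CO z : C z -> O k z by rewrite CE; exact.
  have [s1 Hs1] := (O_open k).1 _ (CO _ Cx1).
  have [s2 Hs2] := (O_open k).1 _ (CO _ Chx).
  have [s3 Hs3] := Theta_locally_constant n Cx1.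
  have [s4 Hs4] := Theta_locally_constant n Chx.
  exists (x1, s ++ k :: s1 ++ s2 ++ s3 ++ s4, h'); rewrite /good /=.
  split => //; split => //=.
  + split; first by move=> i si; rewrite mem_cat si.
    by rewrite mem_cat mem_head orbT.
  + split => z zag; [apply: Hs1|apply: Hs2]; apply: agree_sub zag => i si;
    by rewrite !(mem_cat, in_cons) si !orbT.
  + exists n => //; exists (Theta x1 n); split => z Cz zag.
      by apply: Hs3 => //; apply: agree_sub zag => i si; rewrite !(mem_cat, in_cons) si !orbT.
    rewrite -Th'; apply: Hs4 => //; apply: agree_sub zag => i si.
    by rewrite !(mem_cat, in_cons) si !orbT.
pose x k : Y := (f k).1.1; pose s k := (f k).1.2; pose h k i := i \in (f k).2.
have mono m n : (m <= n)%N -> [/\ {subset s m <= s n}, agree (s m) (x m) (x n) &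
    agree (s m) (h m) (h n)].
  elim: n => [|n IH]; first by rewrite leqn0 => /eqP->; split.
  rewrite leq_eqVlt => /orP[/eqP->|/IH[sub ag agh]]; first by split.
  have [_ [[ag' agh'] [sub' _] _ _ _]] := Hf n; split; first by move=> i /sub /sub'.
    exact: agree_trans ag (agree_sub sub ag').
  exact: agree_trans agh (agree_sub sub agh').
have sk k : k \in s k.+1 by have [_ [_ []]] := Hf k.
pose xl : Y := fun i => x i.+1 i; pose hl i := h i.+1 i.
have xxl k : agree (s k) (x k) xl /\ agree (s k) (h k) hl.
  split=> i si; rewrite /xl /hl; have [ki|/ltnW ik] := leqP k i.+1.
  - by have [_ ag _] := mono _ _ ki; exact: ag.
  - by have [_ ag _] := mono _ _ ik; rewrite ag.
  - by have [_ _ ag] := mono _ _ ki; exact: ag.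
  - by have [_ _ ag] := mono _ _ ik; rewrite ag.
pose yl := bitxor hl xl.
have xyl k : agree (s k) (xor_in (f k).2 (x k)) yl.
  by move=> i si; rewrite /xor_in /yl /bitxor -(xxl k).1// -(xxl k).2.
have Cxl : C xl.
  by rewrite CE => k _; have [_ [_ _ [Ok _] _ _]] := Hf k; apply: Ok; exact: (xxl k.+1).1.
have Cyl : C yl.
  by rewrite CE => k _; have [_ [_ _ [_ Ok] _ _]] := Hf k; apply: Ok; exact: xyl k.+1.
have [|m Hm] := (ThetaP xl yl).2 _.
  exists 2 => N.
  have hN k : \sum_(i < N | val i \in (f k).2) w i <= \sum_(j < k) 2 ^- j.
    elim: k => [|k IH]; first by rewrite f0 big_pred0 // big_ord0.
    rewrite big_ord_recr /=; apply: le_trans (lerD IH (lexx _)).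
    by have [_ [_ _ _ _]] := Hf k; exact.
  apply: le_trans (le_trans (hN N) _); last first.
    by rewrite sum_geometric gerBl mulr_ge0// invr_ge0 exprn_ge0.
  rewrite [leRHS]big_mkcond /=; apply: ler_sum => i _.
  have [sub _ hag] := mono i.+1 N (ltn_ord i).
  have -> : (val i \in (f N).2) = hl i.
    by rewrite -[LHS]/(h N i) -hag.
  by rewrite /yl /bitxor; case: (xl i); case: (hl i).
have [_ [_ _ _ [n mn [b [Hb Hb']]] _]] := Hf m.
have := Hm n mn; rewrite (Hb _ Cxl (xxl m.+1).1) (Hb' _ Cyl (xyl m.+1)).
by case: b {Hb Hb'}.
Qed.

(** By stability, flipping one bit outside [s], of mass at most [e], does not change [Theta] from
    [m] on. Finitely many such flips and continuity make this part of [Theta] constant on [C] in a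
    cylinder. Flipping all the bits outside [s] then preserves the class in spite of its infinite
    mass. *)
Lemma no_generic_l1_reduction : False.
Proof.
have [x0 [s0 [e [m [e0 stable]]]]] := stable_cylinder.
have [L wL] := w_small e0.
pose s := s0 ++ iota 0 L.
have flip1 x i n : C x -> agree s x0 x -> i \notin s -> (m <= n)%N ->
    Theta (xor_in [:: i] x) n = Theta x n.
  move=> Cx /agree_cat[x0x _]; rewrite mem_cat mem_iota add0n negb_or => /andP[is0 iL] mn.
  apply: stable => // [j js|N]; first by rewrite inE; apply: contraNneq is0 => <-.
  have [iN|Ni] := ltnP i N.
    rewrite (bigD1 (Ordinal iN)) ?inE//= big1 ?addr0; first by apply: wL; rewrite leqNgt.
    by move=> j /andP[]; rewrite inE -val_eqE /= => /eqP-> /eqP.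
  rewrite big1 ?ltW// => j; rewrite inE => /eqP ji.
  by have := ltn_ord j; rewrite ji ltnNge Ni.
have Theta_const x x' n : C x -> C x' -> agree s x0 x -> agree s x0 x' -> (m <= n)%N ->
    Theta x n = Theta x' n.
  move=> Cx Cx' x0x x0x' mn.
  have [t Ht] := Theta_locally_constant n Cx'.
  (* Single flips move [x] to a point agreeing with [x'] on the finite list [t]; continuity at [x']
     finishes. *)
  suff [z [Cz _ zx' <-]] : exists z, [/\ C z, agree s x0 z, agree t x' z & Theta z n = Theta x n].
    exact: Ht.
  elim: t {Ht} => [|i t [z [Cz x0z x'z Tz]]]; first by exists x; split.
  have [zi|ne] := eqVneq (z i) (x' i).
    exists z; split => // j; rewrite in_cons => /orP[/eqP->//|]; exact: x'z.
  have si : i \notin s.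
    by apply: contra ne => si; rewrite -x0z// -x0x'.
  exists (xor_in [:: i] z); split; first exact: C_xor.
  - move=> j sj; rewrite /xor_in /bitxor inE; case: eqP => [ji|_].
      by rewrite -ji sj in si.
    by rewrite addbF; exact: x0z.
  - move=> j; rewrite in_cons /xor_in /bitxor inE; case: eqP => [->|_] /=.
      by move: ne; case: (z i); case: (x' i).
    by rewrite addbF; exact: x'z.
  - by rewrite flip1.
have cC : comeager C by exists O => //; rewrite CE.
pose g i := i \notin s.
have [x x0x [Cx Cgx]] := comeager_dense (comeagerI cC (comeager_bitxor g cC)) x0 s.
have /ThetaP gsum : exists m, forall n, (m <= n)%N -> Theta x n = Theta (bitxor g x) n.
  exists m => n mn; apply: Theta_const => // i si.
  by rewrite /bitxor /g si addbF; exact: x0x.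
apply: w_unbounded.
apply: (@bounded_sums_dom _ (\max_(i <- s) i).+1 _ _ _ _ gsum).
  by move=> n; case: ifP.
move=> n sn; have gn : g n.
  apply/negP => /(@leq_bigmax_seq _ s xpredT id)/(_ isT).
  by rewrite leqNgt sn.
by rewrite /bitxor gn; case: (x n).
Qed.

End reduction.

Theorem l1_not_reducible : ~ borel_reducible (@RN_mod_l1 R) E0.
Proof.
move=> [theta tb tP].
pose emb (x : Y) : prod_topology (fun _ : nat => R) := fun n => if x n then w n else 0.
have emb_cont : continuous emb.
  apply: prod_continuous => n; apply: cyl_continuous => x _ A Ax.
  exists [:: n] => y _ xy; rewrite /emb -xy ?mem_head//; exact: nbhs_singleton Ax.
pose Theta x := theta (emb x).
have [B Bb] := bool_countable_base.
have /choice[C0 HC0] : forall n, exists C, comeager C /\ continuous_on C (fun x : Y => Theta x n).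
  move=> n; have [|C ? ?] := @borel_generically_continuous nat _ B (fun x : Y => Theta x n) Bb.
    have tbn : borel_fun (fun v => theta v n : bool).
      apply: (@borel_fun_comp _ cantor_space bool theta (fun y => y n) tb).
      apply: borel_fun_continuous; exact: (@proj_continuous _ (fun=> bool) n).
    exact: (borel_fun_comp (borel_fun_continuous emb_cont) tbn).
  by exists C.
have [ O Oo OC] := comeager_bigcap (fun n => (HC0 n).1).
(* Intersecting all the finite flips of the [O j] makes the resulting set invariant under every
   [xor_in t]. *)
pose O' k : set Y := if unpickle k is Some (t, j) then xor_in t @^-1` O j else setT.
have OE x : (\bigcap_k O' k) x <-> forall t j, O j (xor_in t x).
  split=> [Ox t j|Ox k _].
    by have := Ox (pickle (t, j)) Logic.I; rewrite /O' pickleK.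
  by rewrite /O'; case: unpickle => [[t j]|//]; exact: Ox.
apply: (@no_generic_l1_reduction Theta _ (\bigcap_k O' k) O' _ _ erefl).
- move=> x y; rewrite -[X in X <-> _]/(E0 (theta (emb x)) (theta (emb y))) -tP.
  rewrite /RN_mod_l1 nneseries_bounded//.
  rewrite (_ : (fun n => `|_|) = (fun n => if x n == y n then 0 else w n))//.
  apply/funext => n; rewrite /emb; case: (x n); case: (y n) => /=;
    by rewrite ?subrr ?normr0 ?subr0 ?sub0r ?normrN// ger0_norm.
- move=> n; apply: continuous_on_sub (HC0 n).2 => x /OE Ox.
  apply: OC => j _; have := Ox [::] j; rewrite (_ : xor_in [::] x = x)//.
  by apply/funext => i; rewrite /xor_in /bitxor addbF.
- move=> k; rewrite /O'; case: unpickle => [[t j]|].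
    split; first exact: cyl_open_bitxor (Oo j).1.
    exact: cyl_dense_bitxor (Oo j).2.
  by split=> [x _|x s]; [exists [::]|exists x].
- move=> t x /OE Ox; apply/OE => u j; rewrite -xor_in_symdiff; exact: Ox.
Qed.

End l1_irreducible.

(** * Embedding into [c0] *)

Section c0_facts.
Context {R : realType}.
Implicit Types u v : c0 R.

Lemma c0_subE u v n : c0_seq (u - v) n = c0_seq u n - c0_seq v n.
Proof. by rewrite -[c0_seq (u - v)]/(val (u - v)) raddfB. Qed.

Lemma c0_norm_ub u n : `|c0_seq u n| <= `|u|.
Proof.
rewrite c0_normE; apply: sup_upper_bound; last by exists n.
split; first by exists `|c0_seq u 0%N|, 0%N.
have /asboolP u0 : c0_seq u \in @c0_pred R by case: u.
have /cvg_seq_bounded/pinfty_ex_gt0[M _ uM] : cvgn (c0_seq u).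
  by apply/cvg_ex; exists 0.
by exists M => _ [k _ <-]; exact: uM.
Qed.

Lemma c0_norm_le u (M : R) : (forall n, `|c0_seq u n| <= M) -> `|u| <= M.
Proof.
move=> uM; rewrite c0_normE; apply: ge_sup; first by exists `|c0_seq u 0%N|, 0%N.
by move=> _ [n _ <-].
Qed.

Lemma c0_finite_support (a : nat -> R) N :
  (forall n, (N <= n)%N -> a n = 0) -> a \in @c0_pred R.
Proof.
move=> aN; apply/asboolP; apply: (cvg_near_cst 0).
by exists N => // n /= Nn; rewrite aN.
Qed.

Lemma seq_in_c0 (L : seq rat) : (fun n => ratr (nth 0 L n) : R) \in @c0_pred R.
Proof.
by apply: (@c0_finite_support _ (size L)) => n Ln; rewrite nth_default// raddf0.
Qed.

Definition c0_rat n : c0 R :=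
  MkC0 (seq_in_c0 (if unpickle n is Some L then L else [::])).

Lemma c0_ratE n k : c0_seq (c0_rat n) k =
  ratr (nth 0 (if unpickle n is Some L then L else [::]) k).
Proof. by []. Qed.

Lemma c0_rat_dense u e : 0 < e -> exists i, `|u - c0_rat i| < e.
Proof.
move=> e0; have e20 : 0 < e / 2 by rewrite divr_gt0.
have /asboolP u0 : c0_seq u \in @c0_pred R by case: u.
have [N _ uN] := (cvgrPdist_lt _ _).1 u0 _ e20.
have /choice[q Hq] : forall n, exists q : rat, `|c0_seq u n - ratr q| < e / 2.
  move=> n; have [||y [/= yx [q _ qy]]] :=
    @dense_rat R [set y | `|c0_seq u n - y| < e / 2].
  - by exists (c0_seq u n) => /=; rewrite subrr normr0.
  - exact: (@metric_ball_open R _ _ _ _ (@norm_metrizes R R^o)).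
  by exists q; rewrite qy.
exists (pickle (mkseq q N)); apply: (@le_lt_trans _ _ (e / 2)); last first.
  by rewrite ltr_pdivrMr// ltr_pMr// ltr1n.
apply: c0_norm_le => n; rewrite c0_subE c0_ratE pickleK.
have [nN|Nn] := ltnP n N; first by rewrite nth_mkseq// ltW.
rewrite nth_default ?size_mkseq// raddf0 subr0.
by have := uN n Nn; rewrite sub0r normrN => /ltW.
Qed.

Lemma range_dense (V : normedModType R) (s : nat -> V) :
  (forall (v : V) e, 0 < e -> exists i, `|v - s i| < e) -> dense (range s).
Proof.
move=> sd A [v Av] oA.
have [e e0 vA] := ((norm_metrizes V).2 v A).1 (open_nbhs_nbhs (conj oA Av)).
by have [i vi] := sd v e e0; exists (s i); split; [exact: vA|exists i].
Qed.

Lemma c0_base : countable_base (metric_balls (fun u v => `|u - v|) c0_rat).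
Proof.
apply: metric_balls_base; first exact: norm_metrizes.
by apply: range_dense; exact: c0_rat_dense.
Qed.

(** An open ball is a countable union of closed balls, and a closed ball is a countable intersection
    of conditions on single coordinates. *)
Lemma borel_fun_c0 (T : topologicalType) (f : T -> c0 R) :
  (forall n, borel_fun (fun x => c0_seq (f x) n)) -> borel_fun f.
Proof.
move=> fb; apply: (borel_fun_base c0_base) => k; rewrite /metric_balls.
case: unpickle => [[i q]|]; last first.
  by rewrite preimage_set0; apply: borel_open; exact: open0.
set a := c0_rat i; set e := _^-1.
rewrite (_ : _ @^-1` _ = \bigcup_m \bigcap_n
    [set x | `|c0_seq a n - c0_seq (f x) n| <= e - m.+1%:R^-1]).
  apply: borel_setU_countable => m; apply: borel_setI_countable => n.
  set c := e - _.
  rewrite (_ : [set _ | _] = ~` ([set x | c0_seq (f x) n < c0_seq a n - c] `|`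
      [set x | c0_seq a n + c < c0_seq (f x) n])).
    have /borel_fun_realP fbn := fb n.
    by apply: borel_setC; apply: borel_setU; [exact: (fbn _).1|exact: (fbn _).2].
  rewrite setCU; apply/seteqP; split=> x /=; rewrite distrC ler_distl.
    by move=> /andP[? ?]; split; apply/negP; rewrite -leNgt.
  by move=> [/negP + /negP]; rewrite -!leNgt => -> ->.
apply/seteqP; split=> x.
  rewrite /preimage /= => ae; have ae0 : 0 < e - `|a - f x| by rewrite subr_gt0.
  have [m _ /(_ m (leqnn m)) /= me] := near_infty_natSinv_lt (PosNum ae0).
  exists m => // n _; rewrite /mkset -(c0_subE a (f x) n) (le_trans (c0_norm_ub _ _))//.
  by rewrite lerBrDr addrC -lerBrDr ltW.
move=> [m _ xm]; rewrite /preimage /=.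
apply: (@le_lt_trans _ _ (e - m.+1%:R^-1)).
  by apply: c0_norm_le => n; rewrite c0_subE; exact: xm.
by rewrite ltrBlDr ltrDl invr_gt0.
Qed.

End c0_facts.

Section lipschitz.
Context {R : realType}.
Implicit Types a b c : R.

Lemma dist_min_le a a' b b' c : `|a - a'| <= c -> `|b - b'| <= c ->
  `|Num.min a b - Num.min a' b'| <= c.
Proof. by rewrite !ler_norml; case: (lerP a b); case: (lerP a' b'); lra. Qed.

Lemma dist_max0_le a a' c : `|a - a'| <= c -> `|Num.max 0 a - Num.max 0 a'| <= c.
Proof. by rewrite !ler_norml; case: (lerP 0 a); case: (lerP 0 a'); lra. Qed.

End lipschitz.

(* Aharoni's embedding into [c0], above scale [r] only. At scale [scale k], the
   coordinates [bump k i] form a point-finite family of 1-Lipschitz bumps,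
   centred at the [s i] and vanishing near the base point [s 0]. *)
Section c0_embedding.
Context {R : realType} (T : Type) (d : T -> T -> R) (r : R) (s : nat -> T).
Hypothesis d_pm : is_pseudometric d.
Hypothesis r_gt0 : 0 < r.
Hypothesis s_net : forall u, exists i, d u (s i) < r.

Let scale k : R := 2 ^+ k.+1 * r.

(** The term of [s 0] is present even for [i = 0]: it makes all bumps of large scale vanish at a
    given point. *)
Fixpoint cutoff k i u : R := if i is j.+1
  then Num.min (cutoff k j u) (d u (s j) - scale k / 2)
  else d u (s 0) - scale k / 2.

Definition bump k i u : R :=
  Num.max 0 (Num.min (scale k - d u (s i)) (cutoff k i u)).

Let dist_lip u v a : `|d u a - d v a| <= d u v.
Proof.
have := pseudometric_triangle d_pm u v a; have := pseudometric_triangle d_pm v u a.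
by rewrite (pseudometric_sym d_pm v u) ler_norml => ? ?; lra.
Qed.

Lemma bump_lip k i u v : `|bump k i u - bump k i v| <= d u v.
Proof.
apply: dist_max0_le; apply: dist_min_le.
  rewrite (_ : _ - _ - _ = d v (s i) - d u (s i)); first by rewrite distrC.
  by ring.
elim: i => [|i IH] /=; last apply: dist_min_le => //;
  by rewrite opprB addrA subrK; exact: dist_lip.
Qed.

Lemma cutoff_le k i j u : (j < i)%N -> cutoff k i u <= d u (s j) - scale k / 2.
Proof.
elim: i => // i IH; rewrite ltnS leq_eqVlt /= ge_min => /orP[/eqP->|/IH->//].
by rewrite lexx orbT.
Qed.

Lemma cutoff_le0 k i u : cutoff k i u <= d u (s 0) - scale k / 2.
Proof. by elim: i => [//|i IH] /=; rewrite ge_min IH. Qed.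

Lemma cutoff_ge k i u c : c <= d u (s 0) - scale k / 2 ->
  (forall j, (j < i)%N -> c <= d u (s j) - scale k / 2) -> c <= cutoff k i u.
Proof.
move=> c0; elim: i => [//|i IH] ci /=; rewrite le_min ci// IH// => j ji.
by apply: ci; exact: ltnW.
Qed.

Lemma bump_eq0 k i u : cutoff k i u <= 0 -> bump k i u = 0.
Proof. by move=> c0; apply: max_idPl; rewrite ge_min c0 orbT. Qed.

Let scale_half k : scale k / 2 = 2 ^+ k * r.
Proof. by rewrite /scale exprS; field. Qed.

Let scale_half_ge k : r <= scale k / 2.
Proof. by rewrite scale_half ler_pMl// exprn_ege1// ler1n. Qed.

Let scale_large D : exists K, forall k, (K <= k)%N -> D < scale k / 2.
Proof.
have [|||K HK] := @bounded_sums_small R (r / (`|D| + 1)) (fun n => 2 ^- n).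
- by move=> n; rewrite invr_ge0 exprn_ge0.
- exact: bounded_sums_geometric.
- by rewrite divr_gt0// ltr_wpDl.
exists K => k /HK; rewrite scale_half ltr_pdivlMr ?ltr_wpDl// mulrC ltr_pdivrMr ?exprn_gt0//.
by rewrite [r * _]mulrC; apply: lt_trans; rewrite (le_lt_trans (ler_norm _))// ltrDl.
Qed.

(** Large scales are killed by the base point, and large indices by some earlier [s j] within [r] of
    [u], as [r] is at most [scale k / 2]. *)
Lemma bump_finite_support u : exists N, forall k i, (N <= pickle (k, i))%N ->
  bump k i u = 0.
Proof.
have [j uj] := s_net u.
have [K HK] := scale_large (d u (s 0)).
exists (\max_(ki : 'I_K * 'I_j.+1) pickle (val ki.1, val ki.2)).+1 => k i Nki.
apply: bump_eq0; have [kK|Kk] := ltnP k K; last first.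
  by rewrite (le_trans (cutoff_le0 _ _ _))// subr_le0 ltW// HK.
have [ij|ji] := leqP i j; last first.
  rewrite (le_trans (cutoff_le _ _ ji))// subr_le0.
  exact: le_trans (ltW uj) (scale_half_ge k).
have := @leq_bigmax _ (fun ki : 'I_K * 'I_j.+1 => pickle (val ki.1, val ki.2))
  (Ordinal kK, Ordinal (ij : (i < j.+1)%N)).
by rewrite leqNgt Nki.
Qed.

(** When [d u v] is between [2 * scale k] and [4 * scale k], some bump is at least [scale k / 4] at
    one point and zero at the other, whence the factor [16]. Such a [k] exists because [4 * r] is
    [2 * scale 0]. *)
Lemma bump_separates u v : 4 * r <= d u v ->
  exists k i, d u v <= 16 * `|bump k i u - bump k i v|.
Proof.
move=> uv4.
have [k [kuv uvk]] : exists k, 2 * scale k <= d u v /\ d u v < 2 * scale k.+1.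
  have ex : exists k, d u v < 2 * scale k.
    have [K HK] := scale_large (d u v); exists K.
    have := HK K (leqnn K); have : 0 < scale K by rewrite mulr_gt0// exprn_gt0.
    lra.
  case: (ex_minnP ex) => -[|k] uvk kmin.
    by move: uvk; rewrite /scale expr1; move: uv4; lra.
  by exists k; split => //; rewrite leNgt; apply/negP => /kmin; rewrite ltnn.
have scaleS : scale k.+1 = 2 * scale k by rewrite /scale exprS mulrA.
have tri := pseudometric_triangle d_pm; have sym := pseudometric_sym d_pm.
(* The base point cannot be within [scale k] of both points, as these are [2 * scale k] apart. *)
wlog us0 : u v uv4 kuv uvk / scale k <= d u (s 0).
  move=> H; have [?|us0] := leP (scale k) (d u (s 0)); first exact: H.
  have [||||i [j Hij]] := H v u; rewrite ?(sym v u)//.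
    by have := tri u (s 0) v; rewrite (sym (s 0) v); move: us0 kuv; lra.
  by exists i, j; rewrite (sym u v) distrC.
have ex : exists i, d u (s i) < 3 / 4 * scale k.
  have [i ui] := s_net u; exists i; apply: (lt_le_trans ui).
  by have := scale_half_ge k; move: r_gt0; lra.
(* For the first such [i], [u] keeps distance [3 / 4 * scale k] from the earlier points, which
   leaves a margin of [scale k / 4] in [cutoff]. *)
case: (ex_minnP ex) => i ui imin; exists k, i.
have bu : scale k / 4 <= bump k i u.
  rewrite /bump le_max; apply/orP; right; rewrite le_min; apply/andP; split.
    by move: ui; lra.
  apply: cutoff_ge => [|j ji]; first by move: us0 ui; have := pseudometric_ge0 d_pm u (s i); lra.
  have : 3 / 4 * scale k <= d u (s j).
    by rewrite leNgt; apply/negP => /imin; rewrite leqNgt ji.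
  lra.
have -> : bump k i v = 0.
  apply: max_idPl; rewrite ge_min; apply/orP; left.
  have := tri u (s i) v; rewrite (sym (s i) v).
  by move: ui kuv; lra.
rewrite subr0 ger0_norm; last by rewrite le_max lexx.
move: bu uvk; rewrite scaleS; lra.
Qed.

Definition c0_coord (u : T) (l : nat) : R :=
  if pickle_inv l is Some (k, i) then bump k i u else 0.

Lemma c0_coord_in u : c0_coord u \in @c0_pred R.
Proof.
have [N uN] := bump_finite_support u; apply: (@c0_finite_support _ _ N) => l Nl.
rewrite /c0_coord; case E: (pickle_inv l) => [[k i]|//]; apply: uN.
by have := @pickle_invK (nat * nat)%type l; rewrite E /= => ->.
Qed.

Definition c0_embed u : c0 R := MkC0 (c0_coord_in u).

Lemma c0_embed_lip u v : `|c0_embed u - c0_embed v| <= d u v.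
Proof.
apply: c0_norm_le => l; rewrite c0_subE /= /c0_coord.
case: pickle_inv => [[k i]|]; first exact: bump_lip.
by rewrite subrr normr0; exact: pseudometric_ge0.
Qed.

Lemma c0_embed_coarse u v : d u v <= Num.max (4 * r) (16 * `|c0_embed u - c0_embed v|).
Proof.
rewrite le_max; case: (leP (d u v) (4 * r)) => //= /ltW /bump_separates[k [i uv]].
rewrite (le_trans uv)// ler_wpM2l//.
have := c0_norm_ub (c0_embed u - c0_embed v) (pickle (k, i)).
by rewrite c0_subE /= /c0_coord pickleK_inv.
Qed.

End c0_embedding.

Lemma borel_c0_embed (R : realType) (T : topologicalType) (d : T -> T -> R) (r : R)
    (s : nat -> T) (d_pm : is_pseudometric d) (r_gt0 : 0 < r)
    (s_net : forall u, exists i, d u (s i) < r) :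
  (forall i, borel_fun (fun u => d u (s i))) ->
  borel_fun (c0_embed r_gt0 s_net).
Proof.
move=> db; apply: borel_fun_c0 => l /=; rewrite /c0_coord.
case: pickle_inv => [[k i]|]; last by apply: borel_fun_continuous => u; exact: cvg_cst.
have cutb j : borel_fun (cutoff d r s k j).
  elim: j => [|j IH] /=; first exact: borel_fun_addr.
  by apply: borel_fun_min => //; exact: borel_fun_addr.
apply: borel_fun_max; first by apply: borel_fun_continuous; exact: cst_continuous.
apply: borel_fun_min => //.
rewrite (_ : (fun u => _) = fun u => - d u (s i) + 2 ^+ k.+1 * r).
  by apply: borel_fun_addr; exact: borel_fun_opp.
by apply/funext => u; rewrite addrC.
Qed.

Section c0_reduction.
Context {R : realType} (X : nat -> topologicalType)
  (d : forall n, X n -> X n -> R) (p : R).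
Arguments d : clear implicits.
Hypothesis p_ge1 : 1 <= p.
Hypothesis X_nonempty : forall n, [set: X n] !=set0.
Hypothesis d_borel : forall n, borel_pseudometric (d n).

Let d_pm n := borel_pseudometric_pseudometric (d_borel n).

Lemma borel_dist n (a : X n) : borel_fun (fun u => d n u a).
Proof.
apply: (@borel_fun_comp _ (X n * X n)%type _ (fun u => (u, a)) _ _
  (borel_pseudometric_borel (d_borel n))).
apply: borel_fun_continuous => u; apply: cvg_pair; [exact: cvg_id|exact: cvg_cst].
Qed.

Lemma c0_reducible : series_converges (fun n => (delta (d n) `^ p)%E) ->
  borel_reducible (E_sum d p : prod_topology X -> prod_topology X -> Prop) (@E_c0 R p).
Proof.
move=> /(summable_radii p_ge1)[m [r [rsep r0 rsum]]].
have /choice_prod[s Hs] : forall n, exists s : nat -> X n, (m <= n)%N ->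
    forall u, exists i, d n u (s i) < r n.
  move=> n; have [mn|nm] := leqP m n; last first.
    by have [u _] := X_nonempty n; exists (fun=> u).
  have [S cS Sr] := rsep n mn; have [|s Ss] := countable_enum cS.
    by have [u _] := X_nonempty n; have [s Ss _] := Sr u; exists s.
  exists s => _ u; have [a + ua] := Sr u; rewrite Ss => -[i _ ia].
  by exists i; rewrite ia.
(* Below [m] no net is provided; these finitely many coordinates do not affect the relation and are
   sent to [0]. *)
pose theta (x : prod_topology X) : prod_topology (fun _ : nat => c0 R) :=
  fun n => if pselect (m <= n)%N is left mn
    then c0_embed (r0 n) (Hs n mn) (x n) else 0.
exists theta.
  apply: borel_fun_prod => [n|n].
    by exists (metric_balls (fun u v : c0 R => `|u - v|) (@c0_rat R)); exact: c0_base.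
  rewrite /theta; case: pselect => mn; last first.
    by apply: borel_fun_continuous; exact: cst_continuous.
  apply: (@borel_fun_comp _ _ _ (fun x : prod_topology X => x n)).
    by apply: borel_fun_continuous; exact: proj_continuous.
  by apply: borel_c0_embed => // i; exact: borel_dist.
move=> x y; rewrite /E_c0 !E_sum_bounded; split=> xy.
  apply: (@bounded_sums_dom _ m _ (fun n => d n (x n) (y n) `^ p)) => //.
    by move=> n; exact: powR_ge0.
  move=> n mn; apply: (powR_le p_ge1) => //; rewrite /theta; case: pselect => // mn'.
  exact: c0_embed_lip.
apply: (@bounded_sums_dom _ m _ (fun n => 4 `^ p * r n `^ p +
    16 `^ p * `|theta x n - theta y n| `^ p)).
- by move=> n; rewrite addr_ge0// mulr_ge0// powR_ge0.
- move=> n mn; rewrite -!powRM ?(ltW (r0 n))//.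
  have : d n (x n) (y n) <= Num.max (4 * r n) (16 * `|theta x n - theta y n|).
    by rewrite /theta; case: pselect => // mn'; exact: c0_embed_coarse.
  rewrite le_max => /orP[] /(powR_le p_ge1 (pseudometric_ge0 (d_pm n) _ _)) /le_trans; apply.
    by rewrite lerDl powR_ge0.
  by rewrite lerDr powR_ge0.
- by apply: bounded_sumsD; apply: bounded_sumsZ => //; exact: powR_ge0.
Qed.

End c0_reduction.

(** * Reducing [RN_mod_l1] *)

Section clip.
Context {R : realType}.
Implicit Types v u : R.

Definition clip v i : R := Num.min (Num.max (v - i%:R) 0) 1.

Lemma clip_bounds v i : 0 <= clip v i <= 1.
Proof. by rewrite /clip le_min ler01 ge_min lexx orbT andbT le_max lexx orbT. Qed.

Lemma clip_le v u i : v <= u -> clip v i <= clip u i.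
Proof.
move=> vu; have vu0 : Num.max (v - i%:R) 0 <= Num.max (u - i%:R) 0.
  by rewrite ge_max !le_max lerD2r vu lexx orbT.
by rewrite /clip le_min !ge_min vu0 lexx orbT.
Qed.

Lemma sum_clip v I : \sum_(i < I) clip v i = Num.min (Num.max v 0) I%:R.
Proof.
elim: I => [|I IH].
  by rewrite big_ord0; symmetry; apply/min_idPr; rewrite le_max lexx orbT.
have I0 : 0 <= I%:R :> R by [].
rewrite big_ord_recr /= IH /clip -natr1.
move: I0; set a := I%:R => a0.
case: (lerP v 0) => v0; case: (lerP (v - a) 0) => va; repeat (case: lerP => ?); lra.
Qed.

Lemma sum_dist_clip v u I : \sum_(i < I) `|clip v i - clip u i| =
  `|Num.min (Num.max v 0) I%:R - Num.min (Num.max u 0) I%:R|.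
Proof.
wlog vu : v u / v <= u.
  move=> H; have [/H//|/ltW/H] := leP v u.
  by rewrite distrC => <-; apply: eq_bigr => i _; rewrite distrC.
rewrite -!sum_clip [RHS]distrC -sumrB ger0_norm.
  by apply: eq_bigr => i _; rewrite distrC ger0_norm// subr_ge0; exact: clip_le.
by apply: sumr_ge0 => i _; rewrite subr_ge0; exact: clip_le.
Qed.

(* The [n]-th real coordinate is cut into the pieces [signed_clip v i] along
   the intervals [[i/2, i/2 + 1]] for [i] even and their opposites for [i] odd. *)
Definition signed_clip v i := clip (if odd i then - v else v) i./2.

Lemma sum_dist_signed_clip v u I :
  \sum_(i < I.*2) `|signed_clip v i - signed_clip u i| =
  `|Num.min (Num.max v 0) I%:R - Num.min (Num.max u 0) I%:R| +
  `|Num.min (Num.max (- v) 0) I%:R - Num.min (Num.max (- u) 0) I%:R|.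
Proof.
rewrite -!sum_dist_clip; elim: I => [|I IH]; first by rewrite !big_ord0 addr0.
rewrite doubleS !big_ord_recr /= IH /signed_clip /= odd_double /= uphalf_double doubleK.
by rewrite addrAC !addrA; ring.
Qed.

Lemma dist_pos_neg v u : `|Num.max v 0 - Num.max u 0| +
  `|Num.max (- v) 0 - Num.max (- u) 0| = `|v - u|.
Proof.
case: (lerP v 0) => v0; case: (lerP u 0) => u0; case: (lerP (- v) 0) => v0';
  case: (lerP (- u) 0) => u0'; try lra; repeat (case: ger0P => ?); lra.
Qed.

Lemma sum_dist_signed_clip_le v u I :
  \sum_(i < I) `|signed_clip v i - signed_clip u i| <= `|v - u|.
Proof.
apply: (@le_trans _ _ (\sum_(i < I.*2) `|signed_clip v i - signed_clip u i|)).
  apply: (sum_widen (a := fun i => `|signed_clip v i - signed_clip u i|)) => //.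
  by rewrite -addnn leq_addr.
rewrite sum_dist_signed_clip -(dist_pos_neg v u).
by apply: lerD; apply: dist_min_le; rewrite // subrr normr0.
Qed.

Lemma sum_dist_signed_clip_eq v u : exists I,
  \sum_(i < I) `|signed_clip v i - signed_clip u i| = `|v - u|.
Proof.
have [I vI] : exists I : nat, `|v| + `|u| < I%:R.
  exists (Num.truncn (`|v| + `|u|)).+1; exact: truncnS_gt.
exists I.*2; rewrite sum_dist_signed_clip.
have [vv uu] : `|v| < I%:R /\ `|u| < I%:R.
  by split; apply: le_lt_trans vI; rewrite (lerDl, lerDr).
move: vv uu; rewrite !ltr_norml; set a := I%:R => /andP[? ?] /andP[? ?].
rewrite !(min_idPl _) ?ge_max; try (apply/andP; split; lra).
exact: dist_pos_neg.
Qed.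

Lemma nneseries_signed_clip v u :
  (\sum_(0 <= i <oo) `|signed_clip v i - signed_clip u i|%:E = `|v - u|%:E)%E.
Proof.
apply/eqP; rewrite eq_le; apply/andP; split.
  apply: lime_le; first by apply: is_cvg_nneseries => n _ _; rewrite lee_fin.
  by apply: nearW => N; rewrite sumEFin lee_fin big_mkord sum_dist_signed_clip_le.
have [I <-] := sum_dist_signed_clip_eq v u.
rewrite -sumEFin -(big_mkord xpredT (fun n => `|signed_clip v n - signed_clip u n|%:E)).
by apply: nneseries_lim_ge => n _; rewrite lee_fin.
Qed.

Definition pieces (x : nat -> R) (k : nat) : R :=
  if pickle_inv k is Some (n, i) then signed_clip (x n) i else 0.

Lemma pieces_bounds x k : 0 <= pieces x k <= 1.
Proof.
by rewrite /pieces; case: pickle_inv => [[n i]|]; [exact: clip_bounds|rewrite lexx ler01].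
Qed.

(** Each piece is monotone in its coordinate, so distances add up exactly; this [l1]-isometry leaves
    only sequences in [[0, 1]] to be coded. *)
Lemma nneseries_pieces x y : (\sum_(0 <= k <oo) `|pieces x k - pieces y k|%:E =
  \sum_(0 <= n <oo) `|x n - y n|%:E)%E.
Proof.
rewrite nneseries_esumT; last by move=> k; rewrite lee_fin.
transitivity (\esum_(k in range (@pickle (nat * nat)%type)) `|pieces x k - pieces y k|%:E)%E.
  rewrite [RHS]esum_mkcond; apply: eq_esum => k _; case: ifPn => //.
  rewrite notin_setE => nk; rewrite /pieces.
  case E: (@pickle_inv (nat * nat)%type k) => [q|]; last by rewrite subrr normr0.
  by exfalso; apply: nk; exists q => //; have := @pickle_invK (nat * nat)%type k; rewrite E.
rewrite (@reindex_esum R _ _ setT _ (@pickle (nat * nat)%type)); last first.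
  by split=> [q _|a b _ _ /(pcan_inj pickleK)|//]; first by exists q.
transitivity (\esum_(n in setT) \esum_(i in setT)
    `|signed_clip (x n) i - signed_clip (y n) i|%:E)%E.
  rewrite esum_esum; last by move=> n i _ _; rewrite lee_fin.
  rewrite (_ : _ `*`` _ = setT); last by apply/seteqP; split => // -[].
  by apply: eq_esum => -[n i] _; rewrite /pieces pickleK_inv.
rewrite nneseries_esumT; last by move=> n; rewrite lee_fin.
apply: eq_esum => n _; rewrite -nneseries_esumT; last by move=> i; rewrite lee_fin.
exact: nneseries_signed_clip.
Qed.

End clip.

Section blocks.
Context {R : realType}.

Lemma bounded_sums_blocks (a : nat -> R) (m : nat -> nat) : (forall n, 0 <= a n) ->
  m 0%N = 0%N -> (forall k, (m k < m k.+1)%N) ->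
  bounded_sums a <-> bounded_sums (fun k => \sum_(m k <= n < m k.+1) a n).
Proof.
move=> a0 m0 mS.
have sumE K : \sum_(k < K) \sum_(m k <= n < m k.+1) a n = \sum_(n < m K) a n.
  elim: K => [|K IH]; first by rewrite m0 !big_ord0.
  rewrite big_ord_recr /= IH -!(big_mkord xpredT a) -big_cat_nat//=.
  exact: ltnW.
have mK K : (K <= m K)%N by elim: K => // K /leq_ltn_trans; apply.
split=> -[M aM]; exists M => N; first by rewrite sumE.
by apply: le_trans (aM N); rewrite sumE; exact: sum_widen.
Qed.

(** Terms are taken until the running sum reaches [c], so the overshoot is at most a single term. *)
Lemma sum_below (e : nat -> R) m l (eta c : R) : (forall n, 0 <= e n) -> 0 <= c ->
  0 <= eta -> (forall n, (m <= n < m + l)%N -> e n <= eta) ->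
  c <= \sum_(m <= n < m + l) e n ->
  c <= \sum_(m <= n < m + l) (if \sum_(m <= i < n) e i < c then e n else 0) <= c + eta.
Proof.
move=> e0 c0 eta0.
pose T q := \sum_(m <= i < m + q) e i.
pose S q := \sum_(m <= n < m + q) (if \sum_(m <= i < n) e i < c then e n else 0).
have TS q : T q.+1 = T q + e (m + q)%N.
  by rewrite /T addnS big_nat_recr//= leq_addr.
have SS q : S q.+1 = S q + (if T q < c then e (m + q)%N else 0).
  by rewrite /S addnS big_nat_recr//= leq_addr.
suff H : (forall n, (m <= n < m + l)%N -> e n <= eta) ->
    (T l < c -> S l = T l) /\ (c <= T l -> c <= S l <= c + eta).
  by move=> /H[_]; exact.
elim: l => [_|l IH eeta].
  rewrite /T /S addn0 !big_geq//; split=> // c00.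
  by rewrite c00 addr_ge0.
have [|IH1 IH2] := IH.
  by move=> n /andP[mn nl]; apply: eeta; rewrite mn addnS ltnW.
have el : e (m + l)%N <= eta by apply: eeta; rewrite leq_addr addnS ltnS leqnn.
rewrite TS SS; have := e0 (m + l)%N; case: (ltP (T l) c) => [Tc|cT] el0.
  by rewrite (IH1 Tc); split => // ce; rewrite ce lerD// ltW.
by rewrite addr0; split=> [H|_]; [exfalso; move: H cT el0; lra|exact: IH2].
Qed.

End blocks.

Section l1_reduction.
Context {R : realType} (X : nat -> topologicalType)
  (d : forall n, X n -> X n -> R) (p : R).
Arguments d : clear implicits.
Hypothesis p_ge1 : 1 <= p.
Hypothesis X_polish : forall n, polish R (X n).
Hypothesis X_nonempty : forall n, [set: X n] !=set0.
Hypothesis d_borel : forall n, borel_pseudometric (d n).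

Let d_pm n := borel_pseudometric_pseudometric (d_borel n).

Let p_gt0 : 0 < p. Proof. exact: lt_le_trans p_ge1. Qed.

Let block (k m : nat) : cond_l1 d p -> exists q : nat * (forall n, X n) * (forall n, X n),
  [/\ (m < q.1.1)%N, forall n, d n (q.1.2 n) (q.2 n) `^ p < 2 ^- k &
    1 <= \sum_(m <= n < q.1.1) d n (q.1.2 n) (q.2 n) `^ p].
Proof.
move=> l1; have k0 : 0 < (2 : R) ^- k by rewrite invr_gt0 exprn_gt0.
have [x [y [xyk xyoo]]] := l1 _ k0.
pose e n := d n (x n) (y n) `^ p.
have e0 n : 0 <= e n by exact: powR_ge0.
have eunb : ~ bounded_sums e.
  by move=> /(nneseries_bounded e0); rewrite xyoo ltxx.
have [M HM] : exists M, \sum_(n < m) e n + 1 < \sum_(n < M) e n.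
  apply: contrapT => nM; apply: eunb; exists (\sum_(n < m) e n + 1) => N.
  by rewrite leNgt; apply/negP => HN; apply: nM; exists N.
have mM : (m < M)%N.
  rewrite ltnNge; apply/negP => Mm; have := sum_widen e0 Mm; move: HM; lra.
exists (M, x, y); split => //=.
move: HM; rewrite -!(big_mkord xpredT e) (big_cat_nat _ (ltnW mM))//=; lra.
Qed.

Theorem l1_reducible : cond_l1 d p ->
  borel_reducible (@RN_mod_l1 R) (E_sum d p : prod_topology X -> prod_topology X -> Prop).
Proof.
move=> l1.
have /choice[F HF] : forall km : nat * nat, exists q : nat * (forall n, X n) * (forall n, X n),
  [/\ (km.2 < q.1.1)%N, forall n, d n (q.1.2 n) (q.2 n) `^ p < 2 ^- km.1 &
    1 <= \sum_(km.2 <= n < q.1.1) d n (q.1.2 n) (q.2 n) `^ p].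
  by move=> [k m]; exact: block.
pose m := fix m k := if k is k'.+1 then (F (k', m k')).1.1 else 0%N.
have mS k : (m k < m k.+1)%N by have [] := HF (k, m k).
have m_mono k l : (k <= l)%N -> (m k <= m l)%N.
  elim: l => [|l IH]; first by rewrite leqn0 => /eqP->.
  by rewrite leq_eqVlt => /orP[/eqP->//|/IH kl]; exact: leq_trans kl (ltnW (mS l)).
have /choice[kappa Hkappa] : forall n, exists k, (m k <= n < m k.+1)%N.
  elim=> [|n [k /andP[kn nk]]]; first by exists 0%N; exact: (mS 0%N).
  have [nk'|kn'] := ltnP n.+1 (m k.+1); first by exists k; rewrite (leq_trans kn).
  by exists k.+1; rewrite kn' (leq_ltn_trans nk (mS k.+1)).
have kappaE k n : (m k <= n < m k.+1)%N -> kappa n = k.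
  move=> /andP[kn nk]; have /andP[kn' nk'] := Hkappa n.
  apply/eqP; rewrite eqn_leq; apply/andP; split; rewrite leqNgt; apply/negP => /m_mono kk.
    by have := leq_ltn_trans kn' nk; rewrite ltnNge kk.
  by have := leq_ltn_trans kn nk'; rewrite ltnNge kk.
pose a n : X n := (F (kappa n, m (kappa n))).1.2 n.
pose b n : X n := (F (kappa n, m (kappa n))).2 n.
pose e n := d n (a n) (b n) `^ p.
have e0 n : 0 <= e n by exact: powR_ge0.
have e_small k n : (m k <= n < m k.+1)%N -> e n <= 2 ^- k.
  move=> kn; have [_ /(_ n) H _] := HF (k, m k).
  by rewrite /e /a /b (kappaE _ _ kn) ltW.
have e_block k : 1 <= \sum_(m k <= n < m k.+1) e n.
  have [_ _] := HF (k, m k); rewrite [leRHS]big_nat [X in _ -> _ <= X]big_nat /=.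
  move=> /le_trans; apply; rewrite le_eqVlt; apply/orP; left; apply/eqP.
  by apply: eq_bigr => n kn; rewrite /e /a /b (kappaE _ _ kn).
pose t n := \sum_(m (kappa n) <= i < n) e i.
(* Two images differ at [n] only if the threshold [t n] separates the two pieces. By [sum_below],
   the total over block [k] is the distance of the pieces up to [2 ^- k], a summable error. *)
pose theta (x : nat -> R) n : X n := if t n < pieces x (kappa n) then a n else b n.
pose S k c := \sum_(m k <= n < m k.+1) (if \sum_(m k <= i < n) e i < c then e n else 0).
have SP k c : 0 <= c <= 1 -> c <= S k c <= c + 2 ^- k.
  move=> /andP[c0 c1]; have mkE : m k.+1 = (m k + (m k.+1 - m k))%N by rewrite subnKC// ltnW.
  rewrite /S mkE; apply: sum_below; rewrite -?mkE//.
  - exact: e_small.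
  - exact: le_trans (e_block k).
have S_mono k c c' : c <= c' -> S k c' - S k c =
    \sum_(m k <= n < m k.+1) (if (\sum_(m k <= i < n) e i < c) ==
       (\sum_(m k <= i < n) e i < c') then 0 else e n).
  move=> cc'; rewrite /S -sumrB; apply: eq_bigr => n _; set s := \sum_(_ <= i < n) e i.
  by case: (ltP s c) => sc; case: (ltP s c') => sc' /=; rewrite ?subrr ?subr0//; lra.
have blockE x y k : \sum_(m k <= n < m k.+1) d n (theta x n) (theta y n) `^ p =
    `|S k (pieces x k) - S k (pieces y k)|.
  wlog xy : x y / pieces x k <= pieces y k.
    move=> H; have [/H//|/ltW/H] := leP (pieces x k) (pieces y k).
    rewrite distrC => <-; apply: eq_bigr => n _.
    by rewrite (pseudometric_sym (d_pm n)).
  rewrite distrC S_mono// ger0_norm; last first.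
    by apply: sumr_ge0 => n _; case: ifP.
  rewrite big_nat [RHS]big_nat; apply: eq_bigr => n kn.
  rewrite /theta /t (kappaE _ _ kn); case: ifP => c1; case: ifP => c2 /=.
  - by rewrite (pseudometric_xx (d_pm n)) powR0 ?gt_eqF.
  - by [].
  - by rewrite (pseudometric_sym (d_pm n)).
  - by rewrite (pseudometric_xx (d_pm n)) powR0 ?gt_eqF.
have dist_block x y k :
    `|\sum_(m k <= n < m k.+1) d n (theta x n) (theta y n) `^ p -
      `|pieces x k - pieces y k| | <= 2 ^- k.
  rewrite blockE; have /andP[] := SP k _ (pieces_bounds x k).
  have /andP[] := SP k _ (pieces_bounds y k).
  set u := S _ _; set v := S _ _; set u' := pieces _ _; set v' := pieces _ _ => *.
  apply: (le_trans (ler_dist_dist _ _)); rewrite ler_norml; apply/andP; split; lra.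
exists theta.
  apply: borel_fun_prod => [n|n].
    exact: polish_countable_base.
  apply: borel_fun_if.
  have pb : borel_fun (fun x : prod_topology (fun _ : nat => R) => pieces x (kappa n)).
    rewrite /pieces; case: pickle_inv => [[l i]|]; last first.
      by apply: borel_fun_continuous; exact: cst_continuous.
    have xb : borel_fun (fun x : prod_topology (fun _ : nat => R) => x l : R).
      by apply: borel_fun_continuous; exact: (@proj_continuous _ (fun=> R) l).
    apply: borel_fun_min; last by apply: borel_fun_continuous; exact: cst_continuous.
    apply: borel_fun_max; last by apply: borel_fun_continuous; exact: cst_continuous.
    by apply: borel_fun_addr; case: odd => //; exact: borel_fun_opp.
  exact: ((borel_fun_realP _).2 pb (t n)).2.
move=> x y; rewrite /RN_mod_l1 -nneseries_pieces nneseries_bounded// E_sum_bounded.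
rewrite (@bounded_sums_blocks _ (fun n => d n (theta x n) (theta y n) `^ p) m _ erefl mS);
  last by move=> n; exact: powR_ge0.
have blk0 k : 0 <= \sum_(m k <= n < m k.+1) d n (theta x n) (theta y n) `^ p.
  by apply: sumr_ge0 => n _; exact: powR_ge0.
split=> [xy|xy].
  apply: (@bounded_sums_dom _ 0 _ (fun k => `|pieces x k - pieces y k| + 2 ^- k)).
  - by move=> k; rewrite addr_ge0// invr_ge0 exprn_ge0.
  - by move=> k _; have := dist_block x y k; rewrite ler_norml => /andP[_]; rewrite lerBlDl.
  - by apply: bounded_sumsD => //; exact: bounded_sums_geometric.
apply: (@bounded_sums_dom _ 0 _ (fun k =>
   \sum_(m k <= n < m k.+1) d n (theta x n) (theta y n) `^ p + 2 ^- k)).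
- by move=> k; rewrite addr_ge0// invr_ge0 exprn_ge0.
- move=> k _; have := dist_block x y k; rewrite ler_norml => /andP[+ _].
  set u := \sum_(_ <= _ < _) _; set v := `|_|; lra.
- by apply: bounded_sumsD => //; exact: bounded_sums_geometric.
Qed.

End l1_reduction.

(** * The [E0] case *)

Lemma borel_reducible_trans (T U V : topologicalType) (E : T -> T -> Prop)
    (F : U -> U -> Prop) (G : V -> V -> Prop) :
  borel_reducible E F -> borel_reducible F G -> borel_reducible E G.
Proof.
move=> [f fb EF] [g gb FG]; exists (g \o f); first exact: borel_fun_comp.
by move=> x y; rewrite EF FG.
Qed.

Section E0_reduction.
Context {R : realType} (X : nat -> topologicalType)
  (d : forall n, X n -> X n -> R) (p : R).
Arguments d : clear implicits.
Hypothesis p_ge1 : 1 <= p.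
Hypothesis X_nonempty : forall n, [set: X n] !=set0.
Hypothesis d_pm : forall n, is_pseudometric (d n).

Let p_gt0 : 0 < p. Proof. exact: lt_le_trans p_ge1. Qed.

Lemma E0_reducible (c : R) : 0 < c ->
  (forall N, exists2 n, (N <= n)%N & exists u v, c <= d n u v `^ p) ->
  borel_reducible E0 (E_sum d p : prod_topology X -> prod_topology X -> Prop).
Proof.
move=> c0 far.
have [n0 _ far0] := far 0%N.
have [||nu [_ Hnu]] := @dependent_choice_from nat
  (fun _ n => exists u v, c <= d n u v `^ p) (fun _ n n' => (n < n')%N) n0.
- by [].
- by move=> _ n _; have [n' nn' ?] := far n.+1; exists n'.
have nu_lt k l : (k < l)%N -> (nu k < nu l)%N.
  elim: l => // l IH; rewrite ltnS leq_eqVlt => /orP[/eqP->|/IH kl].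
    exact: (Hnu l).2.
  exact: ltn_trans kl (Hnu l).2.
have nu_ge k : (k <= nu k)%N by elim: k => // k /leq_ltn_trans; apply; exact: nu_lt.
have nu_inj : injective nu.
  by move=> k l kl; case: (ltngtP k l) => // /nu_lt; rewrite kl ltnn.
have /choice_prod[ab Hab] : forall n, exists q : X n * X n,
    (exists k, nu k = n) -> c <= d n q.1 q.2 `^ p.
  move=> n; have [[k kn]|nk] := pselect (exists k, nu k = n).
    by have [[u [v uv]] _] := Hnu k; case: _ / kn; exists (u, v).
  by have [u _] := X_nonempty n; exists (u, u).
pose inv n := xget 0%N [set k | nu k = n].
have invK k : inv (nu k) = k.
  by apply: nu_inj; apply: (@xgetPex _ 0%N [set l | nu l = nu k]); exists k.
pose theta (x : nat -> bool) n : X n :=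
  if `[< exists k, nu k = n >] && x (inv n) then (ab n).1 else (ab n).2.
exists theta.
  apply: borel_fun_continuous; apply: prod_continuous => n.
  apply: cyl_continuous => x _ A Ax; exists [:: inv n] => y _ xy.
  by rewrite /theta -xy ?mem_head//; exact: nbhs_singleton Ax.
move=> x y; split=> [[m xy]|/E_sum_bounded xy].
  apply/E_sum_bounded; apply: (@bounded_sums_dom _ (nu m) _ (fun=> 0)) => //; last first.
    by exists 0 => N; rewrite big1.
  move=> n mn; rewrite (_ : theta x n = theta y n).
    by rewrite (pseudometric_xx (d_pm n)) powR0 ?gt_eqF.
  rewrite /theta; case: asboolP => //= -[k kn]; rewrite -kn invK xy//.
  by rewrite leqNgt; apply/negP => /nu_lt; rewrite kn ltnNge mn.
have [|m Hm] := bounded_sums_small _ xy c0; first by move=> n; exact: powR_ge0.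
exists m => k mk; apply/eqP; apply: contrapT => /negP xyk.
have := Hm _ (leq_trans mk (nu_ge k)); rewrite ltNge => /negP; apply.
have := Hab (nu k) (ex_intro _ k erefl).
rewrite /theta invK; case: asboolP => [_|[]]; last by exists k.
move: xyk; case: (x k); case: (y k) => //= _.
by rewrite (pseudometric_sym (d_pm _)).
Qed.

End E0_reduction.

Section E0_dichotomy.
Context {R : realType} (X : nat -> topologicalType)
  (d : forall n, X n -> X n -> R) (p : R).
Arguments d : clear implicits.
Hypothesis p_ge1 : 1 <= p.
Hypothesis X_nonempty : forall n, [set: X n] !=set0.
Hypothesis d_borel : forall n, borel_pseudometric (d n).

Let d_pm n := borel_pseudometric_pseudometric (d_borel n).
Let p_gt0 : 0 < p. Proof. exact: lt_le_trans p_ge1. Qed.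
Let E : prod_topology X -> prod_topology X -> Prop := E_sum d p.

Variable c : R.
Hypothesis c_gt0 : 0 < c.
Hypothesis c_small : forall x y : forall n, X n,
  (forall n, d n (x n) (y n) `^ p < c) -> E x y.

Let near n (u v : X n) := d n u v `^ p < c.

(** In each coordinate a near pair realises at least half of the supremum when this is positive;
    such pairs form two sequences to which [c_small] applies. *)
Lemma close_pairs_summable : exists sigma : nat -> R,
  [/\ forall n, 0 <= sigma n, bounded_sums sigma &
      forall n u v, near u v -> d n u v `^ p <= sigma n].
Proof.
pose D n := [set t | exists u v : X n, near u v /\ t = d n u v `^ p].
have D0 n : D n 0.
  have [u _] := X_nonempty n; exists u, u.
  by rewrite /near (pseudometric_xx (d_pm n)) powR0 ?gt_eqF.
have Dsup n : has_sup (D n).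
  by split; [exists 0|exists c => _ [u [v [uv ->]]]; exact: ltW].
have sigma0 n : 0 <= sup (D n) by apply: sup_upper_bound.
have /choice_prod[ab Hab] : forall n, exists q : X n * X n,
    near q.1 q.2 /\ sup (D n) <= 2 * d n q.1 q.2 `^ p.
  move=> n; have [s0|] := ltP 0 (sup (D n)).
    have s20 : 0 < sup (D n) / 2 by rewrite divr_gt0.
    have [_ [u [v [uv ->]]] Hs] := sup_adherent s20 (Dsup n).
    by exists (u, v); split => //=; lra.
  have [u _] := X_nonempty n => s0; exists (u, u) => /=; split.
    by rewrite /near (pseudometric_xx (d_pm n)) powR0 ?gt_eqF.
  by rewrite (le_trans s0)// mulr_ge0// powR_ge0.
exists (fun n => sup (D n)); split => //.
  apply: (@bounded_sums_dom _ 0 _ (fun n => 2 * d n (ab n).1 (ab n).2 `^ p)).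
  - by move=> n; rewrite mulr_ge0// powR_ge0.
  - by move=> n _; exact: (Hab n).2.
  - apply: bounded_sumsZ => //; apply/(@E_sum_bounded R p X d
      (fun n => (ab n).1) (fun n => (ab n).2)); apply: c_small => n.
    exact: (Hab n).1.
by move=> n u v uv; apply: sup_upper_bound => //; exists u, v.
Qed.

(** If far pairs occur in finitely many coordinates only, altering these coordinates reduces any two
    points to the situation of [c_small]. *)
Lemma E0_reducible_or_trivial : borel_reducible E0 E \/ trivial_rel E.
Proof.
have [far|nfar] := pselect (forall N, exists2 n, (N <= n)%N &
    exists u v, c <= d n u v `^ p).
  by left; exact: E0_reducible far.
right=> x y; have [N HN] : exists N, forall n, (N <= n)%N -> forall u v : X n, near u v.
  apply: contrapT => nN; apply: nfar => N; apply: contrapT => nn; apply: nN; exists N.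
  move=> n Nn u v; rewrite /near ltNge; apply/negP => uv; apply: nn.
  by exists n => //; exists u, v.
pose y' n := if (n < N)%N then x n else y n.
have /E_sum_bounded xy' : E x y'.
  apply: c_small => n; rewrite /y'; case: ltnP => [_|/HN]; last exact.
  by rewrite (pseudometric_xx (d_pm n)) powR0 ?gt_eqF.
apply/E_sum_bounded; apply: (bounded_sums_dom (m := N) _ _ xy').
  by move=> n; exact: powR_ge0.
by move=> n Nn; rewrite /y' ltnNge Nn.
Qed.

Hypothesis delta_summable : series_converges (fun n => (delta (d n) `^ p)%E).

(** The class of [x n] is coded by a row with a single true bit, at the first [i] such that [x n] is
    near [s n i]. A row being eventually false, a change in finitely many coordinates alters
    finitely many bits. *)
Lemma reducible_to_E0 : borel_reducible E E0.
Proof.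
have [m1 [r [rsep r0 rsum]]] := summable_radii p_ge1 delta_summable.
have [sigma [sigma0 sigma_sum sigmaP]] := close_pairs_summable.
have [|m2 Hm2] := bounded_sums_small _ rsum c_gt0; first by move=> n; exact: powR_ge0.
(* Makes [near] transitive: two near steps cost at most twice [sigma n] times the constant of
   [powR_addle], hence less than [c]. *)
have c'0 : 0 < c / (2 `^ p * 2) by rewrite divr_gt0// mulr_gt0// powR_gt0.
have [m3 Hm3] := bounded_sums_small sigma0 sigma_sum c'0.
pose N0 := maxn m1 (maxn m2 m3).
have near_sym n u v : near (n := n) u v -> near v u.
  by rewrite /near (pseudometric_sym (d_pm n)).
have near_trans n u v w : (N0 <= n)%N -> near (n := n) u v -> near v w -> near u w.
  rewrite !geq_max => /and3P[_ _ /Hm3]; rewrite ltr_pdivlMr ?mulr_gt0 ?powR_gt0//.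
  move=> sc /sigmaP uv /sigmaP vw; rewrite /near; apply: le_lt_trans sc.
  apply: (le_trans (powR_le p_ge1 _ (pseudometric_triangle (d_pm n) u v w))).
    exact: pseudometric_ge0.
  apply: (le_trans (powR_addle p_ge1 _ _)); try exact: pseudometric_ge0.
  rewrite [leRHS]mulrC -mulrA ler_wpM2l ?powR_ge0//; lra.
have /choice_prod[s Hs] : forall n, exists s : nat -> X n, (N0 <= n)%N ->
    forall u, exists i, near u (s i).
  move=> n; have [Nn|nN] := leqP N0 n; last first.
    by have [u _] := X_nonempty n; exists (fun=> u).
  move: (Nn); rewrite !geq_max => /and3P[/rsep[S cS Sr] /Hm2 rc _].
  have [|s Ss] := countable_enum cS.
    by have [u _] := X_nonempty n; have [s Ss _] := Sr u; exists s.
  exists s => _ u; have [a + ua] := Sr u; rewrite Ss => -[i _ ia].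
  exists i; rewrite /near ia (le_lt_trans _ rc)//.
  by apply: (powR_le p_ge1); [exact: pseudometric_ge0|exact: ltW].
pose bit n k (u : X n) := near u (s n k) && [forall j : 'I_k, ~~ near u (s n j)].
pose theta (x : prod_topology X) : cantor_space := fun l =>
  if pickle_inv l is Some (n, k) then (N0 <= n)%N && bit n k (x n) else false.
have bit_ex n u : (N0 <= n)%N -> exists k, bit n k u.
  move=> Nn; case: (ex_minnP (Hs n Nn u)) => k uk kmin; exists k.
  rewrite /bit uk; apply/forallP => j; apply/negP => /kmin.
  by rewrite leqNgt ltn_ord.
have bit_late n u : (N0 <= n)%N -> exists K, forall k, (K <= k)%N -> bit n k u = false.
  move=> Nn; have [i ui] := Hs n Nn u; exists i.+1 => k ik.
  by apply/negP => /andP[_ /forallP/(_ (Ordinal ik))]; rewrite /= ui.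
exists theta.
  apply: borel_fun_prod => [_|l]; first exact: bool_countable_base.
  rewrite /theta; case: pickle_inv => [[n k]|]; last first.
    by apply: borel_fun_continuous; exact: cst_continuous.
  case: (N0 <= n)%N => /=; last by apply: borel_fun_continuous; exact: cst_continuous.
  have near_borel j : borel_set [set u | near u (s n j)].
    have cp : (c `^ p^-1) `^ p = c by rewrite -powRrM mulVf ?gt_eqF// powRr1// ltW.
    rewrite (_ : [set _ | _] = [set u | d n u (s n j) < c `^ p^-1]).
      exact: ((borel_fun_realP _).2 (borel_dist d_borel (s n j)) _).1.
    have nearE u : near u (s n j) = (d n u (s n j) < c `^ p^-1).
      rewrite -(powR_lt p_ge1 (pseudometric_ge0 (d_pm n) _ _) (powR_ge0 _ _)).
      by rewrite cp.
    by apply/seteqP; split=> u /=; rewrite nearE.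
  have bit_borel : borel_fun (bit n k).
    rewrite (_ : bit n k = fun u => if bit n k u then true else false); last first.
      by apply/funext => u; case: (bit n k u).
    apply: borel_fun_if.
    rewrite (_ : [set _ | _] = [set u | near u (s n k)] `&`
        \bigcap_j (if (j < k)%N then ~` [set u | near u (s n j)] else setT)).
      apply: borel_setI => //; apply: borel_setI_countable => j.
      by case: ifP => _; [exact: borel_setC|exact: borel_setT].
    apply/seteqP; split=> u; rewrite /bit /=.
      move=> /andP[uk /forallP uj]; split=> // j _; case: ifP => // jk.
      by apply/negP; exact: (uj (Ordinal jk)).
    move=> [-> uj]; apply/forallP => j; have := uj j Logic.I.
    by rewrite ltn_ord => /negP.
  have proj_borel : borel_fun (fun x : prod_topology X => x n).
    by apply: borel_fun_continuous; exact: proj_continuous.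
  exact: (borel_fun_comp proj_borel bit_borel).
move=> x y; split=> [/E_sum_bounded xy|[m xy]]; last first.
  (* Only finitely many rows have a bit coded below [m]. *)
  have [n1 Hn1] : exists n1, forall n k : nat, (n1 <= n)%N -> (m <= pickle (n, k))%N.
    exists (\max_(l < m) (odflt (0, 0)%N (pickle_inv (val l))).1).+1 => n k.
    rewrite leqNgt => nk; rewrite leqNgt; apply: contra nk => lm; rewrite ltnS.
    have := @leq_bigmax _ (fun l : 'I_m => (odflt (0, 0)%N (pickle_inv (val l))).1)
      (Ordinal lm).
    by rewrite /= pickleK_inv.
  apply/E_sum_bounded; apply: (@bounded_sums_dom _ (maxn N0 n1) _ sigma) => //.
  move=> n; rewrite geq_max => /andP[Nn n1n]; apply: sigmaP.
  have [k xk] := bit_ex n (x n) Nn.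
  have := xy _ (Hn1 n k n1n); rewrite /theta pickleK_inv Nn xk /= => /esym yk.
  move: xk yk => /andP[xk _] /andP[/near_sym yk _].
  exact: near_trans Nn xk yk.
have [|m4 Hm4] := bounded_sums_small _ xy c_gt0; first by move=> n; exact: powR_ge0.
have /choice[K HK] : forall n, exists K, (N0 <= n)%N -> forall k, (K <= k)%N ->
    bit n k (x n) = false /\ bit n k (y n) = false.
  move=> n; have [Nn|] := leqP N0 n; last by exists 0%N.
  have [K1 HK1] := bit_late n (x n) Nn; have [K2 HK2] := bit_late n (y n) Nn.
  exists (maxn K1 K2) => _ k; rewrite geq_max => /andP[k1 k2].
  by rewrite HK1// HK2.
(* Rows from [m4] on agree, and the earlier ones are false from [M] on, so only finitely many codes
   can differ. *)
pose M := \max_(n < m4) K n.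
exists (\max_(nk : 'I_m4 * 'I_M) pickle (val nk.1, val nk.2)).+1 => l lM.
rewrite /theta; case lnk: (pickle_inv l) => [[n k]|//].
have lE : l = pickle (n, k) by have := @pickle_invK (nat * nat)%type l; rewrite lnk.
have [Nn|//] := leqP N0 n; rewrite /=.
have [m4n|nm4] := leqP m4 n.
  have nxy := Hm4 n m4n.
  have nE v : near (x n) v = near (y n) v.
    apply/idP/idP => [xv|yv].
      exact: near_trans Nn (near_sym _ _ _ nxy) xv.
    exact: near_trans Nn nxy yv.
  by rewrite /bit nE; congr (_ && _); apply: eq_forallb => j; rewrite nE.
have [kM|Mk] := ltnP k M; last first.
  have nK : (K n <= k)%N.
    by apply: leq_trans Mk; exact: (@leq_bigmax _ (fun n : 'I_m4 => K n) (Ordinal nm4)).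
  by have [-> ->] := HK n Nn k nK.
have := @leq_bigmax _ (fun nk : 'I_m4 * 'I_M => pickle (val nk.1, val nk.2))
  (Ordinal nm4, Ordinal kM).
by rewrite /= -lE leqNgt lM.
Qed.

End E0_dichotomy.

(** * The three equivalences *)

Lemma not_cond_l1 (R : realType) (X : nat -> Type) (d : forall n, X n -> X n -> R) (p : R) :
  ~ cond_l1 d p -> exists2 c, 0 < c & forall x y : forall n, X n,
    (forall n, d n (x n) (y n) `^ p < c) -> E_sum d p x y.
Proof.
move=> nl1; apply: contrapT => nc; apply: nl1 => c c0; apply: contrapT => nxy.
apply: nc; exists c => // x y xyc; rewrite /E_sum ltey; apply/eqP => xyoo.
by apply: nxy; exists x, y.
Qed.

Theorem corollary4p1 (R : realType) (X : nat -> topologicalType)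
    (d : forall n, X n -> X n -> R) (p : R)
    (X_polish : forall n, polish R (X n))
    (X_nonempty : forall n, [set: X n] !=set0)
    (d_borel : forall n, borel_pseudometric (d n))
    (p_ge1 : 1 <= p) :
  let E : prod_topology X -> prod_topology X -> Prop := E_sum d p in
  let delta_p n := (delta (d n) `^ p)%E in
  [/\ (series_converges delta_p /\ ~ cond_l1 d p)
        <-> (borel_bireducible E E0 \/ trivial_rel E),
      (series_converges delta_p /\ cond_l1 d p)
        <-> (borel_reducible (@RN_mod_l1 R) E /\ borel_reducible E (@E_c0 R p))
    & series_diverges delta_p <-> borel_reducible E1 E].
Proof.
move=> E delta_p.
have dvN : series_diverges delta_p <-> ~ series_converges delta_p.
  exact: series_divergesN.
have E1_E : ~ series_converges delta_p -> borel_reducible E1 E.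
  by move=> /dvN; exact: E1_reducible.
have reducible_to_c0 : series_converges delta_p -> borel_reducible E (@E_c0 R p).
  exact: c0_reducible.
have E1_c0 : ~ borel_reducible E1 (@E_c0 R p).
  apply: (@E1_not_reducible R (c0 R) (@c0_rat R)) => // v e; exact: c0_rat_dense.
(* Through this, a reduction of [E1] to [E0] would contradict [E1_c0]. *)
have E0_c0 : borel_reducible E0 (@E_c0 R p).
  pose a := @c0_rat R (pickle [:: 1 : rat]).
  have a0 : 0 < `|a|.
    apply: lt_le_trans (c0_norm_ub a 0).
    by rewrite c0_ratE pickleK /= rmorph1 normr1.
  apply: (@E0_reducible R (fun=> c0 R) (fun _ u v => `|u - v|) p p_ge1 _ _ (`|a| `^ p)).
  - by move=> _; exists a.
  - by move=> _; exact: (norm_metrizes _).1.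
  - exact: powR_gt0.
  - by move=> N; exists N => //; exists a, 0; rewrite subr0.
have E1_E0 : ~ borel_reducible E1 E0.
  by move=> /borel_reducible_trans/(_ E0_c0).
have l1_E0 := @l1_not_reducible R.
have l1_E : cond_l1 d p -> borel_reducible (@RN_mod_l1 R) E.
  exact: l1_reducible.
have nl1_E0 : series_converges delta_p -> ~ cond_l1 d p -> borel_reducible E E0.
  move=> dc /not_cond_l1[c c0 Hc].
  exact: (reducible_to_E0 p_ge1 X_nonempty d_borel c0 Hc dc).
split.
- split=> [[dc nl1]|].
    have [c c0 Hc] := not_cond_l1 nl1.
    have [?|?] := E0_reducible_or_trivial p_ge1 X_nonempty d_borel c0 Hc; last by right.
    by left; split => //; exact: nl1_E0.
  move=> [[EE0 E0E]|triv]; split.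
  + apply: contrapT => /E1_E E1E; apply: E1_E0; exact: borel_reducible_trans E1E EE0.
  + by move=> /l1_E l1E; apply: l1_E0; exact: borel_reducible_trans l1E EE0.
  (* Otherwise [E1] would reduce to a trivial relation, but the two constant points are not
     [E1]-equivalent. *)
  + apply: contrapT => /E1_E[theta _ HE].
    have [m] := (HE (fun=> true) (fun=> false)).2 (triv _ _).
    by move=> /(_ m (leqnn m) 0%N).
  + move=> /(_ 1 ltr01)[x [y [_ xyoo]]].
    by have := triv x y; rewrite /E /E_sum xyoo ltxx.
- split=> [[dc l1]|[l1E Ec0]]; first by split; [exact: l1_E|exact: reducible_to_c0].
  have dc : series_converges delta_p.
    apply: contrapT => /E1_E E1E; apply: E1_c0; exact: borel_reducible_trans E1E Ec0.
  split=> //; apply: contrapT => /(nl1_E0 dc) EE0.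
  by apply: l1_E0; exact: borel_reducible_trans l1E EE0.
- split=> [/dvN/E1_E//|E1E]; apply/dvN => /reducible_to_c0 Ec0.
  by apply: E1_c0; exact: borel_reducible_trans E1E Ec0.
Qed.
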